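(* There is an absolute constant $C>0$ such that for every sufficiently large prime $q$, every $d\geq 2$ with $d\mid(q-1)$ and every primitive Dirichlet character $\chi$ modulo $q$ of order $d$, $$\frac{1}{d}\sum_{1 \leq \ell \leq d-1} M(\chi^\ell) \leq C\,(\sqrt{q}\log q)\left(\sqrt{\frac{\log\log\log q}{\log \log q}} + \frac{1}{P^-(d)}\right).$$
   Context: For a Dirichlet character $\psi$ modulo $q$, $M(\psi) := \max_{1 \leq t \leq q} \left|\sum_{1\le n \leq t} \psi(n)\right|$. $P^-(d)$ denotes the smallest prime factor of $d$. *)

(* Defs.v *)
From Stdlib Require Import Reals List.
From Coquelicot Require Import Coquelicot.
From mathcomp Require Import ssreflect ssrbool ssrnat div prime.

Open Scope R_scope.

Definition is_dirichlet_char (q : nat) (chi : nat -> C) : Prop :=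
  (forall m n : nat, chi (m * n)%nat = Cmult (chi m) (chi n)) /\
  (forall n : nat, chi (n + q)%nat = chi n) /\
  (forall n : nat, chi n = 0%R <-> gcdn n q <> 1%nat).

Definition induced_from (q q' : nat) (chi : nat -> C) : Prop :=
  forall n : nat, gcdn n q = 1%nat -> n = 1 %[mod q'] -> chi n = 1%R.

Definition primitive_char (q : nat) (chi : nat -> C) : Prop :=
  is_dirichlet_char q chi /\
  forall q' : nat, (q' %| q)%N -> (q' < q)%N -> ~ induced_from q q' chi.

Definition char_pow (chi : nat -> C) (l : nat) : nat -> C :=
  fun n => Cpow (chi n) l.

Definition char_order (q : nat) (chi : nat -> C) (d : nat) : Prop :=
  (0 < d)%N /\
  (forall n : nat, gcdn n q = 1%nat -> Cpow (chi n) d = 1%R) /\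
  (forall k : nat, (0 < k)%N -> (k < d)%N ->
     exists n : nat, gcdn n q = 1%nat /\ Cpow (chi n) k <> 1%R).

Fixpoint char_sum (psi : nat -> C) (t : nat) : C :=
  match t with
  | O => 0%R
  | S t' => Cplus (char_sum psi t') (psi t)
  end.

Definition Mmax (q : nat) (psi : nat -> C) : R :=
  fold_right Rmax 0 (map (fun t => Cmod (char_sum psi t)) (seq 1 q)).

Definition sum_M (q d : nat) (chi : nat -> C) : R :=
  fold_right Rplus 0 (map (fun l => Mmax q (char_pow chi l)) (seq 1 (d - 1))).

Definition lpf (d : nat) : nat := pdiv d.

(* Main.v *)
Require Import Defs.
From Stdlib Require Import Reals List Lra Lia Psatz ClassicalEpsilon.
From Coquelicot Require Import Coquelicot.
From HB Require Import structures.
From mathcomp Require Import ssreflect ssrfun ssrbool eqtype ssrnat seq div prime choice fintype finfun bigop finset fingroup zmodp cyclic zify.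
Open Scope R_scope.

(** By the Pólya expansion, for [d] odd (so that [chi^l] is even) the maximum [M(chi^l)] is governed by
    sums of [conj (chi^l)(n) sin(2 PI n a) / n].  On minor arcs these are small by Kátai's bilinear
    argument; on major arcs they are linear combinations of logarithmic means of
    [conj (chi^l) xi] with [xi] odd of small conductor, and such a mean is exponentially small in the
    squared pretentious distance, with at most one exceptional [xi].  Hence [M(chi^l)] is
    small unless [l] lies in the set [S] of those residues modulo [d] for which [conj (chi^l)] pretends
    to be (the conjugate of) an odd character of small conductor.  A set [S] with more than
    [d / P^-(d)] elements generates [Z/dZ], and it does so in [O(d / #|S|)] steps, so a dense [S] yields
    a relation between a sum of [j + 1] and a sum of [j + 2] of its elements; by the triangle
    inequality the same character then pretends to be both an even and an odd character of
    controlled conductor, which is impossible by the bound [L(1 + 1/T, Psi) << log m] for a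
    nontrivial character [Psi] modulo [m].  This bounds the density of [S] by
    [O(sqrt (log log log q / log log q)) + 1 / P^-(d)].  For [d] even the theorem is the
    Pólya-Vinogradov inequality. *)

(** * Real and complex finite sums *)

(** Write [T] for log q and [u] for log [T]. The main term is one balance. A product of k
    characters, each within squared distance [32 * ln u] of an odd character, lies within k^2 times
    that of a character of parity (-1)^k, while an odd, hence nontrivial, character of modulus m
    keeps squared distance about [u] - log log m from 1. A relation of length d / #|S| is therefore
    impossible once (d / #|S|)^2 log u is small against [u]; this is the density sqrt(log u / u).
    The threshold has size log u because a logarithmic mean gains only exp(-distance^2 / 8) and a
    fixed power of [u] has to be gained outside [S]. There the bound is T / sqrt u: Kátai's argument
    gains the square root of the sum of 1/p over its primes, which run up to exp(T^(1/128)), so that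
    this sum has order [u]. Conductors stay below about T^(1/128), so that all nonexceptional
    characters together cost O(T / u). Distances use p^(-1-1/T) in place of a sharp cutoff because
    prime sums with these weights can be read off from a Dirichlet series: partial summation bounds
    the series, and a sieve identity relates it to the finite Euler product. *)

Fact RplusA : associative Rplus. Proof. by move=> x y z; rewrite Rplus_assoc. Qed.
Fact RmultA : associative Rmult. Proof. by move=> x y z; rewrite Rmult_assoc. Qed.
Fact CplusA : associative Cplus. Proof. by move=> x y z; rewrite Cplus_assoc. Qed.
Fact CmultA : associative Cmult. Proof. by move=> x y z; rewrite Cmult_assoc. Qed.
HB.instance Definition _ := Monoid.isComLaw.Build R 0 Rplus RplusA Rplus_comm Rplus_0_l.
HB.instance Definition _ := Monoid.isComLaw.Build R 1 Rmult RmultA Rmult_comm Rmult_1_l.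
HB.instance Definition _ := Monoid.isMulLaw.Build R 0 Rmult Rmult_0_l Rmult_0_r.
HB.instance Definition _ := Monoid.isAddLaw.Build R Rmult Rplus Rmult_plus_distr_r Rmult_plus_distr_l.
HB.instance Definition _ := Monoid.isComLaw.Build C (RtoC 0) Cplus CplusA Cplus_comm Cplus_0_l.
HB.instance Definition _ := Monoid.isComLaw.Build C (RtoC 1) Cmult CmultA Cmult_comm Cmult_1_l.
HB.instance Definition _ := Monoid.isMulLaw.Build C (RtoC 0) Cmult Cmult_0_l Cmult_0_r.
HB.instance Definition _ := Monoid.isAddLaw.Build C Cmult Cplus Cmult_plus_distr_r Cmult_plus_distr_l.

Reserved Notation "\Rsum_ ( i <- r | P ) F" (at level 41, F at level 41, i, r at level 60).
Reserved Notation "\Rsum_ ( m <= i < n | P ) F" (at level 41, F at level 41, i, m, n at level 60).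
Reserved Notation "\Rsum_ ( m <= i < n ) F" (at level 41, F at level 41, i, m, n at level 60).
Reserved Notation "\Rsum_ ( i | P ) F" (at level 41, F at level 41, i at level 60).
Reserved Notation "\Csum_ ( i <- r | P ) F" (at level 41, F at level 41, i, r at level 60).
Reserved Notation "\Csum_ ( m <= i < n | P ) F" (at level 41, F at level 41, i, m, n at level 60).
Reserved Notation "\Csum_ ( m <= i < n ) F" (at level 41, F at level 41, i, m, n at level 60).
Reserved Notation "\Csum_ ( i | P ) F" (at level 41, F at level 41, i at level 60).
Notation "\Rsum_ ( i <- r | P ) F" := (\big[Rplus/0%R]_(i <- r | P%B) F%R) : R_scope.
Notation "\Rsum_ ( m <= i < n | P ) F" := (\big[Rplus/0%R]_(m <= i < n | P%B) F%R) : R_scope.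
Notation "\Rsum_ ( m <= i < n ) F" := (\big[Rplus/0%R]_(m <= i < n) F%R) : R_scope.
Notation "\Rsum_ ( i | P ) F" := (\big[Rplus/0%R]_(i | P%B) F%R) : R_scope.
Notation "\Csum_ ( i <- r | P ) F" := (\big[Cplus/RtoC 0%R]_(i <- r | P%B) F%C) : C_scope.
Notation "\Csum_ ( m <= i < n | P ) F" := (\big[Cplus/RtoC 0%R]_(m <= i < n | P%B) F%C) : C_scope.
Notation "\Csum_ ( m <= i < n ) F" := (\big[Cplus/RtoC 0%R]_(m <= i < n) F%C) : C_scope.
Notation "\Csum_ ( i | P ) F" := (\big[Cplus/RtoC 0%R]_(i | P%B) F%C) : C_scope.

Lemma Rsum_le (I : Type) (r : seq I) (P : pred I) (F G : I -> R) :
  (forall i, P i -> F i <= G i) -> \Rsum_(i <- r | P i) F i <= \Rsum_(i <- r | P i) G i.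
Proof.
move=> H; elim/big_rec2: _ => [|i x y Pi xy]; first lra.
by have := H i Pi; lra.
Qed.

Lemma Rsum_le_in (I : eqType) (r : seq I) (P : pred I) (F G : I -> R) :
  (forall i, i \in r -> P i -> F i <= G i) ->
  \Rsum_(i <- r | P i) F i <= \Rsum_(i <- r | P i) G i.
Proof.
move=> H; rewrite big_seq_cond [in X in _ <= X]big_seq_cond.
by apply: Rsum_le => i /andP[]; apply: H.
Qed.

Lemma Rsum_le_nat (m k : nat) (P : pred nat) (F G : nat -> R) :
  (forall i, (m <= i < k)%N -> P i -> F i <= G i) ->
  \Rsum_(m <= i < k | P i) F i <= \Rsum_(m <= i < k | P i) G i.
Proof. by move=> H; apply: Rsum_le_in => i; rewrite mem_index_iota; apply: H. Qed.

Lemma Rsum_ge0 (I : Type) (r : seq I) (P : pred I) (F : I -> R) :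
  (forall i, P i -> 0 <= F i) -> 0 <= \Rsum_(i <- r | P i) F i.
Proof.
move=> H; elim/big_rec: _ => [|i x Pi xy]; first lra.
by have := H i Pi; lra.
Qed.

Lemma Rsum_le_sub (I : Type) (r : seq I) (P Q : pred I) (F : I -> R) :
  (forall i, P i -> Q i) -> (forall i, Q i -> 0 <= F i) ->
  \Rsum_(i <- r | P i) F i <= \Rsum_(i <- r | Q i) F i.
Proof.
move=> PQ F0; rewrite big_mkcond [in X in _ <= X]big_mkcond; apply: Rsum_le => i _.
have := PQ i; have := F0 i; case: (P i); case: (Q i) => // h1 h2; try lra; last exact: h1.
by have := h2 isT.
Qed.

Lemma Cmod_sum (I : Type) (r : seq I) (P : pred I) (F : I -> C) :
  Cmod (\Csum_(i <- r | P i) F i)%C <= \Rsum_(i <- r | P i) Cmod (F i).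
Proof.
elim/big_rec2: _ => [|i x y Pi xy]; first by rewrite Cmod_0; lra.
by have := Cmod_triangle (F i) y; lra.
Qed.

Lemma Cmod_sum_le (I : Type) (r : seq I) (P : pred I) (F : I -> C) B :
  \Rsum_(i <- r | P i) Cmod (F i) <= B -> Cmod (\Csum_(i <- r | P i) F i)%C <= B.
Proof. exact: Rle_trans (Cmod_sum I r P F). Qed.

Lemma Cmod_add_le (x y : C) B : Cmod x + Cmod y <= B -> Cmod (x + y)%C <= B.
Proof. exact: Rle_trans (Cmod_triangle x y). Qed.

Lemma RtoC_sum (I : Type) (r : seq I) (P : pred I) (F : I -> R) :
  RtoC (\Rsum_(i <- r | P i) F i) = (\Csum_(i <- r | P i) RtoC (F i))%C.
Proof. exact: (big_morph RtoC RtoC_plus). Qed.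

Lemma Re_sum (I : Type) (r : seq I) (P : pred I) (F : I -> C) :
  Re (\Csum_(i <- r | P i) F i)%C = \Rsum_(i <- r | P i) Re (F i).
Proof. exact: (big_morph Re (fun x y => erefl)). Qed.

Lemma Cconj_sum (I : Type) (r : seq I) (P : pred I) (F : I -> C) :
  Cconj (\Csum_(i <- r | P i) F i)%C = (\Csum_(i <- r | P i) Cconj (F i))%C.
Proof.
apply: (big_morph Cconj); last by rewrite /Cconj /RtoC /= Ropp_0.
by move=> x y; rewrite /Cconj /Cplus /=; f_equal; lra.
Qed.

Lemma Rsum_opp (I : Type) (r : seq I) (P : pred I) (F : I -> R) :
  \Rsum_(i <- r | P i) (- F i) = - \Rsum_(i <- r | P i) F i.
Proof. by rewrite (big_morph Ropp Ropp_plus_distr Ropp_0). Qed.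

Lemma Csum_opp (I : Type) (r : seq I) (P : pred I) (F : I -> C) :
  (\Csum_(i <- r | P i) (- F i) = - \Csum_(i <- r | P i) F i)%C.
Proof.
symmetry; apply: (big_morph Copp); last by rewrite /Copp /RtoC /= Ropp_0.
by move=> x y; rewrite /Copp /Cplus /=; f_equal; lra.
Qed.

Lemma Rsum_sub (I : Type) (r : seq I) (P : pred I) (F G : I -> R) :
  \Rsum_(i <- r | P i) (F i - G i) = \Rsum_(i <- r | P i) F i - \Rsum_(i <- r | P i) G i.
Proof. by rewrite /Rminus -Rsum_opp -big_split. Qed.

Lemma Csum_sub (I : Type) (r : seq I) (P : pred I) (F G : I -> C) :
  (\Csum_(i <- r | P i) (F i - G i) =
   \Csum_(i <- r | P i) F i - \Csum_(i <- r | P i) G i)%C.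
Proof. by rewrite /Cminus -Csum_opp -big_split. Qed.

Lemma Rsum_const (I : Type) (r : seq I) (P : pred I) (c : R) :
  \Rsum_(i <- r | P i) c = INR (count P r) * c.
Proof.
elim: r => [|x r IH]; first by rewrite big_nil /=; lra.
have -> : count P (x :: r) = (P x + count P r)%N by [].
by rewrite big_cons IH; case: ifP => _; rewrite ?add0n // add1n S_INR; lra.
Qed.

Lemma Rsum_CS (I : Type) (r : seq I) (P : pred I) (F G : I -> R) :
  (\Rsum_(i <- r | P i) F i * G i) ^ 2 <=
  (\Rsum_(i <- r | P i) F i ^ 2) * (\Rsum_(i <- r | P i) G i ^ 2).
Proof.
set A := \Rsum_(i <- r | P i) F i ^ 2; set B := \Rsum_(i <- r | P i) (F i * G i).
set D := \Rsum_(i <- r | P i) G i ^ 2.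
have key t u : 0 <= t ^ 2 * A + 2 * t * u * B + u ^ 2 * D.
  have -> : t ^ 2 * A + 2 * t * u * B + u ^ 2 * D = \Rsum_(i <- r | P i) (t * F i + u * G i) ^ 2.
    rewrite /A /B /D !big_distrr /= -!big_split /=.
    by apply: eq_bigr => i _; ring.
  by apply: Rsum_ge0 => i _; apply: pow2_ge_0.
have A0 : 0 <= A by apply: Rsum_ge0 => i _; apply: pow2_ge_0.
(* The form at (-B, A) equals A (A D - B^2), which settles A > 0. If A = 0, a nonzero B would make
   the value at t = -(D + 1) / B, u = 1 equal to -(D + 2). *)
case: (Req_dec A 0) => [A0'|A0']; last first.
  have := key (- B) A; nra.
suff -> : B = 0 by nra.
have D0 : 0 <= D by apply: Rsum_ge0 => i _; apply: pow2_ge_0.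
case: (Req_dec B 0) => // B0.
have := key (- (D + 1) / B) 1; rewrite A0'.
have -> : (- (D + 1) / B) ^ 2 * 0 + 2 * (- (D + 1) / B) * 1 * B + 1 ^ 2 * D = - (D + 2) by field.
lra.
Qed.

Lemma big_multiples (R' : Type) (idx : R') (op : Monoid.com_law idx) (g M : nat) (F : nat -> R') :
  (0 < g)%N ->
  \big[op/idx]_(1 <= n < M.+1 | (g %| n)%N) F n =
  \big[op/idx]_(1 <= m < (M %/ g).+1) F (g * m)%N.
Proof.
move=> g0; elim: M => [|M IH]; first by rewrite div0n !big_geq.
rewrite big_mkcond big_nat_recr //= -big_mkcond IH /= {IH} divnS //.
case: ifP => [dv|ndv] /=; last by rewrite add0n Monoid.mulm1.
have e : (g * (M %/ g).+1 = M.+1)%N.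
  have := divnS M g0; rewrite dv add1n => h; rewrite -h mulnC; exact: divnK.
by rewrite [RHS]big_nat_recr //= e.
Qed.

(** * Harmonic sums and the weights [n^(-1-1/T)] *)

Lemma INR_leq (m n : nat) : (m <= n)%N -> INR m <= INR n.
Proof. by move=> h; apply: le_INR; lia. Qed.

Lemma INR_pos (n : nat) : (0 < n)%N -> 0 < INR n.
Proof. by move=> h; apply: lt_0_INR; lia. Qed.

Lemma INR_ge1 (n : nat) : (0 < n)%N -> 1 <= INR n.
Proof. by move=> h; have := INR_leq 1 n h. Qed.

Lemma INRD (m n : nat) : INR (m + n)%N = INR m + INR n.
Proof. exact: plus_INR. Qed.

Lemma INRM (m n : nat) : INR (m * n)%N = INR m * INR n.
Proof. exact: mult_INR. Qed.

Lemma inv_INR_ge0 (n : nat) : 0 <= / INR n.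
Proof.
case: n => [|n]; first by rewrite Rinv_0; lra.
by apply/Rlt_le/Rinv_0_lt_compat/INR_pos.
Qed.

Lemma exp_mono (x y : R) : x <= y -> exp x <= exp y.
Proof. by case=> [h|->]; [left; apply: exp_increasing | right]. Qed.

Lemma ln_mono (x y : R) : 0 < x -> x <= y -> ln x <= ln y.
Proof. by move=> x0 [h|->]; [left; apply: ln_increasing | right]. Qed.

Lemma ln_INR_ge0 (n : nat) : 0 <= ln (INR n).
Proof.
case: n => [|n]; first by rewrite /= /ln; case: (Rlt_dec 0 0) => h; [exfalso; lra | right].
by rewrite -ln_1; apply: ln_mono; [lra | apply: INR_ge1].
Qed.

Lemma ln_le_sub1 (x : R) : 0 < x -> ln x <= x - 1.
Proof. by move=> x0; have := exp_ineq1_le (ln x); rewrite exp_ln //; lra. Qed.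

Lemma ln_succ_sub_ge (n : nat) : (0 < n)%N -> / INR n.+1 <= ln (INR n.+1) - ln (INR n).
Proof.
move=> n0; have n0' := INR_pos _ n0; have h : 0 < INR n.+1 by apply: INR_pos.
have := ln_le_sub1 (INR n / INR n.+1) (Rdiv_lt_0_compat _ _ n0' h).
rewrite ln_div //; have -> : INR n / INR n.+1 - 1 = - / INR n.+1; last by lra.
by rewrite S_INR in h *; field; lra.
Qed.

Lemma ln_succ_sub_le (n : nat) : (0 < n)%N -> ln (INR n.+1) - ln (INR n) <= / INR n.
Proof.
move=> n0; have n0' := INR_pos _ n0; have h : 0 < INR n.+1 by apply: INR_pos.
have := ln_le_sub1 (INR n.+1 / INR n) (Rdiv_lt_0_compat _ _ h n0').
rewrite ln_div //; have -> : INR n.+1 / INR n - 1 = / INR n; last by lra.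
by rewrite S_INR; field; lra.
Qed.

Definition hsum (N : nat) : R := \Rsum_(1 <= n < N.+1) / INR n.

Lemma hsumS (N : nat) : hsum N.+1 = hsum N + / INR N.+1.
Proof. by rewrite /hsum big_nat_recr. Qed.

Lemma hsum0 : hsum 0 = 0.
Proof. by rewrite /hsum big_geq. Qed.

Lemma hsum_ge_ln (N : nat) : ln (INR N + 1) <= hsum N.
Proof.
elim: N => [|N IH]; first by rewrite hsum0 /= Rplus_0_l ln_1; lra.
rewrite hsumS; have := ln_succ_sub_le N.+1 isT; rewrite -S_INR in IH.
by rewrite -S_INR; lra.
Qed.

Lemma hsum_le_ln (N : nat) : hsum N <= 1 + ln (INR N).
Proof.
elim: N => [|[|N] IH]; first by rewrite hsum0; have := ln_INR_ge0 0; lra.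
  by rewrite hsumS hsum0 /= ln_1 Rinv_1; lra.
by rewrite hsumS; have := ln_succ_sub_ge N.+1 isT; lra.
Qed.

Lemma hsum_mono (M N : nat) : (M <= N)%N -> hsum M <= hsum N.
Proof.
move=> /subnKC <-; elim: (N - M)%N => [|k IH]; first by rewrite addn0; lra.
by rewrite addnS hsumS; have := inv_INR_ge0 (M + k).+1; lra.
Qed.

Lemma hsum_ge0 (N : nat) : 0 <= hsum N.
Proof. by rewrite -hsum0; apply: hsum_mono. Qed.

Lemma hsum_sub (M N : nat) : (M <= N)%N ->
  \Rsum_(M.+1 <= n < N.+1) / INR n = hsum N - hsum M.
Proof. by move=> MN; rewrite /hsum [X in X - _](big_cat_nat (n := M.+1)) //=; lra. Qed.

Lemma INR_divn_lt (N p : nat) : (0 < p)%N -> INR N / INR p < INR (N %/ p) + 1.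
Proof.
move=> p0; have p0' := INR_pos _ p0; apply: (Rmult_lt_reg_r (INR p)) => //.
have -> : INR N / INR p * INR p = INR N by field; lra.
rewrite -S_INR -INRM; apply: lt_INR.
by have := ltn_ceil N p0; lia.
Qed.

Lemma INR_divn_le (N p : nat) : (0 < p)%N -> INR (N %/ p) <= INR N / INR p.
Proof.
move=> p0; have p0' := INR_pos _ p0; apply: (Rmult_le_reg_r (INR p)) => //.
have -> : INR N / INR p * INR p = INR N by field; lra.
by rewrite -INRM; apply: INR_leq; apply: leq_trunc_div.
Qed.

(** Logarithmic sums hardly notice a division of the range by p: the loss is about log p, however
    large [N] is. Kátai's argument rests on this when it replaces N / p by [N]. *)
Lemma hsum_sub_divn (N p : nat) : (0 < p)%N -> hsum N - hsum (N %/ p) <= 1 + ln (INR p).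
Proof.
move=> p0; have p0' := INR_pos _ p0.
case: N => [|N]; first by rewrite div0n hsum0; have := ln_INR_ge0 p; lra.
have N0 : 0 < INR N.+1 by apply: INR_pos.
have h1 := hsum_le_ln N.+1; have h2 := hsum_ge_ln (N.+1 %/ p).
have := ln_mono (INR N.+1 / INR p) (INR (N.+1 %/ p) + 1) (Rdiv_lt_0_compat _ _ N0 p0')
  (Rlt_le _ _ (INR_divn_lt _ _ p0)).
by rewrite ln_div //; lra.
Qed.

Definition wt (T : R) (n : nat) : R := exp (- (1 + / T) * ln (INR n)).

Lemma wt_pos (T : R) (n : nat) : 0 < wt T n.
Proof. exact: exp_pos. Qed.

Lemma wt1 (T : R) : wt T 1 = 1.
Proof. by rewrite /wt /= ln_1 Rmult_0_r exp_0. Qed.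

Lemma wtM (T : R) (m n : nat) : (0 < m)%N -> (0 < n)%N -> wt T (m * n) = wt T m * wt T n.
Proof.
move=> m0 n0; rewrite /wt -exp_plus INRM ln_mult; try exact: INR_pos.
by congr exp; ring.
Qed.

Lemma wt_split (T : R) (n : nat) : (0 < n)%N -> wt T n = / INR n * exp (- (ln (INR n) / T)).
Proof.
move=> n0; rewrite -[X in / X * _](exp_ln (INR n)); last exact: INR_pos.
by rewrite -exp_Ropp -exp_plus /wt; congr exp; rewrite /Rdiv; ring.
Qed.

Lemma wt_le_inv (T : R) (n : nat) : 0 < T -> (0 < n)%N -> wt T n <= / INR n.
Proof.
move=> T0 n0; rewrite wt_split // -{2}(Rmult_1_r (/ INR n)).
apply: Rmult_le_compat_l; first exact: inv_INR_ge0.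
rewrite -exp_0; apply: exp_mono.
by have := Rdiv_le_0_compat _ _ (ln_INR_ge0 n) T0; lra.
Qed.

(** n^(-1/T) stays above 1/e as long as log n <= T, so on the range of interest a nonnegative sum
    with weights 1/n is at most e times the same sum with the weights of the Dirichlet series. *)
Lemma wt_ge_inv (T : R) (n : nat) : 0 < T -> (0 < n)%N -> ln (INR n) <= T ->
  / INR n <= exp 1 * wt T n.
Proof.
move=> T0 n0 nT; rewrite wt_split //.
have -> : exp 1 * (/ INR n * exp (- (ln (INR n) / T))) = / INR n * exp (1 - ln (INR n) / T).
  by rewrite /Rminus exp_plus; ring.
rewrite -{1}(Rmult_1_r (/ INR n)); apply: Rmult_le_compat_l; first exact: inv_INR_ge0.
rewrite -{1}exp_0; apply: exp_mono.
suff : ln (INR n) / T <= 1 by lra.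
by apply: (Rmult_le_reg_r T) => //; rewrite /Rdiv Rmult_assoc Rinv_l; lra.
Qed.

(** This is n^(-1/T), and [- T * pw T] is an antiderivative of x^(-1-1/T). The two lemmas below that
    compare [wt] with differences of [pw] are the integral test. *)
Definition pw (T : R) (n : nat) : R := exp (- (ln (INR n) / T)).

Lemma pw_pos T n : 0 < pw T n. Proof. exact: exp_pos. Qed.

Lemma wt_le_pw (T : R) (n : nat) : 0 < T -> (0 < n)%N -> wt T n.+1 <= T * (pw T n - pw T n.+1).
Proof.
move=> T0 n0; rewrite wt_split // -/(pw T n.+1).
have := ln_succ_sub_ge n n0 => h.
have e : pw T n = pw T n.+1 * exp ((ln (INR n.+1) - ln (INR n)) / T).
  by rewrite /pw -exp_plus; congr exp; rewrite /Rdiv; ring.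
have := exp_ineq1_le ((ln (INR n.+1) - ln (INR n)) / T) => h2.
have h3 : / INR n.+1 <= T * (exp ((ln (INR n.+1) - ln (INR n)) / T) - 1).
  apply: (Rle_trans _ _ _ h); apply: (Rle_trans _ (T * ((ln (INR n.+1) - ln (INR n)) / T))).
    by right; field; lra.
  by apply: Rmult_le_compat_l; lra.
by have := Rmult_le_compat_r _ _ _ (Rlt_le _ _ (pw_pos T n.+1)) h3; rewrite e; lra.
Qed.

Lemma wt_ge_pw (T : R) (n : nat) : 0 < T -> (0 < n)%N -> T * (pw T n - pw T n.+1) <= wt T n.
Proof.
move=> T0 n0; rewrite wt_split // -/(pw T n).
have := ln_succ_sub_le n n0 => h.
have e : pw T n.+1 = pw T n * exp (- ((ln (INR n.+1) - ln (INR n)) / T)).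
  by rewrite /pw -exp_plus; congr exp; rewrite /Rdiv; ring.
have := exp_ineq1_le (- ((ln (INR n.+1) - ln (INR n)) / T)) => h2.
have h3 : T * (1 - exp (- ((ln (INR n.+1) - ln (INR n)) / T))) <= / INR n.
  apply: Rle_trans; last exact: h.
  apply: (Rle_trans _ (T * ((ln (INR n.+1) - ln (INR n)) / T))); last by right; field; lra.
  by apply: Rmult_le_compat_l; lra.
by have := Rmult_le_compat_r _ _ _ (Rlt_le _ _ (pw_pos T n)) h3; rewrite e; lra.
Qed.

Lemma wt_tail (T : R) (M N : nat) : 0 < T -> (0 < M)%N ->
  \Rsum_(M.+1 <= n < N.+1) wt T n <= T * pw T M.
Proof.
move=> T0 M0.
suff H k : \Rsum_(M.+1 <= n < (M + k).+1) wt T n <= T * (pw T M - pw T (M + k)%N).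
  case: (leqP M N) => [/subnKC <-|NM].
    by have := H (N - M)%N; have := pw_pos T (M + (N - M)); nra.
  by rewrite big_geq; [have := pw_pos T M; nra | lia].
elim: k => [|k IH]; first by rewrite addn0 big_geq //; lra.
rewrite addnS big_nat_recr /=; last by lia.
by have := wt_le_pw T (M + k) T0; rewrite addn_gt0 M0 => /(_ isT); lra.
Qed.

Lemma wt_sum_le (T : R) (N : nat) : 0 < T -> \Rsum_(1 <= n < N.+1) wt T n <= 1 + T.
Proof.
move=> T0; case: N => [|N]; first by rewrite big_geq //; lra.
rewrite big_nat_recl //= wt1; have := wt_tail T 1 N.+1 T0 isT.
by rewrite big_add1 /= /pw /= ln_1 /Rdiv Rmult_0_l Ropp_0 exp_0; lra.
Qed.

Lemma wt_sum_ge (T : R) (N : nat) : 0 < T -> T * (1 - pw T N.+1) <= \Rsum_(1 <= n < N.+1) wt T n.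
Proof.
move=> T0; elim: N => [|N IH].
  by rewrite big_geq // /pw /= ln_1 /Rdiv Rmult_0_l Ropp_0 exp_0; lra.
by rewrite big_nat_recr //=; have := wt_ge_pw T N.+1 T0 isT; lra.
Qed.

(** * A truncated Euler product *)

(** Recursion on [y] rather than a condition on the prime factors: the sieve below advances one
    integer at a time, and at a composite one nothing changes. *)
Fixpoint rough (y n : nat) : bool :=
  if y is y'.+1 then rough y' n && ~~ (prime y && (y %| n)%N) else true.

Lemma roughP (y n p : nat) : rough y n -> prime p -> (p <= y)%N -> ~~ (p %| n)%N.
Proof.
elim: y => [|y IH] /=; first by move=> _ pp; rewrite leqn0 => /eqP p0; rewrite p0 in pp.
move=> /andP[h1 h2] pp; rewrite leq_eqVlt => /orP[/eqP e|h]; last exact: IH.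
by move: h2; rewrite -e pp.
Qed.

Lemma rough_gt (y n : nat) : (1 < n)%N -> rough y n -> (y < n)%N.
Proof.
move=> n1 r; rewrite ltnNge; apply/negP => ny.
have := roughP _ _ _ r (pdiv_prime n1) (leq_trans (pdiv_leq (ltnW n1)) ny).
by rewrite pdiv_dvd.
Qed.

Lemma rough1 (y : nat) : rough y 1.
Proof.
elim: y => //= y ->; rewrite dvdn1 /=; apply/negP => /andP[pp /eqP e].
by rewrite e in pp.
Qed.

Lemma rough_prime_mul (y p m : nat) : prime p -> (y < p)%N -> rough y (p * m) = rough y m.
Proof.
move=> pp; elim: y => //= y IH yp; rewrite IH ?(ltnW yp) //; congr (_ && ~~ _).
case py: (prime y.+1) => //=; rewrite Euclid_dvdM // dvdn_prime2 //.
by rewrite (ltn_eqF yp).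
Qed.

Lemma INR_unbounded (x : R) : exists n : nat, (0 < n)%N /\ x <= INR n.
Proof.
have [n hn] := INR_archimed 1 (Rmax x 1) Rlt_0_1.
exists n; have := Rmax_l x 1; have := Rmax_r x 1 => h1 h2; split; last lra.
by case: n hn => //=; lra.
Qed.

Lemma pw_anti (T : R) (m n : nat) : 0 < T -> (0 < m)%N -> (m <= n)%N -> pw T n <= pw T m.
Proof.
move=> T0 m0 mn; apply: exp_mono; apply: Ropp_le_contravar.
apply: Rmult_le_compat_r; first by left; apply: Rinv_0_lt_compat.
by apply: ln_mono; [apply: INR_pos | apply: INR_leq].
Qed.

Lemma pw_small (T e : R) : 0 < T -> 0 < e -> exists Z : nat, (0 < Z)%N /\ pw T Z <= e.
Proof.
move=> T0 e0; have [Z [Z0 hZ]] := INR_unbounded (exp (- (T * ln e))).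
exists Z; split=> //; rewrite /pw -[X in _ <= X]exp_ln //; apply: exp_mono.
have h := ln_mono _ _ (exp_pos _) hZ; rewrite ln_exp in h.
apply: (Rmult_le_reg_r T) => //.
have -> : - (ln (INR Z) / T) * T = - ln (INR Z) by field; lra.
lra.
Qed.

Section Euler.
Variables (T : R) (a : nat -> C).
Hypothesis T0 : 0 < T.
Hypothesis aM : forall m n, (0 < m)%N -> (0 < n)%N -> a (m * n)%N = (a m * a n)%C.
Hypothesis a1 : a 1%N = RtoC 1.
Hypothesis a_le : forall n, (0 < n)%N -> Cmod (a n) <= wt T n.

Let G (y X : nat) : C := (\Csum_(1 <= n < X.+1 | rough y n) a n)%C.

(** The [y]-rough multiples of the prime [y.+1] are exactly its products with [y]-rough numbers up
    to X / (y + 1), because a prime factor above [y] creates no divisor among the primes up to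
    [y]. *)
Lemma rough_sumS (y X : nat) : prime y.+1 ->
  G y.+1 X = (G y X - a y.+1 * G y (X %/ y.+1))%C.
Proof.
move=> pp; rewrite {2}/G (bigID (fun n => (y.+1 %| n)%N)) /=.
have -> : (\Csum_(1 <= i < X.+1 | rough y i && (y.+1 %| i)%N) a i = a y.+1 * G y (X %/ y.+1))%C.
  rewrite big_mkcondl /= big_multiples // /G big_distrr /= [RHS]big_mkcond /=.
  apply: eq_big_nat => m /andP[m0 _]; rewrite rough_prime_mul //.
  by case: ifP => _ //; rewrite aM.
rewrite /G /= pp /=; ring.
Qed.

Lemma rough_sum_diff (y X Z : nat) : (0 < Z)%N -> (Z <= X)%N ->
  Cmod (G y X - G y Z)%C <= T * pw T Z.
Proof.
move=> Z0 ZX; rewrite /G (big_cat_nat (n := Z.+1)) //=.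
set A := \big[_/_]_(1 <= _ < _ | _) _; set B := \big[_/_]_(_ <= _ < _ | _) _.
have -> : (A + B - A)%C = B by ring.
apply: Cmod_sum_le; apply: Rle_trans; last exact: (wt_tail T Z X T0 Z0).
apply: (Rle_trans _ (\Rsum_(Z.+1 <= n < X.+1 | rough y n) wt T n)).
  by apply: Rsum_le_nat => n /andP[nZ _] _; apply: a_le; lia.
by apply: Rsum_le_sub => // n _; left; apply: wt_pos.
Qed.

Lemma Cmod_a_le1 (n : nat) : (0 < n)%N -> Cmod (a n) <= 1.
Proof.
move=> n0; apply: Rle_trans (a_le _ n0) _; apply: Rle_trans (wt_le_inv _ _ T0 n0) _.
by rewrite -Rinv_1; apply: Rinv_le_contravar; [lra | apply: INR_ge1].
Qed.

Lemma Cmod_1sub_le2 (z : C) : Cmod z <= 1 -> Cmod (1 - z)%C <= 2.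
Proof.
move=> h; have := Cmod_triangle 1%R (- z)%C; rewrite Cmod_opp Cmod_1 -/(Cminus _ _).
lra.
Qed.

(** Multiplying by 1 - a p removes the multiples of p, except that the removed sum runs to X instead
    of X / p. As X / p >= Z, this mismatch is a tail beyond [Z]. Since |1 - a p| <= 2, a step
    doubles the error and adds one tail, whence 2^y - 1; the factor is harmless, since [Z] can grow
    with [y] fixed. *)
Lemma euler_rough (y X Z : nat) : (0 < Z)%N -> (Z * y.+1 <= X)%N ->
  Cmod (\big[Cmult/RtoC 1]_(1 <= p < y.+1 | prime p) (1 - a p) *
        (\Csum_(1 <= n < X.+1) a n) - G y X)%C <= (2 ^ y - 1) * (T * pw T Z).
Proof.
move=> Z0; elim: y => [|y IH] ZX.
  rewrite big_geq // Cmult_1_l /G /=; set A := \big[_/_]_(_ <= _ < _) _.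
  have -> : (A - A)%C = RtoC 0 by ring.
  by rewrite Cmod_0; lra.
have {}IH := IH (leq_trans (leq_mul (leqnn Z) (leqnSn y.+1)) ZX).
rewrite big_mkcond big_nat_recr //= -big_mkcond /=.
have pw0 := pw_pos T Z.
have y2 : 1 <= 2 ^ y by apply: pow_R1_Rle; lra.
case: ifP => pp; last first.
  have -> : G y.+1 X = G y X by rewrite /G /= pp; under eq_bigl do rewrite andbT.
  rewrite Cmult_1_r; apply: (Rle_trans _ _ _ IH).
  by apply: Rmult_le_compat_r; [nra | rewrite /=; lra].
rewrite rough_sumS //.
move: IH; set Pr := \big[_/_]_(_ <= _ < _ | _) _; set F := \big[_/_]_(_ <= _ < _) _ => IH.
have -> : (Pr * (1 - a y.+1) * F - (G y X - a y.+1 * G y (X %/ y.+1)) =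
  (1 - a y.+1) * (Pr * F - G y X) + - (a y.+1 * (G y X - G y (X %/ y.+1))))%C by ring.
apply: Cmod_add_le; rewrite Cmod_opp !Cmod_mult.
have h1 := Cmod_1sub_le2 _ (Cmod_a_le1 y.+1 isT).
have h2 := Cmod_a_le1 y.+1 isT.
have ZX' : (Z <= X %/ y.+1)%N.
  by rewrite leq_divRL //; apply: leq_trans ZX; rewrite leq_mul.
have h3 := rough_sum_diff y X (X %/ y.+1) (leq_trans Z0 ZX') (leq_div _ _).
have h4 := pw_anti T _ _ T0 Z0 ZX'.
have h5 : Cmod (G y X - G y (X %/ y.+1))%C <= T * pw T Z.
  by apply: (Rle_trans _ _ _ h3); apply: Rmult_le_compat_l; lra.
have c0 z := Cmod_ge_0 z.
have := Rmult_le_compat _ _ _ _ (c0 _) (c0 _) h1 IH.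
have := Rmult_le_compat _ _ _ _ (c0 _) (c0 _) h2 h5.
by rewrite /=; lra.
Qed.

(** After the sieve only n = 1 and n > y are left, and the latter form a tail of at most 1/2; the
    sieve error is kept to 1/4. What matters about 3/4 is that it is below 1, so that the product
    times the sum stays away from 0. *)
Lemma euler_approx (y : nat) : (0 < y)%N -> T * pw T y <= / 2 ->
  exists X0 : nat, forall X, (X0 <= X)%N ->
  Cmod (\big[Cmult/RtoC 1]_(1 <= p < y.+1 | prime p) (1 - a p) *
        (\Csum_(1 <= n < X.+1) a n) - 1)%C <= 3 / 4.
Proof.
move=> y0 hy; have y2 : 1 <= 2 ^ y by apply: pow_R1_Rle; lra.
have [Z [Z0 hZ]] := pw_small T (/ (4 * 2 ^ y * T)) T0 ltac:(apply: Rinv_0_lt_compat; nra).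
exists (Z * y.+1)%N => X ZX; have := euler_rough y X Z Z0 ZX.
move: (\big[_/_]_(_ <= _ < _ | _) _) (\big[_/_]_(_ <= _ < _) _) => Pr F h.
have {}h : Cmod (Pr * F - G y X)%C <= / 4.
  apply: (Rle_trans _ _ _ h); apply: (Rle_trans _ (2 ^ y * (T * / (4 * 2 ^ y * T)))).
    have := pw_pos T Z => pw0.
    apply: Rmult_le_compat; [lra | nra | lra |].
    by apply: Rmult_le_compat_l; lra.
  by right; field; lra.
have X0 : (0 < X)%N by apply: leq_trans ZX; rewrite muln_gt0 Z0.
have h2 : Cmod (G y X - 1)%C <= / 2.
  rewrite /G big_mkcond big_nat_recl //= rough1 a1.
  set S := \big[_/_]_(_ <= _ < _) _; have -> : (1 + S - 1)%C = S by ring.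
  apply: Cmod_sum_le; apply: Rle_trans; last exact: hy.
  case: (leqP X y) => Xy.
    rewrite big1_seq; first by have := pw_pos T y; nra.
    move=> i; rewrite mem_index_iota => /andP[_ iX]; case: ifP; rewrite ?Cmod_0 //.
    by move=> r; have := rough_gt y i.+1 ltac:(lia) r; lia.
  rewrite (big_cat_nat (n := y)) //=; last lia.
  rewrite big1_seq; last first.
    move=> i; rewrite mem_index_iota => /andP[_ iX]; case: ifP; rewrite ?Cmod_0 //.
    by move=> r; have := rough_gt y i.+1 ltac:(lia) r; lia.
  rewrite Rplus_0_l; apply: Rle_trans (wt_tail T y X T0 y0).
  rewrite [X in _ <= X]big_add1 /=; apply: Rsum_le_nat => i /andP[iy _] _.
  by case: ifP => _; [apply: a_le | rewrite Cmod_0; left; apply: wt_pos].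
have -> : (Pr * F - 1 = (Pr * F - G y X) + (G y X - 1))%C by ring.
by apply: Cmod_add_le; lra.
Qed.
End Euler.

Lemma sum_primes_inv_sq (y : nat) : \Rsum_(1 <= p < y.+1 | prime p) (/ INR p) ^ 2 <= 1.
Proof.
suff H : \Rsum_(1 <= p < y.+2 | prime p) (/ INR p) ^ 2 <= 1 - / INR y.+1.
  move: H; rewrite big_mkcond big_nat_recr //= -big_mkcond /=.
  have := inv_INR_ge0 y.+1; have : 0 <= (if prime y.+1 then (/ INR y.+1) ^ 2 else 0).
    by case: ifP => _; [apply: pow2_ge_0 | lra].
  rewrite /=; lra.
elim: y => [|y IH].
  by rewrite big_mkcond big_nat1 /= Rinv_1; lra.
have -> : \Rsum_(1 <= p < y.+3 | prime p) (/ INR p) ^ 2 =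
    \Rsum_(1 <= p < y.+2 | prime p) (/ INR p) ^ 2 + (if prime y.+2 then (/ INR y.+2) ^ 2 else 0).
  by rewrite big_mkcond big_nat_recr // -big_mkcond.
have p1 := INR_pos y.+1 isT; have e : INR y.+2 = INR y.+1 + 1 by rewrite -S_INR.
have h : (/ INR y.+2) ^ 2 <= / INR y.+1 - / INR y.+2.
  rewrite e; set x := INR y.+1 in p1 *.
  have -> : / x - / (x + 1) = / (x * (x + 1)) by field; lra.
  have -> : (/ (x + 1)) ^ 2 = / ((x + 1) * (x + 1)) by field; lra.
  apply: Rinv_le_contravar; nra.
have : 0 <= (/ INR y.+2) ^ 2 by apply: pow2_ge_0.
case: ifP => _; lra.
Qed.

Lemma sum_primes_wt_sq (T : R) (y : nat) : 0 < T ->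
  \Rsum_(1 <= p < y.+1 | prime p) (wt T p) ^ 2 <= 1.
Proof.
move=> T0; apply: Rle_trans (sum_primes_inv_sq y); apply: Rsum_le => p pp.
have := wt_le_inv T p T0 (prime_gt0 pp); have := wt_pos T p => h1 h2.
by apply: pow_incr; lra.
Qed.

Lemma Cmod_1sub_le_exp (z : C) : Cmod (1 - z)%C <= exp (- Re z + (Cmod z) ^ 2 / 2).
Proof.
have c0 := Cmod_ge_0 (1 - z)%C; have e0 := exp_pos (- Re z + (Cmod z) ^ 2 / 2).
apply: (Rsqr_incr_0_var); last lra.
rewrite /Rsqr -exp_plus.
have -> : Cmod (1 - z)%C * Cmod (1 - z)%C = 1 + (- 2 * Re z + (Cmod z) ^ 2).
  have -> : Cmod (1 - z)%C * Cmod (1 - z)%C = Cmod (1 - z)%C ^ 2 by ring.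
  by rewrite !Cmod2_alt /Re /Im /=; ring.
have := exp_ineq1_le (- 2 * Re z + (Cmod z) ^ 2).
by have -> : - Re z + (Cmod z) ^ 2 / 2 + (- Re z + (Cmod z) ^ 2 / 2) = - 2 * Re z + Cmod z ^ 2 by field.
Qed.

Lemma Cmod_prod (I : Type) (r : seq I) (P : pred I) (F : I -> C) :
  Cmod (\big[Cmult/RtoC 1]_(i <- r | P i) F i) = \big[Rmult/1]_(i <- r | P i) Cmod (F i).
Proof. exact: (big_morph Cmod Cmod_mult Cmod_1). Qed.

Lemma Rprod_le (I : Type) (r : seq I) (P : pred I) (F G : I -> R) :
  (forall i, P i -> 0 <= F i <= G i) ->
  0 <= \big[Rmult/1]_(i <- r | P i) F i <= \big[Rmult/1]_(i <- r | P i) G i.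
Proof.
move=> H; elim/big_rec2: _ => [|i x y Pi xy]; first lra.
have h := H i Pi; split; first by apply: Rmult_le_pos; lra.
by apply: Rmult_le_compat; lra.
Qed.

Lemma exp_sum (I : Type) (r : seq I) (P : pred I) (F : I -> R) :
  exp (\Rsum_(i <- r | P i) F i) = \big[Rmult/1]_(i <- r | P i) exp (F i).
Proof. exact: (big_morph exp exp_plus exp_0). Qed.

Lemma exp2_ge4 : 4 <= exp 2.
Proof.
have -> : 2 = 1 + 1 by lra.
by rewrite exp_plus; have := exp_ineq1_le 1; nra.
Qed.

(** The product of the 1 - a p times the sum is within 3/4 of 1, so a sum bounded by [B] forces the
    product to be at least 1 / (4 B). Its modulus is also at most exp(1/2 - S), S being the sum of
    Re (a p), because |1 - z|^2 = 1 - 2 Re z + |z|^2. Comparing logarithms leaves ln 4 + 1/2 <=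
    3. *)
Lemma sum_primes_Re_le (T : R) (a : nat -> C) (y : nat) (B : R) :
  0 < T -> (forall m n, (0 < m)%N -> (0 < n)%N -> a (m * n)%N = (a m * a n)%C) ->
  a 1%N = RtoC 1 -> (forall n, (0 < n)%N -> Cmod (a n) <= wt T n) ->
  (0 < y)%N -> T * pw T y <= / 2 -> 0 < B ->
  (forall X, Cmod (\Csum_(1 <= n < X.+1) a n)%C <= B) ->
  \Rsum_(1 <= p < y.+1 | prime p) Re (a p) <= ln B + 3.
Proof.
move=> T0 aM a1 a_le y0 hy B0 hB.
have [X0 /(_ X0 (leqnn _))] := euler_approx T a T0 aM a1 a_le y y0 hy.
have := hB X0; move: (\big[_/_]_(_ <= _ < _) _) => F hF.
set Pr := \big[_/_]_(_ <= _ < _ | _) _ => h.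
have h1 : / 4 <= Cmod Pr * Cmod F.
  rewrite -Cmod_mult; have := Cmod_triangle (Pr * F)%C (1 - Pr * F)%C.
  have -> : (Pr * F + (1 - Pr * F) = 1)%C by ring.
  have -> : (1 - Pr * F = - (Pr * F - 1))%C by ring.
  by rewrite Cmod_opp Cmod_1; lra.
set S := \Rsum_(_ <= _ < _ | _) _.
have h2 : Cmod Pr <= exp (- S + / 2).
  rewrite Cmod_prod; apply: Rle_trans.
    apply: (proj2 (Rprod_le _ _ _ _ (fun p => exp (- Re (a p) + (Cmod (a p)) ^ 2 / 2)) _)).
    by move=> p pp; split; [apply: Cmod_ge_0 | apply: Cmod_1sub_le_exp].
  rewrite -exp_sum; apply: exp_mono; rewrite big_split /= Rsum_opp -/S.
  suff : \Rsum_(1 <= p < y.+1 | prime p) (Cmod (a p) ^ 2 / 2) <= / 2 by rewrite /=; lra.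
  apply: (Rle_trans _ (\Rsum_(1 <= p < y.+1 | prime p) (/ 2 * wt T p ^ 2))).
    apply: Rsum_le => p pp; have := a_le p (prime_gt0 pp); have := Cmod_ge_0 (a p) => c0 c1.
    by have := pow_incr _ _ 2 (conj c0 c1); rewrite /=; lra.
  by rewrite -big_distrr /=; have := sum_primes_wt_sq T y T0; rewrite /=; lra.
have h3 : / 4 <= exp (- S + / 2) * B.
  apply: (Rle_trans _ _ _ h1); apply: Rmult_le_compat => //; exact: Cmod_ge_0.
have h4 : exp (S - / 2) <= 4 * B.
  have -> : S - / 2 = - (- S + / 2) by ring.
  have e0 := exp_pos (- S + / 2).
  rewrite exp_Ropp; apply: (Rmult_le_reg_l (exp (- S + / 2))) => //.
  by rewrite Rinv_r; lra.
have := ln_mono _ _ (exp_pos _) h4; rewrite ln_exp ln_mult; [| lra | lra].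
have := ln_mono 4 _ ltac:(lra) exp2_ge4; rewrite ln_exp; lra.
Qed.

Lemma sum_primes_wt_le (T : R) (y : nat) : 0 < T -> (0 < y)%N -> T * pw T y <= / 2 ->
  \Rsum_(1 <= p < y.+1 | prime p) wt T p <= ln (1 + T) + 3.
Proof.
move=> T0 y0 hy.
have := sum_primes_Re_le T (fun n => RtoC (wt T n)) y (1 + T) T0.
apply=> //; try lra.
- by move=> m n m0 n0; rewrite wtM // RtoC_mult.
- by rewrite wt1.
- by move=> n _; rewrite Cmod_R Rabs_pos_eq; [right | left; apply: wt_pos].
- move=> X; rewrite -RtoC_sum Cmod_R Rabs_pos_eq; first exact: wt_sum_le.
  by apply: Rsum_ge0 => n _; left; apply: wt_pos.
Qed.

Lemma exp_le_1sub (x : R) : 0 <= x <= / 2 -> exp (- x - 2 * x ^ 2) <= 1 - x.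
Proof.
move=> hx; have -> : - x - 2 * x ^ 2 = - (x + 2 * x ^ 2) by ring.
rewrite exp_Ropp; have h := exp_ineq1_le (x + 2 * x ^ 2).
have e0 := exp_pos (x + 2 * x ^ 2).
apply: (Rmult_le_reg_l (exp (x + 2 * x ^ 2))) => //; rewrite Rinv_r; last lra.
apply: (Rle_trans _ ((1 + (x + 2 * x ^ 2)) * (1 - x))); first nra.
by apply: Rmult_le_compat_r; lra.
Qed.

(** A converse for positive weights, in the manner of Mertens' theorem: the truncated series is at
    least T / 2, so the Euler product is O(1 / T), whereas each factor is at least exp(-w - 2 w^2)
    because w <= 1/2. *)
Lemma sum_primes_wt_ge (T : R) (y : nat) : 0 < T -> (0 < y)%N -> T * pw T y <= / 2 ->
  ln T - 4 <= \Rsum_(1 <= p < y.+1 | prime p) wt T p.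
Proof.
move=> T0 y0 hy.
have [Z [Z0 hZ]] := pw_small T (/ 2) T0 ltac:(lra).
have [X0 hX0] := euler_approx T (fun n => RtoC (wt T n)) T0
  (fun m n m0 n0 => eq_trans (f_equal RtoC (wtM T m n m0 n0)) (RtoC_mult _ _))
  (f_equal RtoC (wt1 T))
  (fun n _ => Req_le _ _ (eq_trans (Cmod_R _) (Rabs_pos_eq _ (Rlt_le _ _ (wt_pos T n))))) y y0 hy.
have := hX0 (X0 + Z)%N (leq_addr _ _); rewrite -RtoC_sum.
have -> : \big[Cmult/RtoC 1]_(1 <= p < y.+1 | prime p) (1 - RtoC (wt T p))%C =
    RtoC (\big[Rmult/1]_(1 <= p < y.+1 | prime p) (1 - wt T p)).
  rewrite (big_morph RtoC RtoC_mult (erefl (RtoC 1))).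
  by apply: eq_bigr => p _; rewrite RtoC_minus.
have h1 := wt_sum_ge T (X0 + Z) T0.
have h2 := pw_anti T Z (X0 + Z).+1 T0 Z0 ltac:(lia).
have {h1 h2} : T / 2 <= \Rsum_(1 <= n < (X0 + Z).+1) wt T n.
  by apply: Rle_trans h1; apply: Rmult_le_compat_l; lra.
move: (\big[_/_]_(_ <= _ < _) _) => F hF.
have := Rprod_le _ (index_iota 1 y.+1) prime (fun p => exp (- wt T p - 2 * wt T p ^ 2))
  (fun p => 1 - wt T p).
case.
  move=> p pp; split; first by left; apply: exp_pos.
  apply: exp_le_1sub; have := wt_pos T p; have := wt_le_inv T p T0 (prime_gt0 pp).
  have : / INR p <= / 2; last lra.
  apply: Rinv_le_contravar; first lra.
  by have := INR_leq 2 p (prime_gt1 pp); rewrite /=; lra.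
rewrite -exp_sum /Rminus big_split /= Rsum_opp.
have -> : \big[Rplus/0]_(1 <= i < y.+1 | prime i) (- (2 * (wt T i * (wt T i * 1)))) =
  - (2 * \Rsum_(1 <= p < y.+1 | prime p) wt T p ^ 2).
  by rewrite Rsum_opp big_distrr.
have := sum_primes_wt_sq T y T0; rewrite /=.
move: (\big[Rplus/0]_(1 <= i < y.+1 | prime i) (wt T i * (wt T i * 1))) => Q hQ.
move: (\big[Rplus/0]_(1 <= i < y.+1 | prime i) wt T i) => S.
move: (\big[Rmult/1]_(_ <= _ < _ | _) _) => Pr _ h3.
rewrite -RtoC_mult -RtoC_minus Cmod_R => /Rabs_le_between h4.
have h5 : exp (- S - 2) * (T / 2) <= 2.
  apply: (Rle_trans _ (Pr * F)); last lra.
  apply: Rmult_le_compat => //; [by left; apply: exp_pos | lra |].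
  by apply: Rle_trans h3; apply: exp_mono; lra.
have h6 : exp (- S - 2) <= exp (2 - ln T).
  rewrite /Rminus exp_plus (exp_plus 2) exp_Ropp (exp_Ropp (ln T)) exp_ln // -exp_Ropp -exp_plus.
  apply: (Rmult_le_reg_r T) => //.
  rewrite (Rmult_assoc (exp 2)) Rinv_l; last lra.
  have := exp2_ge4; rewrite /Rminus in h5; lra.
case: (Rle_lt_dec (ln T - 4) S) => // hS.
by have := exp_increasing (2 - ln T) (- S - 2) ltac:(lra); lra.
Qed.

(** * Dirichlet characters and the pretentious distance *)

(** A class that contains all Dirichlet characters of positive modulus and is closed under products
    and conjugation; the value 0 makes room for the nonunits. *)
Definition unimodular_mult (f : nat -> C) : Prop :=
  f 1%N = RtoC 1 /\ (forall m n, f (m * n)%N = (f m * f n)%C) /\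
  (forall n, f n = RtoC 0 \/ Cmod (f n) = 1).

(** The relation xi(-b) = -xi(b) without negative arguments: [a] stands for -b modulo [r]. It is
    also used for functions that are not characters, such as the sine restricted to residues. *)
Definition odd_char (r : nat) (xi : nat -> C) : Prop :=
  forall a b : nat, (r %| a + b)%N -> xi a = (- xi b)%C.

Lemma unimodular_mult_le1 f n : unimodular_mult f -> Cmod (f n) <= 1.
Proof. by case=> _ [_ /(_ n)[-> | ->]]; rewrite ?Cmod_0; lra. Qed.

Lemma unimodular_mult_pow f n k : unimodular_mult f -> f (n ^ k)%N = Cpow (f n) k.
Proof.
case=> f1 [fM _]; elim: k => [|k IH]; first by rewrite expn0 f1.
by rewrite expnS fM IH.
Qed.

Lemma unimodular_multM f g : unimodular_mult f -> unimodular_mult g ->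
  unimodular_mult (fun n => f n * g n)%C.
Proof.
move=> [f1 [fM fn]] [g1 [gM gn]]; split; first by rewrite f1 g1 Cmult_1_l.
split=> [m n|n]; first by rewrite fM gM; ring.
case: (fn n) => [->|h1]; first by left; rewrite Cmult_0_l.
case: (gn n) => [->|h2]; first by left; rewrite Cmult_0_r.
by right; rewrite Cmod_mult h1 h2 Rmult_1_l.
Qed.

Lemma Cmult_eq0 (x y : C) : (x * y)%C = RtoC 0 -> x = RtoC 0 \/ y = RtoC 0.
Proof.
move=> /(f_equal Cmod); rewrite Cmod_mult Cmod_0 => /Rmult_integral[] /Cmod_eq_0; first by left.
by right.
Qed.

Lemma Csub_eq0 (x y : C) : (x - y)%C = RtoC 0 -> x = y.
Proof. by move=> h; rewrite -(Cplus_0_l y) -h; ring. Qed.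

Lemma Cconj_mult (x y : C) : Cconj (x * y)%C = (Cconj x * Cconj y)%C.
Proof. by rewrite /Cconj /Cmult /=; f_equal; ring. Qed.

Lemma Cconj_R (x : R) : Cconj (RtoC x) = RtoC x.
Proof. by rewrite /Cconj /RtoC /= Ropp_0. Qed.

Lemma unimodular_multC f : unimodular_mult f -> unimodular_mult (fun n => Cconj (f n)).
Proof.
move=> [f1 [fM fn]]; split; first by rewrite f1 Cconj_R.
split=> [m n|n]; first by rewrite fM Cconj_mult.
case: (fn n) => [->|h1]; first by left; rewrite Cconj_R.
by right; rewrite Cmod_conj.
Qed.

Section Characters.
Variables (r : nat) (xi : nat -> C).
Hypotheses (r0 : (0 < r)%N) (xiP : is_dirichlet_char r xi).

Lemma char_mod n : xi n = xi (n %% r)%N.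
Proof.
case: xiP => _ [per _]; rewrite {1}(divn_eq n r); elim: (n %/ r)%N => [|k IH].
  by rewrite mul0n.
by rewrite mulSn -addnA addnC per.
Qed.

Lemma char_congr m n : m = n %[mod r] -> xi m = xi n.
Proof. by move=> e; rewrite char_mod e -char_mod. Qed.

Lemma char_one : xi 1%N = RtoC 1.
Proof.
case: xiP => mul [_ z]; have := mul 1%N 1%N; rewrite muln1 => h.
have nz : xi 1%N <> RtoC 0 by move/z; rewrite gcd1n.
have : (xi 1%N * (xi 1%N - 1) = 0)%C by rewrite Cmult_plus_distr_l -h; ring.
by case/Cmult_eq0 => // /Csub_eq0.
Qed.

Lemma char_pow_totient n : coprime n r -> Cpow (xi n) (totient r) = RtoC 1.
Proof.
move=> co; have := Euler_exp_totient co => e.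
rewrite -char_one -(char_congr _ _ e).
elim: (totient r) => [|k IH]; first by rewrite expn0 /= char_one.
by case: xiP => mul _; rewrite expnS mul -IH.
Qed.

Lemma char_unimodular : unimodular_mult xi.
Proof.
split; first exact: char_one.
case: xiP => mul [_ z]; split=> // n.
case: (Ceq_dec (xi n) 0); [by left|move=> nz; right].
have co : coprime n r by apply/eqP; case: (gcdn n r =P 1%N) => // h; case: nz; apply/z.
have := f_equal Cmod (char_pow_totient n co); rewrite Cmod_1.
have : (0 < totient r)%N by rewrite totient_gt0.
case: (totient r) => // k _; rewrite Cmod_pow => e.
have c0 := Cmod_ge_0 (xi n).
case: (Rtotal_order (Cmod (xi n)) 1) => [h|[//|h]].
  by have := pow_lt_1_compat _ k.+1 (conj c0 h) ltac:(lia); lra.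
by have := Rlt_pow_R1 _ k.+1 h ltac:(lia); lra.
Qed.

Lemma char_nz n : coprime n r -> Cmod (xi n) = 1.
Proof.
move=> co; case: char_unimodular => _ [_ /(_ n)[]] //.
by case: xiP => _ [_ z] /z; rewrite (eqP co).
Qed.

Lemma char_zero n : ~~ coprime n r -> xi n = RtoC 0.
Proof. by move=> /eqP h; case: xiP => _ [_ z]; apply/z. Qed.
End Characters.

Lemma big_mul_mod (R' : Type) (idx : R') (op : Monoid.com_law idx) (a r : nat) (F : nat -> R') :
  (0 < r)%N -> coprime a r ->
  \big[op/idx]_(0 <= n < r) F (a * n %% r)%N = \big[op/idx]_(0 <= n < r) F n.
Proof.
move=> r0 co; rewrite -(big_map (fun n => (a * n %% r)%N) xpredT F).
apply: perm_big.
have inj : {in index_iota 0 r &, injective (fun n => (a * n %% r)%N)}.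
  move=> m n; rewrite !mem_index_iota /= => mr nr /eqP.
  wlog mn : m n mr nr / (m <= n)%N.
    by move=> H; case: (leqP m n) => [|/ltnW] h; [exact: H | rewrite eq_sym => /(H _ _ nr mr h)].
  rewrite eq_sym eqn_mod_dvd ?leq_mul2l ?mn ?orbT // -mulnBr Gauss_dvdr; last by rewrite coprime_sym.
  move=> h; case: (posnP (n - m)) => [|h0]; first by lia.
  by have := dvdn_leq h0 h; lia.
have u : uniq [seq (a * n %% r)%N | n <- index_iota 0 r] by rewrite map_inj_in_uniq // iota_uniq.
apply: uniq_perm => //; first exact: iota_uniq.
have [||_ //] := uniq_min_size (s2 := index_iota 0 r) u; last by rewrite size_map.
by move=> x /mapP[n _ ->]; rewrite mem_index_iota /= ltn_pmod.
Qed.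

Definition nontrivial_char (r : nat) (xi : nat -> C) : Prop :=
  exists a, coprime a r /\ xi a <> RtoC 1.

Lemma odd_char_nontrivial r xi : (0 < r)%N -> is_dirichlet_char r xi -> odd_char r xi ->
  nontrivial_char r xi.
Proof.
move=> r0 xiP odd; exists r.-1; split.
  by case: r r0 {xiP odd} => // r _ /=; rewrite coprime_sym; apply: coprimeSn.
rewrite (odd r.-1 1%N); last by rewrite addn1 prednK.
by rewrite (char_one r) //; move=> [h]; lra.
Qed.

Lemma char_sum_period r xi : (0 < r)%N -> is_dirichlet_char r xi -> nontrivial_char r xi ->
  (\Csum_(0 <= n < r) xi n = 0)%C.
Proof.
move=> r0 xiP [a [co na]].
have e : (xi a * (\Csum_(0 <= n < r) xi n) = \Csum_(0 <= n < r) xi n)%C.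
  rewrite big_distrr /= -[RHS](big_mul_mod _ _ _ a r xi) //.
  by apply: eq_bigr => n _; rewrite -char_mod //; case: xiP => ->.
move: e; set S := \big[_/_]_(_ <= _ < _) _ => e.
have : ((xi a - 1) * S = 0)%C by rewrite Cmult_plus_distr_r e; ring.
by case/Cmult_eq0 => // /Csub_eq0.
Qed.

Lemma char_sum_bound r xi N : (0 < r)%N -> is_dirichlet_char r xi -> nontrivial_char r xi ->
  Cmod (\Csum_(0 <= n < N) xi n)%C <= INR r.
Proof.
move=> r0 xiP nt; elim/ltn_ind: N => N IH.
case: (leqP r N) => rN.
  rewrite (big_cat_nat (n := r)) //= char_sum_period // Cplus_0_l.
  rewrite -{1}(add0n r) big_addn.
  have -> : (\Csum_(0 <= i < N - r) xi (i + r)%N = \Csum_(0 <= i < N - r) xi i)%C.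
    by apply: eq_bigr => i _; case: xiP => _ [-> _].
  by apply: IH; lia.
apply: Cmod_sum_le.
apply: (Rle_trans _ (\Rsum_(0 <= n < N) 1)).
  by apply: Rsum_le => n _; apply: unimodular_mult_le1; apply: (char_unimodular r).
by rewrite Rsum_const count_predT size_iota subn0 Rmult_1_r; apply: INR_leq; lia.
Qed.

(** Partial summation. The induction is on the remainder after subtracting S b(M + k), with S the
    partial sum of [c]: its bound telescopes in [b], and the subtracted term contributes the missing
    B b(N). *)
Lemma abel_bound (c : nat -> C) (b : nat -> R) (B : R) (M N : nat) :
  (forall K, (M <= K)%N -> Cmod (\Csum_(M <= n < K) c n)%C <= B) ->
  (forall n, (M <= n)%N -> 0 <= b n.+1 <= b n) -> (M <= N)%N -> 0 <= b M ->
  Cmod (\Csum_(M <= n < N) (c n * RtoC (b n)))%C <= B * b M.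
Proof.
move=> hB hb MN bM.
have H k : Cmod ((\Csum_(M <= n < M + k) (c n * RtoC (b n))) -
                 (\Csum_(M <= n < M + k) c n) * RtoC (b (M + k)%N))%C <= B * (b M - b (M + k)%N)
           /\ 0 <= b (M + k)%N.
  elim: k => [|k [IH bk]].
    rewrite addn0 !big_geq // Cmult_0_l.
    have -> : (0 - 0 = 0)%C by ring.
    by rewrite Cmod_0; split; lra.
  have h1 := hB (M + k).+1 ltac:(lia); have h2 := hb (M + k)%N (leq_addr _ _).
  move: h1; rewrite addnS !big_nat_recr /=; try by lia.
  set S := (\Csum_(M <= n < M + k) c n)%C in IH *.
  set U := (\Csum_(M <= n < M + k) (c n * RtoC (b n)))%C in IH *.
  move=> h1; split; last lra.
  have -> : (U + c (M + k)%N * b (M + k)%N - (S + c (M + k)%N) * b (M + k).+1 =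
    (U - S * b (M + k)%N) + (S + c (M + k)%N) * RtoC (b (M + k)%N - b (M + k).+1))%C.
    by rewrite RtoC_minus; ring.
  apply: Cmod_add_le; rewrite Cmod_mult Cmod_R Rabs_pos_eq; last lra.
  have := Rmult_le_compat_r (b (M + k)%N - b (M + k).+1) _ _ ltac:(lra) h1; lra.
have [] := H (N - M)%N; have := hB N MN; rewrite subnKC //.
set S := (\Csum_(M <= n < N) c n)%C; set U := (\Csum_(M <= n < N) (c n * RtoC (b n)))%C => h1 h2 h3.
have -> : U = (U - S * RtoC (b N) + S * RtoC (b N))%C by ring.
apply: Cmod_add_le; rewrite Cmod_mult Cmod_R Rabs_pos_eq //.
have := Rmult_le_compat_r (b N) _ _ h3 h1; lra.
Qed.

Lemma wt_anti (T : R) (n : nat) : 0 < T -> (0 < n)%N -> wt T n.+1 <= wt T n.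
Proof.
move=> T0 n0; apply: exp_mono; have := ln_mono _ _ (INR_pos _ n0) (INR_leq _ _ (leqnSn n)).
have : 0 < / T by apply: Rinv_0_lt_compat.
nra.
Qed.

(** This is L(1 + 1/T, xi) << log r, uniformly in [T]. Terms below [r] are estimated trivially; from
    [r] on the character sums are bounded by [r] and the weights by 1/r, so partial summation leaves
    at most 1. *)
Lemma char_wt_sum_bound (T : R) r xi X : 0 < T -> (0 < r)%N -> is_dirichlet_char r xi ->
  nontrivial_char r xi ->
  Cmod (\Csum_(1 <= n < X.+1) (xi n * RtoC (wt T n)))%C <= 2 + ln (INR r).
Proof.
move=> T0 r0 xiP nt.
have um := char_unimodular r xi r0 xiP.
have triv K : (K <= r)%N -> Cmod (\Csum_(1 <= n < K) (xi n * RtoC (wt T n)))%C <= 1 + ln (INR r).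
  move=> Kr; apply: Cmod_sum_le.
  apply: Rle_trans (hsum_le_ln r); apply: Rle_trans (hsum_mono K.-1 r ltac:(lia)).
  case: K Kr => [|K] _; first by rewrite big_geq //; apply: hsum_ge0.
  apply: Rsum_le_nat => n /andP[n0 _] _; rewrite Cmod_mult Cmod_R Rabs_pos_eq; last by left; apply: wt_pos.
  have := unimodular_mult_le1 xi n um; have := Cmod_ge_0 (xi n); have := wt_pos T n.
  have := wt_le_inv T n T0 n0; nra.
case: (leqP X.+1 r) => Xr; first by have := triv X.+1 Xr; lra.
rewrite (big_cat_nat (n := r)) //=; last lia.
apply: Cmod_add_le.
suff : Cmod (\Csum_(r <= i < X.+1) (xi i * RtoC (wt T i)))%C <= 1.
  by have := triv r (leqnn r); lra.
have := abel_bound xi (wt T) (INR r) r X.+1; move/(_ _ _ _ _)=> H.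
apply: (Rle_trans _ (INR r * wt T r)); first apply: H; try lia.
- move=> K rK; have := char_sum_bound r xi K r0 xiP nt.
  by rewrite (big_cat_nat (n := r)) //= char_sum_period // Cplus_0_l.
- by move=> n rn; split; [left; apply: wt_pos | apply: wt_anti => //; lia].
- by left; apply: wt_pos.
have := wt_le_inv T r T0 r0; have := INR_pos r r0 => h1 h2.
have := Rmult_le_compat_l _ _ _ (Rlt_le _ _ h1) h2; rewrite Rinv_r; lra.
Qed.

(** The weights alone sum to at least ln T - 4 over the primes, the real parts of xi to at most ln
    (2 + ln r) + 3. A nontrivial character of small modulus thus cannot stay close to 1. *)
Lemma sum_primes_char_ge (T : R) (y r : nat) xi : 0 < T -> (0 < y)%N -> T * pw T y <= / 2 ->
  (0 < r)%N -> is_dirichlet_char r xi -> nontrivial_char r xi ->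
  ln T - ln (2 + ln (INR r)) - 7 <=
  \Rsum_(1 <= p < y.+1 | prime p) (wt T p * (1 - Re (xi p))).
Proof.
move=> T0 y0 hy r0 xiP nt; have [x1 [xM xn]] := char_unimodular r xi r0 xiP.
have lr := ln_INR_ge0 r.
have := sum_primes_Re_le T (fun n => xi n * RtoC (wt T n))%C y (2 + ln (INR r)) T0.
move=> /(_ _ _ _ y0 hy) H.
have {}H : \Rsum_(1 <= p < y.+1 | prime p) Re (xi p * RtoC (wt T p))%C <= ln (2 + ln (INR r)) + 3.
  apply: H; last 1 first.
  - by move=> X; apply: (char_wt_sum_bound T r).
  - by move=> m n m0 n0; rewrite xM wtM // RtoC_mult; ring.
  - by rewrite x1 wt1 Cmult_1_l.
  - move=> n n0; rewrite Cmod_mult Cmod_R Rabs_pos_eq; last by left; apply: wt_pos.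
    have := unimodular_mult_le1 xi n (conj x1 (conj xM xn)); have := wt_pos T n; nra.
  - lra.
have := sum_primes_wt_ge T y T0 y0 hy.
have -> : \Rsum_(1 <= p < y.+1 | prime p) (wt T p * (1 - Re (xi p))) =
  \Rsum_(1 <= p < y.+1 | prime p) wt T p - \Rsum_(1 <= p < y.+1 | prime p) Re (xi p * RtoC (wt T p))%C.
  by rewrite -Rsum_sub; apply: eq_bigr => p _; rewrite /Re /=; ring.
lra.
Qed.

(* The square of a pretentious distance between [h] and [1], with weights [p^(-1-1/T)]
   in place of a cutoff of the weights [1/p] at [exp T]. *)
Definition dist2 (T : R) (y : nat) (h : nat -> C) : R :=
  \Rsum_(1 <= p < y.+1 | prime p) (wt T p * Cmod (1 - h p)%C ^ 2).

Lemma dist2_ge0 T y h : 0 <= dist2 T y h.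
Proof.
apply: Rsum_ge0 => p _; apply: Rmult_le_pos; first by left; apply: wt_pos.
exact: pow2_ge_0.
Qed.

(** A triangle inequality for the square roots, stated with squares. Pointwise (a + b)^2 <= (1 +
    1/k) a^2 + (1 + k) b^2, and these two weights turn k^2 E and E into exactly (k + 1)^2 E.
    Iteration makes k factors cost k^2. *)
Lemma dist2_mul T y h1 h2 (k : nat) E : (0 < k)%N ->
  (forall n, Cmod (h1 n) <= 1) ->
  dist2 T y h1 <= INR k ^ 2 * E -> dist2 T y h2 <= E ->
  dist2 T y (fun n => h1 n * h2 n)%C <= INR k.+1 ^ 2 * E.
Proof.
move=> k0 h1le d1 d2; have kp := INR_pos k k0; have ik := Rinv_0_lt_compat _ kp.
have E0 : 0 <= E by have := dist2_ge0 T y h2; lra.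
apply: (Rle_trans _ ((1 + / INR k) * dist2 T y h1 + (1 + INR k) * dist2 T y h2)); last first.
  have := Rmult_le_compat_l (1 + / INR k) _ _ ltac:(lra) d1.
  have := Rmult_le_compat_l (1 + INR k) _ _ ltac:(lra) d2.
  rewrite S_INR; have -> : (1 + / INR k) * (INR k ^ 2 * E) = (INR k ^ 2 + INR k) * E by field; lra.
  lra.
rewrite /dist2 !big_distrr /= -big_split /=; apply: Rsum_le => p _.
have w0 := wt_pos T p; have c1 := Cmod_ge_0 (1 - h1 p)%C; have c2 := Cmod_ge_0 (1 - h2 p)%C.
have tri : Cmod (1 - h1 p * h2 p)%C <= Cmod (1 - h1 p)%C + Cmod (1 - h2 p)%C.
  have -> : (1 - h1 p * h2 p = (1 - h1 p) + h1 p * (1 - h2 p))%C by ring.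
  apply: Cmod_add_le; rewrite Cmod_mult.
  have := h1le p; have := Cmod_ge_0 (h1 p); nra.
have c3 := Cmod_ge_0 (1 - h1 p * h2 p)%C.
move: tri c1 c2 c3; set u := Cmod (1 - h1 p * h2 p)%C; set a := Cmod (1 - h1 p)%C.
set b := Cmod (1 - h2 p)%C => tri a0 b0 u0.
have s1 : u ^ 2 <= (a + b) ^ 2 by apply: pow_incr; lra.
have s2 : (a + b) ^ 2 <= (1 + / INR k) * a ^ 2 + (1 + INR k) * b ^ 2.
  have h0 : 0 <= / INR k * (a - INR k * b) ^ 2.
    by apply: Rmult_le_pos; [lra | apply: pow2_ge_0].
  have : / INR k * (a - INR k * b) ^ 2 = / INR k * a ^ 2 - 2 * a * b + INR k * b ^ 2 by field; lra.
  lra.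
have := Rmult_le_compat_l _ _ _ (Rlt_le _ _ w0) (Rle_trans _ _ _ s1 s2).
rewrite /=; lra.
Qed.

Lemma Cmod_sq (z : C) : Cmod z ^ 2 = fst z ^ 2 + snd z ^ 2.
Proof. by rewrite Cmod2_alt. Qed.

(** When all moduli are 1, put z1 = f x1 and z2 = f x2: then 2 - 2 Re(z1 conj z2) = |z1 - z2|^2 <= 2
    |1 - z1|^2 + 2 |1 - z2|^2, and [f] cancels from z1 conj z2. If some value is 0, the distances
    equal to 1 pay for the left side. *)
Lemma one_sub_Re_le (f x1 x2 : C) : (f = RtoC 0 \/ Cmod f = 1) ->
  (x1 = RtoC 0 \/ Cmod x1 = 1) -> (x2 = RtoC 0 \/ Cmod x2 = 1) ->
  1 - Re (x1 * Cconj x2)%C <= Cmod (1 - f * x1)%C ^ 2 + Cmod (1 - f * x2)%C ^ 2.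
Proof.
move=> hf h1 h2.
have s0 z : 0 <= Cmod z ^ 2 by apply: pow2_ge_0.
have z0 : Cmod (1 - 0)%C ^ 2 = 1.
  have -> : (1 - 0 = 1)%C by ring.
  by rewrite Cmod_1; ring.
have le1 x : (x = RtoC 0 \/ Cmod x = 1) -> Cmod x <= 1 by case=> ->; rewrite ?Cmod_0; lra.
case: hf => [->|hf].
  rewrite !Cmult_0_l z0.
  have := re_le_Cmod (x1 * Cconj x2)%C; rewrite Cmod_mult Cmod_conj => /Rabs_le_between h.
  have := le1 _ h1; have := le1 _ h2; have := Cmod_ge_0 x1; have := Cmod_ge_0 x2; nra.
case: h1 => [->|h1].
  by rewrite Cmult_0_r Cmult_0_l z0 /=; have := s0 (1 - f * x2)%C; lra.
case: h2 => [->|h2].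
  by rewrite Cconj_R !Cmult_0_r z0 /=; have := s0 (1 - f * x1)%C; lra.
have e : (x1 * Cconj x2 = (f * x1) * Cconj (f * x2))%C.
  rewrite Cconj_mult; have -> : (f * x1 * (Cconj f * Cconj x2) = (f * Cconj f) * (x1 * Cconj x2))%C by ring.
  by rewrite -Cmod2_conj hf /= !Rmult_1_r Cmult_1_l.
rewrite e; have m1 : Cmod (f * x1)%C ^ 2 = 1 by rewrite Cmod_mult hf h1; ring.
have m2 : Cmod (f * x2)%C ^ 2 = 1 by rewrite Cmod_mult hf h2; ring.
move: (f * x1)%C (f * x2)%C m1 m2 => [a b] [c d]; rewrite !Cmod_sq /= => m1 m2.
have := pow2_ge_0 ((1 - a) + (1 - c)); have := pow2_ge_0 (b + d); rewrite /=.
nra.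
Qed.

Lemma is_char_mul r1 r2 x1 x2 : is_dirichlet_char r1 x1 -> is_dirichlet_char r2 x2 ->
  (0 < r1)%N -> (0 < r2)%N -> is_dirichlet_char (r1 * r2) (fun n => x1 n * x2 n)%C.
Proof.
move=> h1 h2 p1 p2; split; last split.
- by move=> m n; case: h1 => -> _; case: h2 => -> _; ring.
- move=> n; congr Cmult.
    by apply: (char_congr r1) => //; rewrite mulnC addnC modnMDl.
  by apply: (char_congr r2) => //; rewrite addnC modnMDl.
move=> n; have := coprimeMr n r1 r2; rewrite /coprime => e.
split.
  move=> /Cmult_eq0[]; [case: h1 => _ [_ z] /z | case: h2 => _ [_ z] /z];
  by move=> h /eqP; rewrite e => /andP[/eqP ? /eqP ?].
move/eqP; rewrite e negb_and => /orP[] h.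
  by rewrite (char_zero r1 x1) // Cmult_0_l.
by rewrite (char_zero r2 x2) // Cmult_0_r.
Qed.

Lemma is_char_conj r x : is_dirichlet_char r x -> is_dirichlet_char r (fun n => Cconj (x n)).
Proof.
case=> mul [per z]; split; last split.
- by move=> m n; rewrite mul Cconj_mult.
- by move=> n; rewrite per.
move=> n; rewrite -z; split=> [h|->]; last by rewrite Cconj_R.
by rewrite -(Cconj_conj (x n)) h Cconj_R.
Qed.

(** If [f] were close to the conjugates of both [x1] and [x2], then x1 conj x2 would be close to 1,
    which [sum_primes_char_ge] excludes. The bound depends on [r] only, so the large conductor of
    [f] costs nothing. *)
Lemma dist2_repulsion (T : R) (y r : nat) f x1 x2 : 0 < T -> (0 < y)%N -> T * pw T y <= / 2 ->
  unimodular_mult f -> unimodular_mult x1 -> unimodular_mult x2 -> (0 < r)%N ->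
  is_dirichlet_char r (fun n => x1 n * Cconj (x2 n))%C ->
  nontrivial_char r (fun n => x1 n * Cconj (x2 n))%C ->
  ln T - ln (2 + ln (INR r)) - 7 <=
  dist2 T y (fun n => f n * x1 n)%C + dist2 T y (fun n => f n * x2 n)%C.
Proof.
move=> T0 y0 hy [_ [_ fu]] [_ [_ u1]] [_ [_ u2]] r0 xP nt.
apply: (Rle_trans _ _ _ (sum_primes_char_ge T y r _ T0 y0 hy r0 xP nt)).
rewrite /dist2 -big_split /=; apply: Rsum_le => p _.
rewrite -Rmult_plus_distr_l; apply: Rmult_le_compat_l; first by left; apply: wt_pos.
exact: one_sub_Re_le.
Qed.

(** * Smooth sums of [1 * h] *)

Definition smooth (y n : nat) : bool := all (fun p => (p <= y)%N) (primes n).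

Definition divisor_sum (h : nat -> C) (n : nat) : C := (\Csum_(1 <= d < n.+1 | (d %| n)%N) h d)%C.

(** The sum 1 + z + ... + z^k in Horner form, that is, the value of [divisor_sum] at p^k when z = h
    p. *)
Fixpoint geom (z : C) (k : nat) : C := if k is k'.+1 then (1 + z * geom z k')%C else RtoC 1.

Lemma geom_le (z : C) (k : nat) : Cmod z <= 1 -> Cmod (geom z k) <= INR k + 1.
Proof.
move=> hz; elim: k => [|k IH]; first by rewrite /= Cmod_1; lra.
rewrite S_INR /=; apply: Cmod_add_le; rewrite Cmod_1 Cmod_mult.
have := Cmod_ge_0 z; have := Cmod_ge_0 (geom z k); nra.
Qed.

Lemma divisor_sum1 h : h 1%N = RtoC 1 -> divisor_sum h 1 = RtoC 1.
Proof. by move=> h1; rewrite /divisor_sum big_mkcond big_nat1 dvdnn. Qed.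

Lemma divisor_sum_prime_pow h p k m : (forall a b, h (a * b)%N = (h a * h b)%C) ->
  prime p -> (0 < m)%N -> ~~ (p %| m)%N ->
  divisor_sum h (p ^ k * m) = (geom (h p) k * divisor_sum h m)%C.
Proof.
move=> hM pp m0 pm; elim: k => [|k IH]; first by rewrite expn0 mul1n /= Cmult_1_l.
have p0 := prime_gt0 pp; have pk0 : (0 < p ^ k)%N by rewrite expn_gt0 p0.
have e : (p ^ k.+1 * m = p * (p ^ k * m))%N by rewrite expnS mulnA.
rewrite {1}/divisor_sum (bigID (fun d => (p %| d)%N)) /=.
have -> : (\Csum_(1 <= i < (p ^ k.+1 * m).+1 | (i %| p ^ k.+1 * m)%N && (p %| i)%N) h i =
   h p * divisor_sum h (p ^ k * m))%C.
  rewrite big_mkcondl big_multiples // e mulKn // /divisor_sum big_distrr /= [RHS]big_mkcond /=.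
  by apply: eq_bigr => d _; rewrite dvdn_pmul2l // hM.
have -> : (\Csum_(1 <= i < (p ^ k.+1 * m).+1 | (i %| p ^ k.+1 * m)%N && ~~ (p %| i)%N) h i =
   divisor_sum h m)%C.
  have hm : (m.+1 <= (p ^ k.+1 * m).+1)%N.
    by rewrite ltnS leq_pmull // expn_gt0 p0.
  rewrite /divisor_sum (big_nat_widen _ _ _ _ _ hm).
  apply: eq_bigl => i; apply/andP/andP => [[h1 h2]|[h1 h2]].
    have co : coprime i (p ^ k.+1) by rewrite coprime_sym coprimeXl // prime_coprime.
    have := h1; rewrite (Gauss_dvdr _ co) => h3; split=> //.
    by rewrite ltnS; apply: dvdn_leq.
  split; first by apply: dvdn_mull.
  by apply/negP => h3; case/negP: pm; apply: dvdn_trans h1.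
by rewrite IH /=; ring.
Qed.

Lemma smooth_prime_pow y p k m : prime p -> p = y.+1 -> (0 < m)%N -> ~~ (p %| m)%N ->
  smooth y.+1 (p ^ k * m) = smooth y m.
Proof.
move=> pp e m0 pm; have p0 := prime_gt0 pp; have pk0 : (0 < p ^ k)%N by rewrite expn_gt0 p0.
apply/allP/allP => H l.
  move=> lm; have := H l; rewrite primesM // lm orbT => /(_ isT).
  rewrite leq_eqVlt => /orP[/eqP le|//]; case/negP: pm.
  by move: lm; rewrite mem_primes -e in le *; rewrite le => /andP[_ /andP[]].
rewrite primesM // => /orP[|/H]; last by lia.
case: k {pk0} => [|k]; first by rewrite expn0.
by rewrite primesX // primes_prime // inE => /eqP ->; rewrite e.
Qed.

Lemma smooth_not_dvd y n : ~~ (prime y.+1 && (y.+1 %| n)%N) -> smooth y.+1 n = smooth y n.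
Proof.
move=> H; apply/allP/allP => h l ln; have := h l ln; last by lia.
rewrite leq_eqVlt => /orP[/eqP e|//]; move: ln; rewrite mem_primes e => /andP[pp /andP[_ d]].
by rewrite pp d in H.
Qed.

Lemma smooth_self n : (0 < n)%N -> smooth n n.
Proof. by move=> n0; apply/allP => p; rewrite mem_primes => /andP[_ /andP[_]]; apply: dvdn_leq. Qed.

Lemma smooth0 n : (0 < n)%N -> smooth 0 n -> n = 1%N.
Proof.
move=> n0 /allP h; apply/eqP; case: eqP => // n1.
have n2 : (1 < n)%N by lia.
have := h (pdiv n); rewrite mem_primes pdiv_prime // n0 pdiv_dvd => /(_ isT).
by rewrite leqNgt pdiv_gt0.
Qed.

Section SmoothSums.
Variables (T : R) (h : nat -> C).
Hypotheses (T0 : 0 < T) (hP : unimodular_mult h).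
Let G (n : nat) : R := Cmod (divisor_sum h n) * wt T n.

Lemma smooth_G_ge0 n : 0 <= G n.
Proof. by apply: Rmult_le_pos; [apply: Cmod_ge_0 | left; apply: wt_pos]. Qed.

Lemma wt_prime_le p : prime p -> 0 <= wt T p <= / 2.
Proof.
move=> pp; split; first by left; apply: wt_pos.
apply: (Rle_trans _ _ _ (wt_le_inv T p T0 (prime_gt0 pp))).
apply: Rinv_le_contravar; first lra.
by have := INR_leq 2 p (prime_gt1 pp); rewrite /=; lra.
Qed.

Lemma wt_pow p k : (0 < p)%N -> wt T (p ^ k) = wt T p ^ k.
Proof.
move=> p0; elim: k => [|k IH]; first by rewrite expn0 wt1.
by rewrite expnS wtM ?expn_gt0 ?p0 // IH.
Qed.

(** The terms beyond the linear one are at most (k + 3) x^(k + 2) with x <= 1/2, and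
    [8 - (2 * INR K + 8) * (/ 2) ^ K] is the closed form of the sum of (k + 3) / 2^k over k < K. *)
Lemma geom_sum_le (z : C) (x : R) (K : nat) : Cmod z <= 1 -> 0 <= x <= / 2 ->
  \Rsum_(0 <= k < K.+2) (Cmod (geom z k) * x ^ k) <=
  1 + Cmod (1 + z)%C * x + x ^ 2 * (8 - (2 * INR K + 8) * (/ 2) ^ K).
Proof.
move=> hz hx; elim: K => [|K IH].
  rewrite big_nat_recr // big_nat1 /= Cmod_1 Cmult_1_r; lra.
have -> : \Rsum_(0 <= k < K.+3) (Cmod (geom z k) * x ^ k) =
  \Rsum_(0 <= k < K.+2) (Cmod (geom z k) * x ^ k) + Cmod (geom z K.+2) * x ^ K.+2.
  by rewrite big_nat_recr.
have step : Cmod (geom z K.+2) * x ^ K.+2 <= x ^ 2 * ((INR K + 3) * (/ 2) ^ K).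
  have -> : x ^ K.+2 = x ^ 2 * x ^ K by rewrite /=; ring.
  have := geom_le z K.+2 hz; rewrite !S_INR => g1.
  have pK : 0 <= x ^ K <= (/ 2) ^ K by split; [apply: pow_le; lra | apply: pow_incr; lra].
  have x2 : 0 <= x ^ 2 by apply: pow2_ge_0.
  have g0 := Cmod_ge_0 (geom z K.+2).
  rewrite Rmult_comm Rmult_assoc; apply: Rmult_le_compat_l => //.
  rewrite Rmult_comm; apply: Rmult_le_compat; lra.
rewrite S_INR; have -> : (/ 2) ^ K.+1 = / 2 * (/ 2) ^ K by [].
have -> : x ^ 2 * (8 - (2 * (INR K + 1) + 8) * (/ 2 * (/ 2) ^ K)) =
  x ^ 2 * (8 - (2 * INR K + 8) * (/ 2) ^ K) + x ^ 2 * ((INR K + 3) * (/ 2) ^ K) by field.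
lra.
Qed.

Lemma geom_sum_le_exp (z : C) (x : R) (K : nat) : Cmod z <= 1 -> 0 <= x <= / 2 ->
  \Rsum_(0 <= k < K.+1) (Cmod (geom z k) * x ^ k) <= exp (Cmod (1 + z)%C * x + 8 * x ^ 2).
Proof.
move=> hz hx; apply: Rle_trans; last exact: exp_ineq1_le.
have := geom_sum_le z x K hz hx; rewrite big_nat_recr //=.
have : 0 <= Cmod (1 + z * geom z K)%C * (x * x ^ K).
  by apply: Rmult_le_pos; [apply: Cmod_ge_0 | apply: Rmult_le_pos; [lra | apply: pow_le; lra]].
have : 0 <= x * (x * 1) * ((2 * INR K + 8) * (/ 2) ^ K).
  apply: Rmult_le_pos; first nra.
  by apply: Rmult_le_pos; [have := pos_INR K; lra | apply: pow_le; lra].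
rewrite /=; lra.
Qed.

(** Each n is p^k m with m prime to p, and [G] factors accordingly. Since all terms are nonnegative,
    the range of m may be enlarged from N / p^k to N, which decouples k from m and gives the Euler
    factor as an upper bound. *)
Lemma smooth_sumS y N : prime y.+1 ->
  \Rsum_(1 <= n < N.+1 | smooth y.+1 n) G n <=
  (\Rsum_(0 <= k < N.+1) (Cmod (geom (h y.+1) k) * wt T y.+1 ^ k)) *
  (\Rsum_(1 <= n < N.+1 | smooth y n) G n).
Proof.
move=> pp; set p := y.+1; have p0 := prime_gt0 pp; have p1 := prime_gt1 pp.
apply: (Rle_trans _ (\Rsum_(0 <= k < N.+1) \Rsum_(1 <= n < N.+1 | (logn p n == k) && smooth p n) G n)).
  right; rewrite (exchange_big_dep (fun n => smooth p n)) /=; last by move=> k n _ /andP[].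
  rewrite [RHS]big_seq_cond [LHS]big_seq_cond; apply: eq_bigr => n.
  rewrite mem_index_iota => /andP[/andP[n0 nN] sm].
  have lt : (logn p n < N.+1)%N.
    by have := ltn_logl p n0; lia.
  under eq_bigl do rewrite sm andbT eq_sym.
  rewrite big_mkcond (bigD1_seq (logn p n)) ?iota_uniq ?mem_index_iota //= eqxx.
  by rewrite big1 ?Rplus_0_r // => i /negbTE ->.
rewrite big_distrl /=; apply: Rsum_le => k _.
have pk0 : (0 < p ^ k)%N by rewrite expn_gt0 p0.
apply: (Rle_trans _ (\Rsum_(1 <= n < N.+1 | (p ^ k %| n)%N) (if (logn p n == k) && smooth p n then G n else 0))).
  rewrite -big_mkcondr; apply: Rsum_le_sub => [n|n _]; last exact: smooth_G_ge0.
  move=> /andP[/eqP h1 h2]; rewrite h1 eqxx h2 !andbT /=.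
  case: n h1 h2 => [|n] h1 _; first by rewrite dvdn0.
  by rewrite -h1 pfactor_dvdnn.
rewrite big_multiples // big_distrr /= [in X in _ <= X]big_mkcond /=.
apply: (Rle_trans _ (\Rsum_(1 <= m < (N %/ p ^ k).+1)
   (if smooth y m then Cmod (geom (h p) k) * wt T p ^ k * G m else 0))).
  apply: Rsum_le_nat => m /andP[m0 _] _.
  have c0 : 0 <= Cmod (geom (h p) k) * wt T p ^ k * G m.
    apply: Rmult_le_pos; last exact: smooth_G_ge0.
    by apply: Rmult_le_pos; [apply: Cmod_ge_0 | apply: pow_le; left; apply: wt_pos].
  case: ifP => [/andP[/eqP lg sm]|_]; last by case: ifP => _; lra.
  have pm : ~~ (p %| m)%N.
    rewrite lognM // pfactorK // in lg.
    by rewrite -(expn1 p) pfactor_dvdn // -leqNgt; lia.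
  rewrite (smooth_prime_pow y) // in sm; rewrite sm; right.
  rewrite /G divisor_sum_prime_pow //; last by case: hP => _ [].
  by rewrite Cmod_mult wtM // wt_pow //; ring.
have le : ((N %/ p ^ k).+1 <= N.+1)%N by rewrite ltnS leq_div.
rewrite (big_nat_widen _ _ _ _ _ le) /=; apply: (Rle_trans _ (\Rsum_(1 <= m < N.+1) (if smooth y m then Cmod (geom (h p) k) * wt T p ^ k * G m else 0))).
  apply: Rsum_le_sub => // m _; case: ifP => _; last lra.
  apply: Rmult_le_pos; last exact: smooth_G_ge0.
  by apply: Rmult_le_pos; [apply: Cmod_ge_0 | apply: pow_le; left; apply: wt_pos].
by apply: Rsum_le => m _; case: ifP => _; lra.
Qed.

Lemma smooth_sum_le y N :
  \Rsum_(1 <= n < N.+1 | smooth y n) G n <=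
  exp (\Rsum_(1 <= p < y.+1 | prime p) (Cmod (1 + h p)%C * wt T p + 8 * wt T p ^ 2)).
Proof.
elim: y => [|y IH].
  rewrite [X in exp X]big_geq // exp_0; case: N => [|N]; first by rewrite big_geq //; lra.
  rewrite big_mkcond big_nat_recl //= /smooth /= /G divisor_sum1; last by case: hP.
  rewrite Cmod_1 wt1 big1_seq; first lra.
  move=> i; rewrite mem_index_iota => /andP[_ /andP[i0 _]]; case: ifP => // s.
  by have := smooth0 i.+1 isT s; lia.
have e : \Rsum_(1 <= p < y.+2 | prime p) (Cmod (1 + h p)%C * wt T p + 8 * wt T p ^ 2) =
  \Rsum_(1 <= p < y.+1 | prime p) (Cmod (1 + h p)%C * wt T p + 8 * wt T p ^ 2) +
  (if prime y.+1 then Cmod (1 + h y.+1)%C * wt T y.+1 + 8 * wt T y.+1 ^ 2 else 0).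
  by rewrite big_mkcond big_nat_recr // -big_mkcond.
rewrite e exp_plus; case: ifP => pp; last first.
  rewrite exp_0 Rmult_1_r; apply: Rle_trans IH; right; apply: eq_bigl => n.
  by apply: smooth_not_dvd; rewrite pp.
apply: (Rle_trans _ _ _ (smooth_sumS y N pp)); rewrite Rmult_comm.
apply: Rmult_le_compat => //.
- by apply: Rsum_ge0 => n _; apply: smooth_G_ge0.
- apply: Rsum_ge0 => k _; apply: Rmult_le_pos; first exact: Cmod_ge_0.
  by apply: pow_le; left; apply: wt_pos.
by apply: geom_sum_le_exp; [apply: unimodular_mult_le1 | apply: wt_prime_le].
Qed.

(** On the unit circle |1 + z|^2 + |1 - z|^2 = 4. Here the distance enters: a deviation of h p from
    1 makes the Euler factor of |1 * h| at p smaller than that of the divisor function. *)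
Lemma Cmod_1add_le (z : C) : z = RtoC 0 \/ Cmod z = 1 ->
  Cmod (1 + z)%C <= 2 - Cmod (1 - z)%C ^ 2 / 4.
Proof.
case=> [->|hz].
  have -> : (1 + 0 = 1)%C by ring.
  have -> : (1 - 0 = 1)%C by ring.
  by rewrite Cmod_1; lra.
have s : Cmod (1 + z)%C ^ 2 = 4 - Cmod (1 - z)%C ^ 2.
  have : Cmod z ^ 2 = 1 by rewrite hz; ring.
  rewrite !Cmod_sq; case: z {hz} => a b /=; nra.
have s0 := pow2_ge_0 (Cmod (1 + z)%C).
move: s s0; set v := Cmod (1 - z)%C ^ 2 => s s0; have v0 : 0 <= v by apply: pow2_ge_0.
apply: Rsqr_incr_0_var; last lra.
by rewrite /Rsqr; have := pow2_ge_0 v; move: s; rewrite /=; nra.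
Qed.

(** Every n <= y is y-smooth, so the Euler product bound applies to all terms. With |1 + h p| <= 2 -
    |1 - h p|^2 / 4 the exponent is at most 2 (ln (1 + T) + 3) + 8 - dist2 / 4, whence the 14. *)
Lemma divisor_sum_wt_le y N : (0 < y)%N -> T * pw T y <= / 2 -> (N <= y)%N ->
  \Rsum_(1 <= n < N.+1) G n <= (1 + T) ^ 2 * exp (14 - dist2 T y h / 4).
Proof.
move=> y0 hy Ny.
apply: (Rle_trans _ (\Rsum_(1 <= n < N.+1 | smooth y n) G n)).
  right; rewrite [RHS]big_mkcond; apply: eq_big_nat => n /andP[n0 nN].
  case: ifP => // /negP[]; apply: sub_all (smooth_self n n0) => p; lia.
apply: (Rle_trans _ _ _ (smooth_sum_le y N)).
have -> : (1 + T) ^ 2 * exp (14 - dist2 T y h / 4) =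
  exp (2 * ln (1 + T) + (14 - dist2 T y h / 4)).
  rewrite exp_plus; have -> : 2 * ln (1 + T) = ln (1 + T) + ln (1 + T) by ring.
  by rewrite exp_plus exp_ln; [ring | lra].
apply: exp_mono; have s1 := sum_primes_wt_le T y T0 y0 hy.
have s2 := sum_primes_wt_sq T y T0.
apply: (Rle_trans _ (\Rsum_(1 <= p < y.+1 | prime p)
   (2 * wt T p - / 4 * (wt T p * Cmod (1 - h p)%C ^ 2) + 8 * wt T p ^ 2))).
  apply: Rsum_le => p pp; case: hP => _ [_ /(_ p) /Cmod_1add_le hp].
  by have := Rmult_le_compat_r (wt T p) _ _ (Rlt_le _ _ (wt_pos T p)) hp; lra.
rewrite big_split /= Rsum_sub -!big_distrr /= -/(dist2 T y h).
by move: s2; rewrite /dist2 /=; lra.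
Qed.
End SmoothSums.

(** * Logarithmic means of multiplicative functions *)

Definition logsum (h : nat -> C) (N : nat) : C := (\Csum_(1 <= n < N.+1) (h n * RtoC (/ INR n)))%C.

Lemma hsum_div_diff (N d : nat) : (0 < d)%N -> (d <= N)%N ->
  Rabs (hsum N - hsum d.-1 - hsum (N %/ d)) <= 2.
Proof.
move=> d0 dN; have dp := INR_pos d d0; have N0 : (0 < N)%N by lia.
have Np := INR_pos N N0.
have h1 := hsum_sub_divn N d d0; have := hsum_ge_ln d.-1.
rewrite -S_INR prednK // => h2.
have h3 := hsum_ge_ln N; have := ln_mono _ (INR N + 1) Np ltac:(lra) => h4.
have h5 := hsum_le_ln (N %/ d); have h6 := hsum_le_ln d; have h7 := hsum_mono d.-1 d (leq_pred d).
have q0 : (0 < N %/ d)%N by rewrite divn_gt0.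
have := ln_mono _ _ (INR_pos _ q0) (INR_divn_le N d d0); rewrite ln_div // => h8.
by apply/Rabs_le_between; lra.
Qed.

Section LogMean.
Variable h : nat -> C.
Hypothesis h_le1 : forall n, Cmod (h n) <= 1.

Lemma Cmod_term_le n : Cmod (h n * RtoC (/ INR n))%C <= / INR n.
Proof.
rewrite Cmod_mult Cmod_R Rabs_pos_eq; last exact: inv_INR_ge0.
have := h_le1 n; have := Cmod_ge_0 (h n); have := inv_INR_ge0 n; nra.
Qed.

Lemma logsum_diff M N : (M <= N)%N -> Cmod (logsum h N - logsum h M)%C <= hsum N - hsum M.
Proof.
move=> MN; rewrite -hsum_sub // /logsum (big_cat_nat (n := M.+1)) //=.
set A := \big[_/_]_(1 <= _ < _) _; set B := \big[_/_]_(M.+1 <= _ < _) _.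
have -> : (A + B - A)%C = B by ring.
apply: Cmod_sum_le; apply: Rsum_le => n _; exact: Cmod_term_le.
Qed.

Lemma logsum_le M : Cmod (logsum h M) <= hsum M.
Proof.
have := logsum_diff 0 M isT; rewrite hsum0 /logsum [X in (_ - X)%C]big_geq //.
set A := \big[_/_]_(_ <= _ < _) _; have -> : (A - 0)%C = A by ring.
lra.
Qed.

Lemma sum_logsum N :
  (\Csum_(1 <= n < N.+1) (logsum h n * RtoC (/ INR n)) =
   \Csum_(1 <= d < N.+1) (h d * RtoC (/ INR d) * RtoC (hsum N - hsum d.-1)))%C.
Proof.
transitivity (\Csum_(1 <= n < N.+1) \Csum_(1 <= d < N.+1 | (d <= n)%N)
   (h d * RtoC (/ INR d) * RtoC (/ INR n)))%C.
  apply: eq_big_nat => n /andP[n0 nN]; rewrite /logsum big_distrl /=.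
  have nN' : (n.+1 <= N.+1)%N by lia.
  by rewrite (big_nat_widen _ _ _ _ _ nN') /=; apply: eq_bigl => d; rewrite ltnS.
rewrite (exchange_big_dep (fun d => true)) //=.
apply: eq_big_nat => d /andP[d0 dN]; rewrite -big_distrr /= -RtoC_sum; congr (_ * RtoC _)%C.
rewrite -hsum_sub; last lia.
by rewrite prednK // [RHS](big_nat_widenl _ 1).
Qed.

Lemma sum_divisor_sum N :
  (\Csum_(1 <= n < N.+1) (divisor_sum h n * RtoC (/ INR n)) =
   \Csum_(1 <= d < N.+1) (h d * RtoC (/ INR d) * RtoC (hsum (N %/ d))))%C.
Proof.
transitivity (\Csum_(1 <= n < N.+1) \Csum_(1 <= d < N.+1 | (d %| n)%N)
   (h d * RtoC (/ INR n)))%C.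
  apply: eq_big_nat => n /andP[n0 nN]; rewrite /divisor_sum big_distrl /=.
  have nN' : (n.+1 <= N.+1)%N by lia.
  rewrite (big_nat_widen _ _ _ _ _ nN') /=; apply: eq_bigl => d; rewrite ltnS.
  by case dn: (d %| n)%N => //=; apply: dvdn_leq.
rewrite (exchange_big_dep (fun d => true)) //=.
apply: eq_big_nat => d /andP[d0 dN]; rewrite -big_distrr /= -RtoC_sum -Cmult_assoc; congr Cmult.
rewrite big_multiples // -RtoC_mult /hsum big_distrr /=; congr RtoC.
apply: eq_big_nat => n /andP[n0 _]; rewrite INRM Rinv_mult //.
Qed.

(** Both sides are sums of h d / d with a weight, hsum N - hsum (d - 1) against hsum (N / d). Either
    weight is log (N / d) + O(1) and they differ by at most 2, so averaging the partial sums amounts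
    to summing 1 * h. *)
Lemma sum_logsum_le N :
  Cmod (\Csum_(1 <= n < N.+1) (logsum h n * RtoC (/ INR n)))%C <=
  \Rsum_(1 <= n < N.+1) (Cmod (divisor_sum h n) * / INR n) + 2 * hsum N.
Proof.
have e : (\Csum_(1 <= n < N.+1) (logsum h n * RtoC (/ INR n)) =
  \Csum_(1 <= n < N.+1) (divisor_sum h n * RtoC (/ INR n)) +
  \Csum_(1 <= d < N.+1) (h d * RtoC (/ INR d) * RtoC (hsum N - hsum d.-1 - hsum (N %/ d))))%C.
  rewrite sum_logsum sum_divisor_sum -big_split /=; apply: eq_bigr => d _.
  by rewrite (RtoC_minus _ (hsum (N %/ d))); ring.
rewrite e; apply: Cmod_add_le; apply: Rplus_le_compat.
  apply: Cmod_sum_le; right; apply: eq_bigr => n _.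
  by rewrite Cmod_mult Cmod_R Rabs_pos_eq //; apply: inv_INR_ge0.
apply: Cmod_sum_le; rewrite /hsum big_distrr /=.
apply: Rsum_le_nat => d /andP[d0 dN] _; rewrite Cmod_mult Cmod_R.
have h1 := Cmod_term_le d; have h2 := hsum_div_diff N d d0 ltac:(lia).
rewrite Rmult_comm; apply: Rmult_le_compat => //; [exact: Rabs_pos | exact: Cmod_ge_0].
Qed.

Lemma hsum_ivt N c : 0 <= c <= hsum N ->
  exists M, (M <= N)%N /\ c <= hsum N - hsum M <= c + 1.
Proof.
elim: N c => [|N IH] c; first by rewrite hsum0 => hc; exists 0%N; rewrite hsum0; split=> //; lra.
rewrite hsumS => hc; have i1 : / INR N.+1 <= 1.
  by rewrite -Rinv_1; apply: Rinv_le_contravar; [lra | apply: INR_ge1].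
case: (Rle_lt_dec c (/ INR N.+1)) => hcN; first by exists N; split=> //; lra.
by have [M [MN hM]] := IH (c - / INR N.+1) ltac:(lra); exists M; split; [lia | lra].
Qed.

(* [logsum h] varies slowly: on a range of logarithmic length [H] it moves by at most [H], so a
   bound for its logarithmic average over such ranges bounds it pointwise. *)
Lemma logsum_le_of_average N B : 4 <= B ->
  (forall M, (M <= N)%N -> Cmod (\Csum_(1 <= n < M.+1) (logsum h n * RtoC (/ INR n)))%C <= B) ->
  Cmod (logsum h N) <= 4 * sqrt B.
Proof.
move=> B4 hB; have s2 : 2 <= sqrt B.
  by rewrite -(sqrt_Rsqr 2) /Rsqr; [apply: sqrt_le_1_alt; lra | lra].
have ss : sqrt B * sqrt B = B by apply: sqrt_sqrt; lra.
case: (Rle_lt_dec (hsum N) (sqrt B)) => hN; first by have := logsum_le N; lra.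
(* A window of logarithmic length H about sqrt B balances the contribution 2 B / H of the averages
   against the drift H inside the window. *)
have [M [MN hM]] := hsum_ivt N (sqrt B) ltac:(lra).
set H := hsum N - hsum M in hM.
have key : (logsum h N * RtoC H =
  \Csum_(1 <= n < N.+1) (logsum h n * RtoC (/ INR n)) -
  \Csum_(1 <= n < M.+1) (logsum h n * RtoC (/ INR n)) -
  \Csum_(M.+1 <= n < N.+1) ((logsum h n - logsum h N) * RtoC (/ INR n)))%C.
  rewrite [X in (X - _ - _)%C](big_cat_nat (n := M.+1)) //=.
  have -> : (\Csum_(M.+1 <= n < N.+1) ((logsum h n - logsum h N) * RtoC (/ INR n)) =
     \Csum_(M.+1 <= n < N.+1) (logsum h n * RtoC (/ INR n)) - logsum h N * RtoC H)%C.
    rewrite /H -hsum_sub // RtoC_sum big_distrr /= -Csum_sub; apply: eq_bigr => n _; ring.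
  ring.
have h1 : Cmod (logsum h N) * H <= 2 * B + H * H.
  have H0 : 0 <= H by lra.
  rewrite -{1}(Rabs_pos_eq H) // -Cmod_R -Cmod_mult key.
  apply: Cmod_add_le; rewrite Cmod_opp.
  apply: Rplus_le_compat.
    apply: Cmod_add_le; rewrite Cmod_opp.
    by have := hB N (leqnn N); have := hB M MN; lra.
  apply: Cmod_sum_le; rewrite {1}/H -hsum_sub // big_distrl /=.
  apply: Rsum_le_nat => n /andP[nM nN] _; rewrite Cmod_mult Cmod_R Rabs_pos_eq; last exact: inv_INR_ge0.
  rewrite Rmult_comm; apply: Rmult_le_compat_l; first exact: inv_INR_ge0.
  have -> : (logsum h n - logsum h N = - (logsum h N - logsum h n))%C by ring.
  rewrite Cmod_opp; apply: Rle_trans (logsum_diff n N ltac:(lia)) _.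
  by have := hsum_mono M n ltac:(lia); rewrite /H; lra.
apply: (Rmult_le_reg_r H); first lra.
apply: (Rle_trans _ _ _ h1); nra.
Qed.
End LogMean.

(** For log N <= T the summatory bound is e (1 + T)^2 exp(14 - D/4) + 2 (1 + T). Passing from the
    average of [logsum] to its value costs a square root, which halves the exponents and leaves T
    exp(-D/8) + sqrt T. *)
Lemma logsum_dist2_bound (T : R) (y N : nat) h : 1 <= T -> (0 < y)%N -> T * pw T y <= / 2 ->
  T <= ln (INR y) -> unimodular_mult h -> ln (INR N) <= T ->
  Cmod (logsum h N) <= 8 * exp 8 * (T * exp (- dist2 T y h / 8) + sqrt T).
Proof.
move=> T1 y0 hy Ty hP NT; have T0 : 0 < T by lra.
set D := dist2 T y h; have hle n := unimodular_mult_le1 h n hP.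
have st : sqrt T * sqrt T = T by apply: sqrt_sqrt; lra.
have sp : 0 <= sqrt T by apply: sqrt_pos.
have Ny : (N <= y)%N.
  case: (leqP N y) => // yN; have := ln_mono _ _ (INR_pos _ y0) (INR_leq _ _ (ltnW yN)) => h1.
  have := ln_increasing _ _ (INR_pos _ y0) (lt_INR y N ltac:(lia)); lra.
set B := exp 1 * ((1 + T) ^ 2 * exp (14 - D / 4)) + 2 * (1 + T).
have e1 : 0 < exp 1 * ((1 + T) ^ 2 * exp (14 - D / 4)).
  apply: Rmult_lt_0_compat; first exact: exp_pos.
  by apply: Rmult_lt_0_compat; [apply: pow_lt; lra | exact: exp_pos].
have hB : Cmod (logsum h N) <= 4 * sqrt B.
  apply: logsum_le_of_average => //; first by rewrite /B; lra.
  move=> M MN; apply: Rle_trans (sum_logsum_le h hle M) _.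
  have MT n : (0 < n)%N -> (n <= M)%N -> ln (INR n) <= T.
    by move=> n0 nM; have := ln_mono _ _ (INR_pos _ n0) (INR_leq n N ltac:(lia)); lra.
  apply: Rplus_le_compat; last first.
    case: M {MN} MT => [_|M MT]; first by rewrite hsum0; lra.
    by have := hsum_le_ln M.+1; have := MT M.+1 isT (leqnn _); lra.
  apply: Rle_trans (Rmult_le_compat_l (exp 1) _ _ (Rlt_le _ _ (exp_pos 1))
    (divisor_sum_wt_le T h T0 hP y M y0 hy ltac:(lia))).
  rewrite big_distrr /=; apply: Rsum_le_nat => n /andP[n0 nM] _.
  have := wt_ge_inv T n T0 n0 (MT n n0 nM); have := Cmod_ge_0 (divisor_sum h n) => c0 w.
  by have := Rmult_le_compat_l _ _ _ c0 w; lra.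
set a := 2 * exp 8 * T * exp (- D / 8).
have a0 : 0 <= a.
  by rewrite /a; have := exp_pos 8; have := exp_pos (- D / 8) => x1 x2; repeat apply: Rmult_le_pos; lra.
have sB : sqrt B <= a + 2 * sqrt T.
  rewrite -(sqrt_Rsqr (a + 2 * sqrt T)); last lra.
  apply: sqrt_le_1_alt; rewrite /Rsqr.
  suff : exp 1 * ((1 + T) ^ 2 * exp (14 - D / 4)) <= a * a by rewrite /B; nra.
  have -> : exp 1 * ((1 + T) ^ 2 * exp (14 - D / 4)) = (1 + T) ^ 2 * exp (15 - D / 4).
    have -> : 15 - D / 4 = 1 + (14 - D / 4) by ring.
    by rewrite (exp_plus 1); ring.
  have -> : a * a = (2 * T) ^ 2 * exp (16 - D / 4).
    have -> : 16 - D / 4 = (8 + 8) + (- D / 8 + - D / 8) by field.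
    by rewrite /a !exp_plus; ring.
  apply: Rmult_le_compat; [apply: pow2_ge_0 | by left; apply: exp_pos | apply: pow_incr; lra |].
  by apply: exp_mono; lra.
apply: (Rle_trans _ _ _ hB); apply: (Rle_trans _ (4 * (a + 2 * sqrt T))); first lra.
have : 1 <= exp 8 by have := exp_ineq1_le 8; lra.
rewrite /a; nra.
Qed.

(** * Exponential sums and the Turán-Kubilius-Kátai inequality *)

Definition expi (x : R) : C := (cos (2 * PI * x), sin (2 * PI * x)).

Lemma expi_add x y : expi (x + y) = (expi x * expi y)%C.
Proof. by rewrite /expi Rmult_plus_distr_l cos_plus sin_plus /Cmult /=; f_equal; ring. Qed.

Lemma expi0 : expi 0 = RtoC 1.
Proof. by rewrite /expi Rmult_0_r cos_0 sin_0. Qed.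

Lemma expi_conj x : Cconj (expi x) = expi (- x).
Proof. by rewrite /expi /Cconj /= Ropp_mult_distr_r_reverse cos_neg sin_neg. Qed.

Lemma Cmod_expi x : Cmod (expi x) = 1.
Proof.
have h : Cmod (expi x) ^ 2 = 1.
  by rewrite Cmod_sq /=; have := sin2_cos2 (2 * PI * x); rewrite /Rsqr; lra.
by have := Cmod_ge_0 (expi x); rewrite /= in h; nra.
Qed.

Lemma expi_INR n : expi (INR n) = RtoC 1.
Proof.
elim: n => [|n IH]; first exact: expi0.
rewrite S_INR expi_add IH Cmult_1_l /expi Rmult_1_r cos_2PI sin_2PI //.
Qed.

Lemma expi_IZR k : expi (IZR k) = RtoC 1.
Proof.
have h n : expi (- INR n) = RtoC 1 by rewrite -expi_conj expi_INR Cconj_R.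
case: k => [|p|p]; first exact: expi0.
  by rewrite -Znat.positive_nat_Z -INR_IZR_INZ expi_INR.
by rewrite -Pos2Z.opp_pos opp_IZR -Znat.positive_nat_Z -INR_IZR_INZ h.
Qed.

Lemma expi_period x k : expi (x + IZR k) = expi x.
Proof. by rewrite expi_add expi_IZR Cmult_1_r. Qed.

Lemma Cmod_1sub_expi x : Cmod (1 - expi x)%C = 2 * Rabs (sin (PI * x)).
Proof.
have a0 := Rabs_pos (sin (PI * x)); have c0 := Cmod_ge_0 (1 - expi x)%C.
suff : Cmod (1 - expi x)%C ^ 2 = (2 * Rabs (sin (PI * x))) ^ 2.
  by rewrite /= => h; nra.
rewrite Rpow_mult_distr RPow_abs Rabs_pos_eq; last exact: pow2_ge_0.
rewrite Cmod_sq /expi /=; have -> : 2 * PI * x = 2 * (PI * x) by ring.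
rewrite cos_2a_sin sin_2a; have := sin2_cos2 (PI * x); rewrite /Rsqr.
move: (sin _) (cos _) => s c h; nra.
Qed.

Lemma expi_geom_sum x M N : (M <= N)%N ->
  ((1 - expi x) * (\Csum_(M <= n < N) expi (INR n * x)) = expi (INR M * x) - expi (INR N * x))%C.
Proof.
move=> /subnKC <-; elim: (N - M)%N => [|k IH]; first by rewrite addn0 big_geq //; ring.
rewrite addnS big_nat_recr /=; last by lia.
rewrite Cmult_plus_distr_l IH; have -> : INR (M + k).+1 * x = INR (M + k) * x + x.
  by rewrite S_INR; ring.
by rewrite expi_add; ring.
Qed.

Lemma expi_sum_le x M N : (M <= N)%N -> sin (PI * x) <> 0 ->
  Cmod (\Csum_(M <= n < N) expi (INR n * x))%C <= / Rabs (sin (PI * x)).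
Proof.
move=> MN s0; have a0 := Rabs_pos_lt _ s0.
have := f_equal Cmod (expi_geom_sum x M N MN); rewrite Cmod_mult Cmod_1sub_expi => h.
have : Cmod (expi (INR M * x) - expi (INR N * x))%C <= 2.
  by apply: Cmod_add_le; rewrite Cmod_opp !Cmod_expi; lra.
rewrite -h => h2; apply: (Rmult_le_reg_l (Rabs (sin (PI * x)))) => //.
rewrite Rinv_r; lra.
Qed.

Definition kern (M N : nat) (x : R) : C :=
  (\Csum_(M.+1 <= n < N.+1) (expi (INR n * x) * RtoC (/ INR n)))%C.

Lemma kern_le_hsum M N x : (M <= N)%N -> Cmod (kern M N x) <= hsum N - hsum M.
Proof.
move=> MN; rewrite -hsum_sub //; apply: Cmod_sum_le.
apply: Rsum_le => n _; rewrite Cmod_mult Cmod_expi Cmod_R Rabs_pos_eq; first lra.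
exact: inv_INR_ge0.
Qed.

Lemma kern_abel M N x : (M <= N)%N -> sin (PI * x) <> 0 ->
  Cmod (kern M N x) <= / Rabs (sin (PI * x)) * / INR M.+1.
Proof.
move=> MN s0; apply: (abel_bound (fun n => expi (INR n * x)) (fun n => / INR n)) => //.
- by move=> K MK; apply: expi_sum_le.
- move=> n Mn; split; first exact: inv_INR_ge0.
  by apply: Rinv_le_contravar; [apply: INR_pos; lia | apply: INR_leq].
- exact: inv_INR_ge0.
Qed.

Lemma kern_cat M K N x : (M <= K)%N -> (K <= N)%N -> kern M N x = (kern M K x + kern K N x)%C.
Proof. by move=> MK KN; rewrite /kern (big_cat_nat (n := K.+1)). Qed.

(** Split at J, the integer part of 1 / |sin (PI x)|: up to J the terms are bounded by 1/n, beyond J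
    partial summation gives at most 1. *)
Lemma kern0_le N x : sin (PI * x) <> 0 ->
  Cmod (kern 0 N x) <= 2 + ln (/ Rabs (sin (PI * x))).
Proof.
move=> s0; have a0 := Rabs_pos_lt _ s0; set s := Rabs _ in a0 *.
have s1 : s <= 1 by apply/Rabs_le; have := SIN_bound (PI * x); lra.
have is1 : 1 <= / s by rewrite -Rinv_1; apply: Rinv_le_contravar.
have [J [J1 J2]] : exists J : nat, INR J <= / s < INR J + 1.
  by have [J hJ] := nfloor_ex (/ s) ltac:(lra); exists J.
have Jp : (0 < J)%N by case: J J1 J2 => [|//] /=; lra.
have hJ : hsum J <= 1 + ln (/ s).
  by have := hsum_le_ln J; have := ln_mono _ _ (INR_pos J Jp) J1; lra.
case: (leqP N J) => NJ.
  by have := kern_le_hsum 0 N x isT; have := hsum_mono _ _ NJ; rewrite hsum0; lra.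
rewrite (kern_cat 0 J N) //; last exact: ltnW.
apply: Cmod_add_le.
have := kern_le_hsum 0 J x isT; have := kern_abel J N x (ltnW NJ) s0; rewrite hsum0 -/s.
suff : / s * / INR J.+1 <= 1 by lra.
rewrite S_INR; apply: (Rmult_le_reg_r (INR J + 1)); first by have := pos_INR J; lra.
by rewrite Rmult_assoc Rinv_l; have := pos_INR J; lra.
Qed.

Lemma kern_le M N x : (M <= N)%N -> sin (PI * x) <> 0 ->
  Cmod (kern M N x) <= 2 * (2 + ln (/ Rabs (sin (PI * x)))).
Proof.
move=> MN s0; have := kern_cat 0 M N x isT MN => e.
have -> : kern M N x = (kern 0 N x - kern 0 M x)%C by rewrite e; ring.
apply: Cmod_add_le; rewrite Cmod_opp.
by have := kern0_le N x s0; have := kern0_le M x s0; lra.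
Qed.

(** Apart from the first, every marked n has the K integers n - K + 1, ..., n to itself, and 1/n is
    at most the mean of their reciprocals. The first one accounts for the 1. *)
Lemma spaced_sum (b : pred nat) (K H : nat) : (0 < K)%N ->
  (forall m n, b m -> b n -> (m < n)%N -> (m + K <= n)%N) ->
  \Rsum_(1 <= n < H.+1 | b n) / INR n <= 1 + hsum H / INR K.
Proof.
move=> K0 hb; have Kp := INR_pos K K0; have iK := Rinv_0_lt_compat _ Kp.
elim/ltn_ind: H => -[|H] IH; first by rewrite big_geq // hsum0; lra.
have rec : \Rsum_(1 <= n < H.+2 | b n) / INR n =
    \Rsum_(1 <= n < H.+1 | b n) / INR n + (if b H.+1 then / INR H.+1 else 0).
  by rewrite big_mkcond big_nat_recr // -big_mkcond.
rewrite rec; case: ifP => bH; last first.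
  have := IH H (ltnSn H); have := hsum_mono H H.+1 (leqnSn H) => h1 h2.
  by have := Rmult_le_compat_r (/ INR K) _ _ (Rlt_le _ _ iK) h1; rewrite /Rdiv in h2 *; lra.
case: (leqP H.+1 K) => KH.
  rewrite big1_seq => [|n /andP[bn]]; last first.
    by rewrite mem_index_iota => /andP[n0 nH]; have := hb n H.+1 bn bH nH; lia.
  have : / INR H.+1 <= 1 by rewrite -Rinv_1; apply: Rinv_le_contravar; [lra | apply: INR_ge1].
  have := hsum_ge0 H.+1 => h1; have := Rmult_le_pos _ _ h1 (Rlt_le _ _ iK); rewrite /Rdiv; lra.
have cut : \Rsum_(1 <= n < H.+1 | b n) / INR n = \Rsum_(1 <= n < (H.+1 - K).+1 | b n) / INR n.
  rewrite (big_cat_nat (n := (H.+1 - K).+1)) //=; last lia.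
  rewrite [X in _ + X]big1_seq ?Rplus_0_r // => n /andP[bn].
  by rewrite mem_index_iota => /andP[n0 nH]; have := hb n H.+1 bn bH nH; lia.
have := IH (H.+1 - K)%N ltac:(lia); rewrite cut.
suff : INR K * / INR H.+1 <= hsum H.+1 - hsum (H.+1 - K).
  move=> h1; have := Rmult_le_compat_r (/ INR K) _ _ (Rlt_le _ _ iK) h1.
  have -> : INR K * / INR H.+1 * / INR K = / INR H.+1.
    by field; split; [have := INR_pos H.+1 isT; lra | lra].
  rewrite /Rdiv; lra.
rewrite -hsum_sub; last lia.
apply: (Rle_trans _ (\Rsum_((H.+1 - K).+1 <= n < H.+2) / INR H.+1)).
  rewrite Rsum_const count_predT size_iota; right; congr (INR _ * _); lia.
apply: Rsum_le_nat => n /andP[n0 nH] _.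
by apply: Rinv_le_contravar; [apply: INR_pos; lia | apply: INR_leq; lia].
Qed.

Lemma Rsum_CS_weighted (I : Type) (r : seq I) (P : pred I) (w G : I -> R) :
  (forall i, P i -> 0 <= w i) ->
  (\Rsum_(i <- r | P i) w i * G i) ^ 2 <=
  (\Rsum_(i <- r | P i) w i) * (\Rsum_(i <- r | P i) w i * G i ^ 2).
Proof.
move=> w0; have ss i : P i -> sqrt (w i) * sqrt (w i) = w i by move=> /w0; apply: sqrt_sqrt.
have -> : \Rsum_(i <- r | P i) w i * G i = \Rsum_(i <- r | P i) sqrt (w i) * (sqrt (w i) * G i).
  by apply: eq_bigr => i Pi; rewrite -Rmult_assoc ss.
apply: (Rle_trans _ _ _ (Rsum_CS _ _ _ _ _)); right; congr Rmult; apply: eq_bigr => i Pi.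
  by rewrite /= Rmult_1_r ss.
by rewrite Rpow_mult_distr /= Rmult_1_r ss.
Qed.

Lemma Rsum_CS_sqrt (I : Type) (r : seq I) (P : pred I) (w G : I -> R) A B :
  (forall i, P i -> 0 <= w i) -> \Rsum_(i <- r | P i) w i <= A ->
  \Rsum_(i <- r | P i) w i * G i ^ 2 <= B ->
  \Rsum_(i <- r | P i) w i * G i <= sqrt (A * B).
Proof.
move=> w0 hA hB; have h := Rsum_CS_weighted I r P w G w0.
case: (Rle_lt_dec (\Rsum_(i <- r | P i) w i * G i) 0) => h0; first by have := sqrt_pos (A * B); lra.
rewrite -(sqrt_pow2 (\Rsum_(i <- r | P i) w i * G i)); last lra.
apply: sqrt_le_1_alt; apply: (Rle_trans _ _ _ h); apply: Rmult_le_compat => //.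
  exact: Rsum_ge0.
by apply: Rsum_ge0 => i Pi; apply: Rmult_le_pos; [apply: w0 | apply: pow2_ge_0].
Qed.

Definition psum (H : nat) : R := \Rsum_(1 <= p < H.+1 | prime p) / INR p.

Lemma psum_ge0 H : 0 <= psum H.
Proof. by apply: Rsum_ge0 => p _; apply: inv_INR_ge0. Qed.

Section Katai.
Variables (H M N : nat).
Hypothesis MN : (M <= N)%N.
Let L := psum H.
Let La := 1 + ln (INR H).

Definition omega (n : nat) : R := \Rsum_(1 <= p < H.+1 | prime p) (if (p %| n)%N then 1 else 0).

Lemma sum_multiples_inv p X : (0 < p)%N ->
  \Rsum_(1 <= n < X.+1) (if (p %| n)%N then / INR n else 0) = / INR p * hsum (X %/ p).
Proof.
move=> p0; rewrite -big_mkcond big_multiples // /hsum big_distrr /=.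
by apply: eq_bigr => n _; rewrite INRM Rinv_mult.
Qed.

Lemma prime_le_La p : (1 <= p < H.+1)%N -> 1 + ln (INR p) <= La.
Proof.
move=> /andP[p0 pH]; have := ln_mono _ _ (INR_pos p p0) (INR_leq p H ltac:(lia)); rewrite /La; lra.
Qed.

(** When the square is expanded, the terms L^2 hsum N cancel. The second moment exceeds L^2 hsum N
    by at most the diagonal p = l, that is L hsum N, since two distinct primes divide n only if
    their product does; the first moment falls short of L hsum N by at most L La, because hsum (N /
    p) loses only 1 + log p. *)
Lemma turan_kubilius :
  \Rsum_(1 <= n < N.+1) (/ INR n * (omega n - L) ^ 2) <= L * hsum N + 2 * L ^ 2 * La.
Proof.
have e1 : \Rsum_(1 <= n < N.+1) (/ INR n * omega n) =
    \Rsum_(1 <= p < H.+1 | prime p) (/ INR p * hsum (N %/ p)).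
  rewrite /omega; under eq_bigr do rewrite big_distrr /=.
  rewrite exchange_big /=; apply: eq_bigr => p pp.
  rewrite -sum_multiples_inv ?prime_gt0 //; apply: eq_bigr => n _.
  by case: ifP => _; lra.
have h1 : L * hsum N - L * La <= \Rsum_(1 <= n < N.+1) (/ INR n * omega n).
  rewrite e1 /L /psum !big_distrl /= -Rsum_sub; apply: Rsum_le_nat => p hp pp.
  have := hsum_sub_divn N p (prime_gt0 pp); have := prime_le_La p hp; have := inv_INR_ge0 p.
  nra.
have h2 : \Rsum_(1 <= n < N.+1) (/ INR n * omega n ^ 2) <= L ^ 2 * hsum N + L * hsum N.
  have -> : L ^ 2 * hsum N + L * hsum N =
    \Rsum_(1 <= p < H.+1 | prime p) \Rsum_(1 <= l < H.+1 | prime l)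
      (hsum N * (/ INR p * / INR l + (if l == p then / INR p else 0))).
    transitivity (\Rsum_(1 <= p < H.+1 | prime p) (hsum N * (/ INR p * L + / INR p))).
      by rewrite -big_distrr /= big_split /= -big_distrl /= -/(psum H) -/L; ring.
    rewrite big_seq_cond [RHS]big_seq_cond; apply: eq_bigr => p /andP[hp pp].
    rewrite -big_distrr /= big_split /= -big_distrr /= -/(psum H) -/L.
    suff -> : \Rsum_(1 <= l < H.+1 | prime l) (if l == p then / INR p else 0) = / INR p by [].
    rewrite big_mkcond (bigD1_seq p) ?iota_uniq //= pp eqxx.
    by rewrite big1 ?Rplus_0_r // => l /negbTE ->; case: ifP.
  have -> : \Rsum_(1 <= n < N.+1) (/ INR n * omega n ^ 2) =
    \Rsum_(1 <= p < H.+1 | prime p) \Rsum_(1 <= l < H.+1 | prime l)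
      \Rsum_(1 <= n < N.+1) (if (p %| n)%N && (l %| n)%N then / INR n else 0).
    transitivity (\Rsum_(1 <= n < N.+1) \Rsum_(1 <= p < H.+1 | prime p)
      \Rsum_(1 <= l < H.+1 | prime l) (if (p %| n)%N && (l %| n)%N then / INR n else 0)).
      apply: eq_bigr => n _; rewrite /= Rmult_1_r {1 2}/omega big_distrlr /= big_distrr /=.
      apply: eq_bigr => p _; rewrite big_distrr /=; apply: eq_bigr => l _.
      by case: (p %| n)%N; case: (l %| n)%N => /=; lra.
    rewrite exchange_big /=; apply: eq_bigr => p _.
    exact: exchange_big.
  apply: Rsum_le => p pp; apply: Rsum_le => l pl.
  have p0 := prime_gt0 pp; have l0 := prime_gt0 pl; have hN := hsum_ge0 N.
  have i1 := inv_INR_ge0 p; have i2 := inv_INR_ge0 l.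
  case: eqP => [->|/eqP lp].
    under eq_bigr do rewrite andbb.
    rewrite sum_multiples_inv //; have := hsum_mono _ _ (leq_div N p) => h.
    have := Rmult_le_compat_l _ _ _ i1 h.
    have : 0 <= hsum N * (/ INR p * / INR p) by apply: Rmult_le_pos => //; apply: Rmult_le_pos.
    lra.
  under eq_bigr => n _.
    rewrite -Gauss_dvd; last by rewrite prime_coprime // dvdn_prime2 // eq_sym.
    over.
  rewrite sum_multiples_inv ?muln_gt0 ?p0 // INRM Rinv_mult Rplus_0_r Rmult_comm.
  apply: Rmult_le_compat_r; first by apply: Rmult_le_pos.
  exact: hsum_mono (leq_div _ _).
have -> : \Rsum_(1 <= n < N.+1) (/ INR n * (omega n - L) ^ 2) =
  \Rsum_(1 <= n < N.+1) (/ INR n * omega n ^ 2) - 2 * L * (\Rsum_(1 <= n < N.+1) (/ INR n * omega n))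
  + L ^ 2 * hsum N.
  have -> : Rmult (2 * L) (\Rsum_(1 <= n < N.+1) (/ INR n * omega n)) =
    \Rsum_(1 <= n < N.+1) (2 * L * (/ INR n * omega n)) by rewrite big_distrr.
  have -> : L ^ 2 * hsum N = \Rsum_(1 <= n < N.+1) (L ^ 2 * / INR n) by rewrite /hsum big_distrr.
  by rewrite -Rsum_sub -big_split; apply: eq_bigr => n _; rewrite /=; ring.
have := psum_ge0 H; rewrite -/L => L0; nra.
Qed.

Lemma Rsum_range_le (F : nat -> R) : (forall n, 0 <= F n) ->
  \Rsum_(M.+1 <= n < N.+1) F n <= \Rsum_(1 <= n < N.+1) F n.
Proof.
move=> F0; rewrite [X in _ <= X](big_cat_nat (n := M.+1)) //=.
have : 0 <= \Rsum_(1 <= n < M.+1) F n by apply: Rsum_ge0.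
lra.
Qed.

Definition katai_kernel_sum (a : R) : R :=
  \Rsum_(1 <= p < H.+1 | prime p) \Rsum_(1 <= l < H.+1 | prime l)
    (/ INR p * / INR l * Cmod (kern M N ((INR p - INR l) * a))).

(** Opening the square and summing over m first leaves only kernels at the frequencies (p - l) a;
    the values of [f] enter through |f| <= 1 alone. *)
Lemma katai_bilinear (f : nat -> C) (a : R) : (forall n, Cmod (f n) <= 1) ->
  \Rsum_(M.+1 <= m < N.+1) (/ INR m *
    Cmod (\Csum_(1 <= p < H.+1 | prime p) (f p * RtoC (/ INR p) * expi (INR m * (INR p * a))))%C ^ 2)
  <= katai_kernel_sum a.
Proof.
move=> f1; set c := fun p => (f p * RtoC (/ INR p))%C.
have cle p : Cmod (c p) <= / INR p.
  rewrite /c Cmod_mult Cmod_R Rabs_pos_eq; last exact: inv_INR_ge0.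
  have := f1 p; have := Cmod_ge_0 (f p); have := inv_INR_ge0 p; nra.
have e : RtoC (\Rsum_(M.+1 <= m < N.+1) (/ INR m *
    Cmod (\Csum_(1 <= p < H.+1 | prime p) (c p * expi (INR m * (INR p * a))))%C ^ 2)) =
  (\Csum_(1 <= p < H.+1 | prime p) \Csum_(1 <= l < H.+1 | prime l)
    (c p * Cconj (c l) * kern M N ((INR p - INR l) * a)))%C.
  rewrite RtoC_sum.
  transitivity (\Csum_(M.+1 <= m < N.+1) \Csum_(1 <= p < H.+1 | prime p)
     \Csum_(1 <= l < H.+1 | prime l)
     (c p * Cconj (c l) * (expi (INR m * ((INR p - INR l) * a)) * RtoC (/ INR m))))%C.
    apply: eq_bigr => m _; rewrite RtoC_mult Cmod2_conj Cconj_sum big_distrlr /= big_distrr /=.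
    apply: eq_bigr => p _; rewrite big_distrr /=; apply: eq_bigr => l _.
    rewrite Cconj_mult expi_conj.
    have -> : INR m * ((INR p - INR l) * a) = INR m * (INR p * a) + - (INR m * (INR l * a)) by ring.
    by rewrite expi_add; ring.
  rewrite exchange_big /=; apply: eq_bigr => p _.
  by rewrite exchange_big /=; apply: eq_bigr => l _; rewrite /kern big_distrr.
apply: (Rle_trans _ (Cmod (RtoC (\Rsum_(M.+1 <= m < N.+1) (/ INR m *
    Cmod (\Csum_(1 <= p < H.+1 | prime p) (c p * expi (INR m * (INR p * a))))%C ^ 2))))).
  by rewrite Cmod_R; apply: Rle_abs.
clearbody c.
rewrite e; apply: Cmod_sum_le; apply: Rsum_le => p _.
apply: Cmod_sum_le; apply: Rsum_le => l _.
rewrite !Cmod_mult Cmod_conj; apply: Rmult_le_compat_r; first exact: Cmod_ge_0.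
by apply: Rmult_le_compat => //; apply: Cmod_ge_0.
Qed.

(* Kátai's argument: insert the number of prime factors, which is nearly constant, and use
   Cauchy-Schwarz to eliminate the multiplicative function. *)
Lemma katai_bound (f : nat -> C) (a : R) : unimodular_mult f ->
  L * Cmod (\Csum_(M.+1 <= n < N.+1) (f n * expi (INR n * a) * RtoC (/ INR n)))%C <=
  sqrt (hsum N * (L * hsum N + 2 * L ^ 2 * La)) + 2 * L * La +
  sqrt (hsum N * katai_kernel_sum a).
Proof.
move=> fP; have f1 n := unimodular_mult_le1 f n fP; have [_ [fM _]] := fP.
set F := fun n => (f n * expi (INR n * a) * RtoC (/ INR n))%C.
have FC n : Cmod (F n) <= / INR n.
  rewrite /F !Cmod_mult Cmod_expi Cmod_R Rabs_pos_eq; last exact: inv_INR_ge0.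
  have := f1 n; have := Cmod_ge_0 (f n); have := inv_INR_ge0 n; nra.
have L0 := psum_ge0 H; rewrite -/L in L0.
set Q := sqrt (hsum N * (L * hsum N + 2 * L ^ 2 * La)).
have hr : \Rsum_(M.+1 <= n < N.+1) / INR n <= hsum N.
  by apply: Rsum_range_le => n; apply: inv_INR_ge0.
have s1 : Cmod (\Csum_(M.+1 <= n < N.+1) (RtoC (L - omega n) * F n))%C <= Q.
  apply: Cmod_sum_le.
  apply: (Rle_trans _ (\Rsum_(M.+1 <= n < N.+1) (/ INR n * Rabs (omega n - L)))).
    apply: Rsum_le => n _; rewrite Cmod_mult Cmod_R Rabs_minus_sym Rmult_comm.
    by apply: Rmult_le_compat_r; first exact: Rabs_pos.
  rewrite /Q; apply: Rsum_CS_sqrt => //; first by move=> n _; apply: inv_INR_ge0.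
  apply: Rle_trans turan_kubilius; apply: Rle_trans (Rsum_range_le (fun n => / INR n * (omega n - L) ^ 2) _).
    by right; apply: eq_bigr => n _; rewrite RPow_abs Rabs_pos_eq //; apply: pow2_ge_0.
  by move=> n; apply: Rmult_le_pos; [apply: inv_INR_ge0 | apply: pow2_ge_0].
pose g p := fun m => (f m * expi (INR m * (INR p * a)))%C.
have g1 p m : Cmod (g p m) <= 1 by rewrite /g Cmod_mult Cmod_expi Rmult_1_r.
have e2 : (\Csum_(M.+1 <= n < N.+1) (RtoC (omega n) * F n) =
   \Csum_(1 <= p < H.+1 | prime p) (f p * RtoC (/ INR p) * (logsum (g p) (N %/ p) - logsum (g p) (M %/ p))))%C.
  transitivity (\Csum_(1 <= p < H.+1 | prime p) \Csum_(M.+1 <= n < N.+1) (if (p %| n)%N then F n else 0))%C.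
    rewrite [RHS]exchange_big /=; apply: eq_bigr => n _.
    rewrite /omega RtoC_sum big_distrl /=; apply: eq_bigr => p _.
    by case: ifP => _; ring.
  apply: eq_bigr => p pp; have p0 := prime_gt0 pp.
  have X K : (\Csum_(1 <= n < K.+1) (if (p %| n)%N then F n else 0) = f p * RtoC (/ INR p) * logsum (g p) (K %/ p))%C.
    rewrite -big_mkcond big_multiples // /logsum big_distrr /=; apply: eq_bigr => m _.
    rewrite /F /g fM INRM Rinv_mult RtoC_mult.
    have -> : INR p * INR m * a = INR m * (INR p * a) by ring.
    ring.
  have -> : (f p * RtoC (/ INR p) * (logsum (g p) (N %/ p) - logsum (g p) (M %/ p)) =
    f p * RtoC (/ INR p) * logsum (g p) (N %/ p) - f p * RtoC (/ INR p) * logsum (g p) (M %/ p))%C by ring.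
  rewrite -!X [in RHS](big_cat_nat (n := M.+1)) //=; ring.
(* The inner ranges from M / p to N / p are replaced by the range from M to N, at a cost of 1 + log
   p at each end. Then p and m vary independently and Cauchy-Schwarz over m applies. *)
have s2 : Cmod ((\Csum_(M.+1 <= n < N.+1) (RtoC (omega n) * F n)) -
   \Csum_(1 <= p < H.+1 | prime p) (f p * RtoC (/ INR p) * (logsum (g p) N - logsum (g p) M)))%C <= 2 * L * La.
  rewrite e2 -Csum_sub; apply: Cmod_sum_le.
  have -> : 2 * L * La = L * (2 * La) by ring.
  rewrite {1}/L /psum big_distrl /=; apply: Rsum_le_nat => p hp pp; have p0 := prime_gt0 pp.
  have -> : (f p * RtoC (/ INR p) * (logsum (g p) (N %/ p) - logsum (g p) (M %/ p)) -
     f p * RtoC (/ INR p) * (logsum (g p) N - logsum (g p) M) =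
     f p * RtoC (/ INR p) * ((logsum (g p) M - logsum (g p) (M %/ p)) + - (logsum (g p) N - logsum (g p) (N %/ p))))%C by ring.
  rewrite Cmod_mult; apply: Rmult_le_compat; try exact: Cmod_ge_0.
    rewrite Cmod_mult Cmod_R Rabs_pos_eq; last exact: inv_INR_ge0.
    have := f1 p; have := Cmod_ge_0 (f p); have := inv_INR_ge0 p; nra.
  apply: Cmod_add_le; rewrite Cmod_opp.
  have := logsum_diff (g p) (g1 p) _ _ (leq_div M p); have := logsum_diff (g p) (g1 p) _ _ (leq_div N p).
  have := hsum_sub_divn M p p0; have := hsum_sub_divn N p p0; have := prime_le_La p hp; lra.
have s3 : Cmod (\Csum_(1 <= p < H.+1 | prime p) (f p * RtoC (/ INR p) * (logsum (g p) N - logsum (g p) M)))%C <=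
   sqrt (hsum N * katai_kernel_sum a).
  have -> : (\Csum_(1 <= p < H.+1 | prime p) (f p * RtoC (/ INR p) * (logsum (g p) N - logsum (g p) M)) =
     \Csum_(M.+1 <= m < N.+1) (f m * RtoC (/ INR m) *
       \Csum_(1 <= p < H.+1 | prime p) (f p * RtoC (/ INR p) * expi (INR m * (INR p * a)))))%C.
    transitivity (\Csum_(1 <= p < H.+1 | prime p) \Csum_(M.+1 <= m < N.+1)
      (f m * RtoC (/ INR m) * (f p * RtoC (/ INR p) * expi (INR m * (INR p * a)))))%C.
      apply: eq_bigr => p _.
      have -> : (logsum (g p) N - logsum (g p) M = \Csum_(M.+1 <= m < N.+1) (g p m * RtoC (/ INR m)))%C.
        by rewrite /logsum (big_cat_nat (n := M.+1)) //=; ring.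
      by rewrite big_distrr /=; apply: eq_bigr => m _; rewrite /g; ring.
    rewrite exchange_big /=; apply: eq_bigr => m _.
    by rewrite big_distrr.
  apply: Cmod_sum_le.
  apply: Rle_trans (Rsum_CS_sqrt _ (index_iota M.+1 N.+1) xpredT (fun m => / INR m) _ _ _ _ hr (katai_bilinear f a f1)).
    apply: Rsum_le => m _; rewrite Cmod_mult; apply: Rmult_le_compat_r; first exact: Cmod_ge_0.
    rewrite Cmod_mult Cmod_R Rabs_pos_eq; last exact: inv_INR_ge0.
    have := f1 m; have := Cmod_ge_0 (f m); have := inv_INR_ge0 m; nra.
  by move=> m _; apply: inv_INR_ge0.
rewrite -{1}(Rabs_pos_eq L) // -Cmod_R -Cmod_mult big_distrr /=.
move: s2 s3; set A := (\Csum_(M.+1 <= n < N.+1) (RtoC (omega n) * F n))%C.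
set B := \big[Cplus/_]_(1 <= p < H.+1 | prime p) _ => s2 s3.
have -> : (\Csum_(M.+1 <= i < N.+1) (RtoC L * (f i * expi (INR i * a) * RtoC (/ INR i))) =
   \Csum_(M.+1 <= n < N.+1) (RtoC (L - omega n) * F n) + (A - B) + B)%C.
  rewrite /A; have -> : (\Csum_(M.+1 <= n < N.+1) (RtoC (L - omega n) * F n) +
    (\Csum_(M.+1 <= n < N.+1) (RtoC (omega n) * F n) - B) + B =
    \Csum_(M.+1 <= n < N.+1) (RtoC (L - omega n) * F n) + \Csum_(M.+1 <= n < N.+1) (RtoC (omega n) * F n))%C by ring.
  by rewrite -big_split /=; apply: eq_bigr => n _; rewrite RtoC_minus /F; ring.
have := Cmod_triangle (\Csum_(M.+1 <= n < N.+1) (RtoC (L - omega n) * F n) + (A - B))%C B.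
have := Cmod_triangle (\Csum_(M.+1 <= n < N.+1) (RtoC (L - omega n) * F n))%C (A - B)%C.
lra.
Qed.
End Katai.

(** * The group of characters modulo [r] *)

Lemma expi_frac_neq1 j n : (0 < j)%N -> (j < n)%N -> expi (INR j / INR n) <> RtoC 1.
Proof.
move=> j0 jn h; have n0 : (0 < n)%N by lia.
have := Cmod_1sub_expi (INR j / INR n); rewrite h.
have -> : (1 - 1 = 0)%C by ring.
rewrite Cmod_0 => e; have s0 : sin (PI * (INR j / INR n)) = 0.
  by case: (Req_dec (sin (PI * (INR j / INR n))) 0) => // /Rabs_pos_lt; lra.
have jp := INR_pos j j0; have np := INR_pos n n0; have jn' := lt_INR j n ltac:(lia).
have PI0 := PI_RGT_0.
have q0 : 0 < INR j / INR n by apply: Rdiv_lt_0_compat.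
have q1 : INR j / INR n < 1 by apply: (Rmult_lt_reg_r (INR n)) => //; rewrite /Rdiv Rmult_assoc Rinv_l; lra.
by have := sin_gt_0 (PI * (INR j / INR n)) ltac:(nra) ltac:(nra); lra.
Qed.

Lemma expi_frac_inj j k n : (j < n)%N -> (k < n)%N ->
  expi (INR j / INR n) = expi (INR k / INR n) -> j = k.
Proof.
wlog jk : j k / (j <= k)%N.
  by move=> H jn kn e; case: (leqP j k) => [|/ltnW] h; [exact: H | rewrite (H k j)].
move=> jn kn e; case: (posnP (k - j)) => h; first by lia.
case: (expi_frac_neq1 (k - j) n h ltac:(lia)).
rewrite minus_INR; last by lia.
have -> : (INR k - INR j) / INR n = INR k / INR n + - (INR j / INR n) by rewrite /Rdiv; ring.
by rewrite expi_add -e -expi_conj -Cmod2_conj Cmod_expi /= !Rmult_1_r.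
Qed.

Lemma expi_mod k n : (0 < n)%N -> expi (INR (k %% n) / INR n) = expi (INR k / INR n).
Proof.
move=> n0; have np := INR_pos n n0; rewrite {2}(divn_eq k n) INRD INRM.
have -> : (INR (k %/ n) * INR n + INR (k %% n)) / INR n = INR (k %/ n) + INR (k %% n) / INR n.
  by field; lra.
by rewrite expi_add expi_INR Cmult_1_l.
Qed.

Lemma expi_root_sum j n : (0 < n)%N -> (j < n)%N ->
  (\Csum_(0 <= k < n) expi (- (INR j * INR k / INR n)) = if j == 0%N then RtoC (INR n) else 0)%C.
Proof.
move=> n0 jn; have np := INR_pos n n0; case: eqP => [->|/eqP j0].
  under eq_bigr do rewrite Rmult_0_l /Rdiv Rmult_0_l Ropp_0 expi0.
  by rewrite -RtoC_sum Rsum_const count_predT size_iota subn0 Rmult_1_r.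
have := expi_geom_sum (- (INR j / INR n)) 0 n (leq0n n).
have -> : INR n * - (INR j / INR n) = - INR j by field; lra.
rewrite -!expi_conj expi_INR Cconj_R Rmult_0_l expi0.
have -> : (1 - 1 = 0)%C by ring.
case/Cmult_eq0 => [/Csub_eq0 h|h].
  have := expi_frac_neq1 j n; rewrite lt0n j0 => /(_ isT jn) [].
  by rewrite -(Cconj_conj (expi _)) -h Cconj_R.
by rewrite -[RHS]h; apply: eq_bigr => k _; congr expi; field; lra.
Qed.

Definition periodic_on_units (r : nat) (phi : nat -> C) : Prop :=
  (forall x, phi (x %% r)%N = phi x) /\ (forall x, ~~ coprime x r -> phi x = RtoC 0).

Lemma periodic_congr r phi x y : periodic_on_units r phi -> x = y %[mod r] -> phi x = phi y.
Proof. by case=> per _ e; rewrite -per e per. Qed.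

Section EigenProjection.
Variables (r g : nat) (phi : nat -> C).
Hypotheses (r0 : (0 < r)%N) (cg : coprime g r) (phiP : periodic_on_units r phi).
Let n := totient r.

(** The projection onto the functions that shifting by [g] multiplies by e(k/n). It exists because
    g^n = 1 modulo r for n = [totient r], so the shift has order dividing n on [phi]. Characters are
    produced as common eigenfunctions of all shifts. *)
Definition eigen_proj (k x : nat) : C :=
  (RtoC (/ INR n) * \Csum_(0 <= j < n) (expi (- (INR j * INR k / INR n)) * phi (g ^ j * x)%N))%C.

Let n0 : (0 < n)%N. Proof. by rewrite totient_gt0. Qed.

Lemma eigen_proj_periodic k : periodic_on_units r (eigen_proj k).
Proof.
split=> [x|x cx]; rewrite /eigen_proj.
  congr Cmult; apply: eq_bigr => j _; congr Cmult.
  by apply: (periodic_congr r) => //; rewrite modnMmr.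
rewrite big1 ?Cmult_0_r // => j _; case: phiP => _ ->; rewrite ?Cmult_0_r //.
by rewrite coprimeMl negb_and cx orbT.
Qed.

Lemma eigen_proj_sum x : (\Csum_(0 <= k < n) eigen_proj k x = phi x)%C.
Proof.
have np := INR_pos n n0.
rewrite /eigen_proj -big_distrr /= exchange_big /=.
rewrite (eq_big_nat _ _ (F2 := fun j => if j == 0%N then (RtoC (INR n) * phi x)%C else RtoC 0)).
  rewrite big_ltn // big1_seq => [|j]; last first.
    by rewrite mem_index_iota => /andP[_ /andP[j0 _]]; case: j j0.
  by rewrite Cplus_0_r Cmult_assoc -RtoC_mult Rinv_l ?Cmult_1_l //; lra.
move=> j /andP[_ jn]; rewrite -big_distrl /= expi_root_sum //.
by case: eqP => [->|_]; rewrite ?expn0 ?mul1n // Cmult_0_l.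
Qed.

Lemma eigen_proj_eigen k x : eigen_proj k (g * x)%N = (expi (INR k / INR n) * eigen_proj k x)%C.
Proof.
have np := INR_pos n n0.
pose F j := (expi (- (INR j * INR k / INR n)) * phi (g ^ j * x)%N)%C.
have Fn : F n = F 0%N.
  rewrite /F; congr Cmult.
    have -> : - (INR n * INR k / INR n) = - INR k by field; lra.
    by rewrite -expi_conj expi_INR Cconj_R Rmult_0_l /Rdiv Rmult_0_l Ropp_0 expi0.
  apply: (periodic_congr r) => //; rewrite expn0 -modnMml Euler_exp_totient //.
  by rewrite modnMml.
have shift : (\Csum_(0 <= j < n) F j.+1 = \Csum_(0 <= j < n) F j)%C.
  have e1 : (\Csum_(0 <= j < n.+1) F j = F 0%N + \Csum_(0 <= j < n) F j.+1)%C by rewrite big_nat_recl.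
  have e2 : (\Csum_(0 <= j < n.+1) F j = \Csum_(0 <= j < n) F j + F n)%C by rewrite big_nat_recr.
  apply: Csub_eq0; have -> : (\Csum_(0 <= j < n) F j.+1 = \Csum_(0 <= j < n.+1) F j - F 0%N)%C by rewrite e1; ring.
  by rewrite e2 Fn; ring.
rewrite /eigen_proj -/(F _) -[X in (_ = _ * (_ * X))%C]shift.
rewrite Cmult_assoc [(expi _ * RtoC _)%C]Cmult_comm -Cmult_assoc; congr Cmult.
rewrite big_distrr /=; apply: eq_bigr => j _; rewrite /F mulnA -expnSr Cmult_assoc -expi_add; congr (expi _ * _)%C.
by rewrite S_INR; field; lra.
Qed.
End EigenProjection.

(** Simultaneous diagonalisation, one shift at a time, from the indicator of the class of 1. The
    projections of [phi] add up to [phi], so one of them still separates [a] from 1; and they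
    commute with the earlier shifts, whose eigenvalue relations therefore persist. *)
Lemma eigen_exists (r a : nat) (gs : seq nat) : (0 < r)%N -> coprime a r -> a <> 1 %[mod r] ->
  exists phi, periodic_on_units r phi /\ phi a <> phi 1%N /\
  forall g, g \in gs -> coprime g r ->
    exists k, (k < totient r)%N /\ forall x, phi (g * x)%N = (expi (INR k / INR (totient r)) * phi x)%C.
Proof.
move=> r0 ca a1; elim: gs => [|g gs [phi [phiP [na IH]]]].
  exists (fun x => if (x == 1 %[mod r])%N then RtoC 1 else RtoC 0); split; last split=> //.
    split=> [x|x cx]; first by rewrite modn_mod.
    case: eqP => // e; case/negP: cx; by rewrite -coprime_modl e coprime_modl coprime1n.
  by rewrite eqxx; case: eqP => // _ [h]; lra.
case cg: (coprime g r); last first.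
  exists phi; split=> //; split=> // h; rewrite inE => /orP[/eqP->|]; [by rewrite cg | exact: IH].
have [k [kn nk]] : exists k, (k < totient r)%N /\ eigen_proj r g phi k a <> eigen_proj r g phi k 1.
  case: (classic (exists k, (k < totient r)%N /\ eigen_proj r g phi k a <> eigen_proj r g phi k 1)) => // H.
  case: na; rewrite -(eigen_proj_sum r g phi r0 a) -(eigen_proj_sum r g phi r0 1%N).
  apply: eq_big_nat => k /andP[_ kn]; apply: NNPP => h; apply: H; by exists k.
exists (eigen_proj r g phi k); split; first exact: eigen_proj_periodic.
split=> // h; rewrite inE => /orP[/eqP-> _|hin ch].
  by exists k; split=> // x; apply: eigen_proj_eigen.
have [k' [k'n e]] := IH h hin ch; exists k'; split=> // x; rewrite /eigen_proj.
rewrite Cmult_assoc [(expi _ * RtoC _)%C]Cmult_comm -Cmult_assoc; congr Cmult.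
rewrite big_distrr /=; apply: eq_bigr => j _.
by rewrite mulnCA e; ring.
Qed.

Definition root_valued (r : nat) (xi : nat -> C) : Prop :=
  forall x, coprime x r -> exists k, (k < totient r)%N /\ xi x = expi (INR k / INR (totient r)).

(** An eigenfunction of all shifts by units becomes multiplicative on division by its value at 1,
    and that value is nonzero: otherwise the eigenfunction would vanish at [a] too. *)
Lemma char_separation (r a : nat) : (0 < r)%N -> coprime a r -> a <> 1 %[mod r] ->
  exists xi, is_dirichlet_char r xi /\ root_valued r xi /\ xi a <> RtoC 1.
Proof.
move=> r0 ca a1; have [phi [phiP [na eig]]] := eigen_exists r a (iota 0 r) r0 ca a1.
have eig' g : coprime g r -> exists k, (k < totient r)%N /\
    forall x, phi (g * x)%N = (expi (INR k / INR (totient r)) * phi x)%C.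
  move=> cg; have [||k [kn e]] := eig (g %% r)%N.
  - by rewrite mem_iota ltn_pmod.
  - by rewrite coprime_modl.
  exists k; split=> // x; rewrite -e; apply: (periodic_congr r) => //; by rewrite modnMml.
have p1 : phi 1%N <> RtoC 0.
  move=> h; case: na; have [k [_ e]] := eig' a ca.
  by have := e 1%N; rewrite muln1 h Cmult_0_r.
have val g k : (forall x, phi (g * x)%N = (expi (INR k / INR (totient r)) * phi x)%C) ->
    (phi g / phi 1%N)%C = expi (INR k / INR (totient r)).
  by move=> e; have := e 1%N; rewrite muln1 => ->; field.
exists (fun x => phi x / phi 1%N)%C; split; last split.
- split; last split.
  + move=> x y; case cx: (coprime x r).
      have [k [_ e]] := eig' x cx; by rewrite (val x k e) e; field.
    case: (phiP) => _ sup; rewrite (sup x) ?cx // (sup (x * y)%N) ?coprimeMl ?cx //; by field.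
  + by move=> x; congr Cdiv; apply: (periodic_congr r) => //; rewrite modnDr.
  + move=> x; case cx: (coprime x r).
      have [k [_ e]] := eig' x cx; rewrite (val x k e); split; last by move: cx => /eqP ->.
      by move=> h; have := Cmod_expi (INR k / INR (totient r)); rewrite h Cmod_0; lra.
    split; first by move=> _ /eqP; rewrite -/(coprime x r) cx.
    by move=> _; case: (phiP) => _ ->; rewrite ?cx //; field.
- by move=> x cx; have [k [kn e]] := eig' x cx; exists k; split=> //; apply: val.
- by move=> h; case: na; rewrite -(Cmult_1_l (phi 1%N)) -h; field.
Qed.

Lemma is_char_mul_same r x1 x2 : (0 < r)%N -> is_dirichlet_char r x1 -> is_dirichlet_char r x2 ->
  is_dirichlet_char r (fun n => x1 n * x2 n)%C.
Proof.
move=> r0 h1 h2; case: (h1) => m1 [per1 z1]; case: (h2) => m2 [per2 z2]; split; last split.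
- by move=> m n; rewrite m1 m2; ring.
- by move=> n; rewrite per1 per2.
move=> n; split; first by case/Cmult_eq0; [move/z1 | move/z2].
by move/z1 => ->; rewrite Cmult_0_l.
Qed.

Section CharacterGroup.
Variable r' : nat.
Let r := r'.+1.
Let n' := (totient r).-1.
Let n := n'.+1.
Local Notation Om := {ffun 'I_r'.+1 -> 'I_n'.+1}.

Lemma totient_n : totient r = n.
Proof. by rewrite /n /n' prednK // totient_gt0. Qed.

(** A character is stored as the table of exponents of its values, which are roots of unity of order
    dividing [totient r]. These tables form a finite type, so sums over all characters are ordinary
    big operators. *)
Definition chi_of (w : Om) (x : nat) : C :=
  if coprime x r then expi (INR (w (inord (x %% r))) / INR n) else RtoC 0.

(** The exponents at nonunits do not affect [chi_of]; fixing them to 0 makes the table of a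
    character unique. *)
Definition char_index (w : Om) : Prop :=
  is_dirichlet_char r (chi_of w) /\ forall i : 'I_r'.+1, ~~ coprime i r -> w i = ord0.

Definition char_indices : {set Om} :=
  [set w | if excluded_middle_informative (char_index w) then true else false].

Lemma char_indicesP w : w \in char_indices <-> char_index w.
Proof. by rewrite inE; case: excluded_middle_informative. Qed.

Lemma chi_of_char w : w \in char_indices -> is_dirichlet_char r (chi_of w).
Proof. by move/char_indicesP => []. Qed.

Lemma char_indices_separates w v : w \in char_indices -> v \in char_indices ->
  (forall x, coprime x r -> chi_of w x = chi_of v x) -> w = v.
Proof.
move=> /char_indicesP[_ hw] /char_indicesP[_ hv] e; apply/ffunP => i.
case ci: (coprime i r); last by rewrite hw ?hv ?ci.
have := e i ci; rewrite /chi_of ci modn_small // inord_val => h.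
by apply: val_inj; apply: (expi_frac_inj _ _ n (ltn_ord _) (ltn_ord _) h).
Qed.

Lemma char_indices_complete xi : is_dirichlet_char r xi -> root_valued r xi ->
  exists w, w \in char_indices /\ forall x, chi_of w x = xi x.
Proof.
move=> xiP rv.
have H (i : 'I_r'.+1) : exists k : 'I_n'.+1,
    if coprime i r then xi i = expi (INR k / INR n) else k = ord0.
  case ci: (coprime i r); last by exists ord0.
  have [k [kn e]] := rv i ci; rewrite totient_n in kn e; by exists (Ordinal kn).
pose F i := proj1_sig (constructive_indefinite_description _ (H i)).
have FP (i : 'I_r'.+1) : if coprime i r then xi i = expi (INR (F i) / INR n) else F i = ord0.
  exact: (proj2_sig (constructive_indefinite_description _ (H i))).
exists [ffun i => F i].
have e x : chi_of [ffun i => F i] x = xi x.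
  rewrite /chi_of; case cx: (coprime x r); last by rewrite (char_zero r) ?cx.
  rewrite ffunE; have := FP (inord (x %% r)); rewrite inordK ?ltn_pmod // coprime_modl cx => <-.
  by rewrite -(char_mod r).
split=> //; apply/char_indicesP; split.
  by have -> : chi_of [ffun i => F i] = xi by apply: FunctionalExtensionality.functional_extensionality.
by move=> i /negbTE ci; rewrite ffunE; have := FP i; rewrite ci.
Qed.

Definition mul_index (v w : Om) : Om := [ffun i => inord ((w i + v i) %% n)].

Lemma chi_of_mul_index v w x : chi_of (mul_index v w) x = (chi_of w x * chi_of v x)%C.
Proof.
rewrite /chi_of; case: ifP => _; last by rewrite Cmult_0_l.
rewrite ffunE inordK ?ltn_pmod // expi_mod // INRD -expi_add; congr expi.
by rewrite /Rdiv; ring.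
Qed.

Lemma mul_index_inj v : injective (mul_index v).
Proof.
move=> w w' /ffunP e; apply/ffunP => i; apply: val_inj => /=.
have := f_equal val (e i); rewrite !ffunE /= !inordK ?ltn_pmod // => /eqP.
by rewrite eqn_modDr !modn_small // => /eqP.
Qed.

Lemma mul_index_char_indices v w : v \in char_indices -> w \in char_indices -> mul_index v w \in char_indices.
Proof.
move=> /char_indicesP[cv zv] /char_indicesP[cw zw]; apply/char_indicesP; split.
  have -> : chi_of (mul_index v w) = (fun x => chi_of w x * chi_of v x)%C.
    by apply: FunctionalExtensionality.functional_extensionality => x; apply: chi_of_mul_index.
  exact: is_char_mul_same.
move=> i ci; rewrite ffunE zv // zw //= addn0 mod0n; apply: val_inj; by rewrite /= inordK.
Qed.

Lemma mul_index_imset v : v \in char_indices -> mul_index v @: char_indices = char_indices.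
Proof.
move=> hv; apply/eqP; rewrite eqEcard card_imset ?leqnn ?andbT; last exact: mul_index_inj.
by apply/subsetP => _ /imsetP[w hw ->]; apply: mul_index_char_indices.
Qed.

Lemma char_indices_sum a : coprime a r ->
  (\Csum_(w | w \in char_indices) chi_of w a = if a == 1 %[mod r] then RtoC (INR #|char_indices|) else 0)%C.
Proof.
move=> ca; case: eqP => [e|a1].
  rewrite (eq_bigr (fun _ => RtoC 1)); last first.
    by move=> w hw; rewrite (char_congr r _ (chi_of_char w hw) a 1%N) // (char_one r) //; apply: chi_of_char.
  by rewrite -RtoC_sum Rsum_const Rmult_1_r cardE size_filter.
have [xi [xiP [rv nx]]] := char_separation r a isT ca a1.
have [v [hv ev]] := char_indices_complete xi xiP rv.
have e : (\Csum_(w | w \in char_indices) chi_of w a = xi a * \Csum_(w | w \in char_indices) chi_of w a)%C.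
  rewrite -{1}(mul_index_imset v hv) big_imset /=; last by move=> w w' _ _; apply: mul_index_inj.
  by rewrite big_distrr /=; apply: eq_bigr => w _; rewrite chi_of_mul_index ev Cmult_comm.
have : ((1 - xi a) * (\Csum_(w | w \in char_indices) chi_of w a) = 0)%C.
  by rewrite Cmult_plus_distr_r {1}Cmult_1_l {1}e; ring.
by case/Cmult_eq0 => // /Csub_eq0 h; case: nx.
Qed.

Lemma sum_coprime_totient : \Rsum_(0 <= a < r) (if coprime a r then 1 else 0) = INR n.
Proof.
rewrite -totient_n totient_count_coprime.
rewrite (big_morph INR INRD (erefl (INR 0))); apply: eq_bigr => a _.
by rewrite coprime_sym; case: (coprime r a).
Qed.

(** Double counting of the values chi(a): summing over characters first, only a = 1 survives and
    gives the number of characters; summing over a first, only the trivial character survives and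
    gives [totient r]. *)
Lemma card_char_indices : #|char_indices| = n.
Proof.
apply: INR_eq; have rp : (0 < r)%N by [].
pose w0 : Om := [ffun i => ord0].
have w0E x : chi_of w0 x = if coprime x r then RtoC 1 else RtoC 0.
  by rewrite /chi_of; case: ifP => //; rewrite ffunE /= /Rdiv Rmult_0_l expi0.
have hw0 : w0 \in char_indices.
  apply/char_indicesP; split; last by move=> i _; rewrite ffunE.
  split; last split.
  - by move=> x y; rewrite !w0E coprimeMl; case: (coprime x r); case: (coprime y r) => /=; ring.
  - by move=> x; rewrite !w0E -coprime_modl modnDr coprime_modl.
  - move=> x; rewrite w0E; case: ifP => [/eqP ->|/eqP h]; last by [].
    by split=> // -[h]; lra.
suff : RtoC (INR #|char_indices|) = RtoC (INR n) by case.
transitivity (\Csum_(0 <= a < r) \Csum_(w | w \in char_indices) chi_of w a)%C.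
  (* The representative [1 %% r] of 1 also covers r = 1. *)
  symmetry; rewrite (bigD1_seq (1 %% r)%N) ?iota_uniq ?mem_index_iota ?ltn_pmod //=.
  rewrite [X in (_ + X)%C]big1_seq => [|a /andP[a1]].
    by rewrite char_indices_sum ?modn_mod ?eqxx ?Cplus_0_r // coprime_modl coprime1n.
  rewrite mem_index_iota /= => ar; case ca: (coprime a r).
    by rewrite char_indices_sum // (modn_small ar) (negbTE a1).
  by rewrite big1 // => w _; rewrite /chi_of ca.
rewrite exchange_big /= (bigD1 w0) //= [X in (_ + X)%C]big1 => [|w /andP[hw ww0]].
  rewrite Cplus_0_r; transitivity (RtoC (INR n)) => //.
  rewrite -sum_coprime_totient RtoC_sum; apply: eq_bigr => a _.
  by rewrite w0E; case: ifP.
apply: (char_sum_period r) => //; first exact: chi_of_char.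
apply: NNPP => H; case/eqP: ww0; apply: char_indices_separates => // x cx.
by rewrite w0E cx; apply: NNPP => h; apply: H; exists x.
Qed.

Definition char_coef (phi : nat -> C) (w : Om) : C :=
  (RtoC (/ INR n) * \Csum_(0 <= b < r) (phi b * Cconj (chi_of w b)))%C.

Lemma char_coef_le phi w : (forall b, Cmod (phi b) <= 1) -> Cmod (char_coef phi w) <= 1.
Proof.
move=> h; have np : 0 < INR n by apply: INR_pos.
rewrite /char_coef Cmod_mult Cmod_R Rabs_pos_eq; last exact: inv_INR_ge0.
apply: (Rmult_le_reg_l (INR n)) => //; rewrite -Rmult_assoc Rinv_r ?Rmult_1_l ?Rmult_1_r; last lra.
apply: Cmod_sum_le; rewrite -sum_coprime_totient.
apply: Rsum_le => b _; rewrite Cmod_mult Cmod_conj /chi_of; case: ifP => _.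
  by rewrite Cmod_expi Rmult_1_r.
by rewrite Cmod_0 Rmult_0_r; lra.
Qed.

Lemma char_expansion phi m : periodic_on_units r phi ->
  phi m = (\Csum_(w | w \in char_indices) (char_coef phi w * chi_of w m))%C.
Proof.
move=> phiP; have np : 0 < INR n by apply: INR_pos.
case cm: (coprime m r); last first.
  case: (phiP) => _ ->; rewrite ?cm // big1 // => w _; by rewrite /chi_of cm Cmult_0_r.
(* Inversion as a power: conj (chi b) = chi (b^n') with n' + 1 = [totient r], by Euler. *)
have e w b : w \in char_indices -> coprime b r -> (Cconj (chi_of w b) * chi_of w m = chi_of w (b ^ n' * m)%N)%C.
  move=> hw cb; have cw := chi_of_char w hw; have um := char_unimodular r _ isT cw.
  case: (um) => _ [mul _]; rewrite mul (unimodular_mult_pow _ b n' um); congr Cmult.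
  have h1 : (Cpow (chi_of w b) n' * chi_of w b = 1)%C.
    have := char_pow_totient r _ cw b cb; rewrite totient_n /n /= => <-; ring.
  have h2 : (Cconj (chi_of w b) * chi_of w b = 1)%C.
    rewrite Cmult_comm -Cmod2_conj (char_nz r) //=; by rewrite !Rmult_1_r.
  by rewrite -[LHS]Cmult_1_r -h1 Cmult_assoc [(_ * Cpow _ _)%C]Cmult_comm -Cmult_assoc h2 Cmult_1_r.
transitivity (RtoC (/ INR n) * \Csum_(0 <= b < r) (phi b * \Csum_(w | w \in char_indices) (Cconj (chi_of w b) * chi_of w m)))%C.
  rewrite (bigD1_seq (m %% r)%N) ?iota_uniq ?mem_index_iota ?ltn_pmod //=.
  have cmm : coprime (m %% r) r by rewrite coprime_modl.
  rewrite [X in (_ + X)%C]big1_seq => [|b /andP[bm]].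
    rewrite (eq_bigr (fun w => chi_of w ((m %% r) ^ n' * m)%N)) => [|w hw]; last exact: e.
    rewrite char_indices_sum; last by rewrite coprimeMl coprimeXl.
    have -> : ((m %% r) ^ n' * m == 1 %[mod r])%N.
      rewrite -modnMml modnXm modnMml -expnSr -/n -totient_n; exact/eqP/Euler_exp_totient.
    case: (phiP) => -> _; rewrite card_char_indices Cplus_0_r Cmult_comm -Cmult_assoc -RtoC_mult Rinv_r ?Cmult_1_r //; lra.
  rewrite mem_index_iota /= => br; case cb: (coprime b r); last first.
    by case: (phiP) => _ ->; rewrite ?cb // Cmult_0_l.
  rewrite (eq_bigr (fun w => chi_of w (b ^ n' * m)%N)) => [|w hw]; last exact: e.
  rewrite char_indices_sum; last by rewrite coprimeMl coprimeXl ?cm.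
  case: eqP => [h|_]; last by rewrite Cmult_0_r.
  case/eqP: bm; have : (b * (b ^ n' * m) = b * 1 %[mod r])%N by rewrite -modnMmr h modnMmr.
  rewrite mulnA -expnS muln1 -modnMml -/n -totient_n Euler_exp_totient // modnMml mul1n.
  by rewrite (modn_small br).
rewrite /char_coef; under [RHS]eq_bigr => w _ do rewrite -Cmult_assoc big_distrl /=.
rewrite -big_distrr /= exchange_big /=; congr Cmult; apply: eq_bigr => b _.
by rewrite big_distrr /=; apply: eq_bigr => w _; ring.
Qed.

(** [r'] represents -1, so chi(r') is 1 or -1. If it is -1 the character is odd; if it is 1, the
    substitution b -> r' b changes the sign of the coefficient sum. *)
Lemma char_coef_odd phi w : periodic_on_units r phi -> odd_char r phi -> w \in char_indices ->
  ~ odd_char r (chi_of w) -> char_coef phi w = RtoC 0.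
Proof.
move=> phiP odd hw nodd; have cw := chi_of_char w hw.
have [mul _] := cw.
have c1 : coprime r' r by rewrite coprime_sym; apply: coprimeSn.
have sq : (r' * r' = 1 %[mod r])%N.
  case: (posnP r') => [r0|r'0]; first by rewrite /r r0.
  have -> : (r' * r' = r'.-1 * r + 1)%N by rewrite /r; nia.
  by rewrite modnMDl.
have pm : chi_of w r' = RtoC 1 \/ chi_of w r' = (- RtoC 1)%C.
  have : ((chi_of w r' - 1) * (chi_of w r' - - (1)) = 0)%C.
    have : (chi_of w r' * chi_of w r' = 1)%C by rewrite -mul (char_congr r _ cw _ _ sq) (char_one r).
    by move=> h; transitivity (chi_of w r' * chi_of w r' - 1)%C; [ring | rewrite h; ring].
  by case/Cmult_eq0 => /Csub_eq0; [left | right].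
case: pm => h; last first.
  case: nodd => a b ab.
  have ea : (a = r' * b %[mod r])%N.
    apply/eqP; rewrite -(eqn_modDr b); have -> : (r' * b + b = b * r)%N by rewrite /r; lia.
    by rewrite modnMl; exact: ab.
  by rewrite (char_congr r _ cw _ _ ea) mul h; ring.
rewrite /char_coef; set S := (\Csum_(0 <= b < r) _)%C.
suff e : S = (- S)%C.
  suff -> : S = RtoC 0 by rewrite Cmult_0_r.
  have : (RtoC 2 * S = 0)%C by rewrite -[RHS](Cplus_opp_r S) -e; ring.
  by case/Cmult_eq0 => // -[]; lra.
rewrite {1}/S -(big_mul_mod _ _ _ r' r) //= /S -Csum_opp; apply: eq_bigr => b _.
case: (phiP) => -> _; rewrite (odd (r' * b)%N b); last by rewrite -mulSnr dvdn_mulr.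
by rewrite -(char_mod r) // mul h Cmult_1_l; ring.
Qed.
End CharacterGroup.

Lemma odd_function_expansion (r : nat) : (0 < r)%N ->
  exists (I : finType) (X : {set I}) (xi : I -> nat -> C),
    (#|X| <= r)%N /\
    (forall w, w \in X -> is_dirichlet_char r (xi w)) /\
    (forall w v, w \in X -> v \in X -> w <> v ->
       exists a, coprime a r /\ xi w a <> xi v a) /\
    forall phi, periodic_on_units r phi -> odd_char r phi -> (forall b, Cmod (phi b) <= 1) ->
    exists c : I -> C, (forall w, Cmod (c w) <= 1) /\
      forall m, phi m = (\Csum_(w | (w \in X) &&
         (if excluded_middle_informative (odd_char r (xi w)) then true else false)) (c w * xi w m))%C.
Proof.
case: r => // r' _.
exists {ffun 'I_r'.+1 -> 'I_(totient r'.+1).-1.+1}, (char_indices r'), (chi_of r'); split; last split; last split.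
- rewrite card_char_indices -totient_n totient_count_coprime.
  apply: (@leq_trans (\sum_(0 <= d < r'.+1) 1)%N); last by rewrite sum_nat_const_nat subn0 muln1.
  by apply: leq_sum => d _; apply: leq_b1.
- exact: chi_of_char.
- move=> w v hw hv wv; apply: NNPP => H; case: wv; apply: char_indices_separates => // x cx.
  by apply: NNPP => h; apply: H; exists x.
move=> phi phiP odd b1; exists (char_coef r' phi); split; first by move=> w; apply: char_coef_le.
move=> m; rewrite (char_expansion r' phi m phiP) [LHS]big_mkcond [RHS]big_mkcond /=.
apply: eq_bigr => w _; case hw: (w \in _) => //=.
by case: excluded_middle_informative => // nodd; rewrite char_coef_odd // Cmult_0_l.
Qed.

(** * Minor arcs and the tails of major arcs *)

(** Concavity of the sine by two mean value steps: a point below the chord would give cos c1 < 2 /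
    PI < cos c2 with c1 < c2, against the monotonicity of the cosine. *)
Lemma jordan (x : R) : 0 <= x <= / 2 -> 2 * x <= sin (PI * x).
Proof.
move=> hx; have pi0 := PI_RGT_0.
case: (Req_dec x 0) => [->|x0]; first by rewrite !Rmult_0_r sin_0; lra.
case: (Req_dec x (/ 2)) => [->|x2].
  by have -> : PI * / 2 = PI / 2 by []; rewrite sin_PI2; lra.
have t0 : 0 < PI * x by nra.
have t1 : PI * x < PI / 2 by nra.
have d c : derivable_pt_lim sin c (cos c) by apply: derivable_pt_lim_sin.
have [c1 [e1 h1]] := MVT_cor2 sin cos 0 (PI * x) t0 (fun c _ => d c).
have [c2 [e2 h2]] := MVT_cor2 sin cos (PI * x) (PI / 2) t1 (fun c _ => d c).
rewrite sin_0 in e1; rewrite sin_PI2 in e2.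
have dec : cos c2 < cos c1 by apply: cos_decreasing_1; lra.
case: (Rle_lt_dec (2 * x) (sin (PI * x))) => // h.
have : PI * cos c1 < 2 by apply: (Rmult_lt_reg_r x); lra.
have : 2 < PI * cos c2 by apply: (Rmult_lt_reg_r (/ 2 - x)); nra.
nra.
Qed.

Lemma abs_sin_expi x : Rabs (sin (PI * x)) = Cmod (1 - expi x)%C / 2.
Proof. by rewrite Cmod_1sub_expi; field. Qed.

Lemma abs_sin_period x k : Rabs (sin (PI * (x + IZR k))) = Rabs (sin (PI * x)).
Proof. by rewrite !abs_sin_expi expi_period. Qed.

Lemma abs_sin_opp x : Rabs (sin (PI * - x)) = Rabs (sin (PI * x)).
Proof. by rewrite Ropp_mult_distr_r_reverse sin_neg Rabs_Ropp. Qed.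

Lemma abs_sin_add x z : Rabs (sin (PI * (x + z))) <= Rabs (sin (PI * x)) + Rabs (sin (PI * z)).
Proof.
rewrite !abs_sin_expi expi_add.
have -> : (1 - expi x * expi z = (1 - expi x) + expi x * (1 - expi z))%C by ring.
have := Cmod_triangle (1 - expi x)%C (expi x * (1 - expi z))%C.
by rewrite Cmod_mult Cmod_expi; lra.
Qed.

Lemma abs_sin_le x : Rabs (sin (PI * x)) <= PI * Rabs x.
Proof.
have pi0 := PI_RGT_0.
have pos z : 0 <= z -> Rabs (sin (PI * z)) <= PI * z.
  move=> z0; case: (Req_dec z 0) => [->|z1]; first by rewrite Rmult_0_r sin_0 Rabs_R0; lra.
  have h := sin_lt_x (PI * z) ltac:(nra).
  apply: Rabs_le; split; last lra.
  case: (Rle_lt_dec z 1) => z2; last by have := SIN_bound (PI * z); have := PI2_3_2; nra.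
  by have := sin_ge_0 (PI * z) ltac:(nra) ltac:(nra); nra.
case: (Rle_lt_dec 0 x) => h; first by rewrite (Rabs_pos_eq x) //; apply: pos.
by rewrite -abs_sin_opp -(Rabs_Ropp x) (Rabs_pos_eq (- x)); [apply: pos; lra | lra].
Qed.

Lemma abs_sin_ge x : Rabs x <= / 2 -> 2 * Rabs x <= Rabs (sin (PI * x)).
Proof.
move=> hx; have h := jordan (Rabs x) (conj (Rabs_pos x) hx).
apply: (Rle_trans _ _ _ h); apply: (Rle_trans _ _ _ (Rle_abs _)); right.
case: (Rle_lt_dec 0 x) => x0; first by rewrite (Rabs_pos_eq x).
by rewrite (Rabs_left x) // abs_sin_opp.
Qed.

Lemma near_integer x : exists k : Z, Rabs (x - IZR k) <= / 2 /\ 2 * Rabs (x - IZR k) <= Rabs (sin (PI * x)).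
Proof.
suff [k hk] : exists k : Z, Rabs (x - IZR k) <= / 2.
  exists k; split=> //; have := abs_sin_ge _ hk.
  by rewrite -(abs_sin_period (x - IZR k) k); have -> : x - IZR k + IZR k = x by ring.
have [h1 h2] := base_Int_part x.
case: (Rle_lt_dec (x - IZR (Int_part x)) (/ 2)) => h.
  by exists (Int_part x); apply: Rabs_le; lra.
by exists (Int_part x + 1)%Z; rewrite plus_IZR; apply: Rabs_le; lra.
Qed.

Lemma abs_sin_frac (m : Z) (r : nat) : (0 < r)%N -> (forall k : Z, m <> (k * Z.of_nat r)%Z) ->
  2 / INR r <= Rabs (sin (PI * (IZR m / INR r))).
Proof.
move=> r0 h; have rp := INR_pos r r0.
have [k [_ hk]] := near_integer (IZR m / INR r); apply: Rle_trans hk.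
have e : IZR m / INR r - IZR k = IZR (m - k * Z.of_nat r) * / INR r.
  by rewrite minus_IZR mult_IZR -INR_IZR_INZ; field; lra.
have ir := Rinv_0_lt_compat _ rp.
rewrite e Rabs_mult (Rabs_pos_eq (/ INR r)); last lra.
have : 1 <= Rabs (IZR (m - k * Z.of_nat r)).
  by rewrite -abs_IZR; apply: (IZR_le 1); have := h k; lia.
rewrite /Rdiv; nra.
Qed.

Lemma sqrt_add_le a b : 0 <= a -> 0 <= b -> sqrt (a + b) <= sqrt a + sqrt b.
Proof.
move=> a0 b0; have sa := sqrt_pos a; have sb := sqrt_pos b.
rewrite -(sqrt_pow2 (sqrt a + sqrt b)); last lra.
apply: sqrt_le_1_alt; have := sqrt_sqrt a a0; have := sqrt_sqrt b b0; rewrite /=; nra.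
Qed.

(** Kátai's inequality divided by L, to be used with L = [psum H]. The kernel sum W is split into
    the resonant pairs, A h L, where the kernel is only bounded by h, and the other pairs, L^2 B;
    the gain over the trivial bound h is sqrt L. *)
Lemma katai_divide (L h La W A B S : R) : 1 <= L -> 0 <= h -> 0 <= La -> 0 <= A -> 0 <= B ->
  W <= A * h * L + L ^ 2 * B ->
  L * S <= sqrt (h * (L * h + 2 * L ^ 2 * La)) + 2 * L * La + sqrt (h * W) ->
  S <= (1 + sqrt A) * h / sqrt L + sqrt (2 * h * La) + 2 * La + sqrt (h * B).
Proof.
move=> L1 h0 La0 A0 B0 hW hS.
have sL := sqrt_lt_R0 L ltac:(lra); have sLL := sqrt_sqrt L ltac:(lra).
have e1 : sqrt (h * (L * h + 2 * L ^ 2 * La)) <= h * sqrt L + L * sqrt (2 * h * La).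
  have -> : h * (L * h + 2 * L ^ 2 * La) = h ^ 2 * L + L ^ 2 * (2 * h * La) by ring.
  apply: Rle_trans (sqrt_add_le _ _ _ _) _.
  - by apply: Rmult_le_pos; [apply: pow2_ge_0 | lra].
  - by apply: Rmult_le_pos; [apply: pow2_ge_0 | apply: Rmult_le_pos; lra].
  rewrite (sqrt_mult_alt (h ^ 2)); last by apply: pow2_ge_0.
  rewrite (sqrt_mult_alt (L ^ 2)); last by apply: pow2_ge_0.
  by rewrite !sqrt_pow2 //; lra.
have e2 : sqrt (h * W) <= sqrt A * h * sqrt L + L * sqrt (h * B).
  apply: (Rle_trans _ (sqrt (A * h ^ 2 * L + L ^ 2 * (h * B)))).
    by apply: sqrt_le_1_alt; have := Rmult_le_compat_l h _ _ h0 hW; lra.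
  have h20 := pow2_ge_0 h.
  apply: Rle_trans (sqrt_add_le _ _ _ _) _.
  - by repeat apply: Rmult_le_pos; lra.
  - by apply: Rmult_le_pos; [apply: pow2_ge_0 | apply: Rmult_le_pos; lra].
  rewrite (sqrt_mult_alt (A * h ^ 2)); last by apply: Rmult_le_pos.
  rewrite (sqrt_mult_alt A) // (sqrt_mult_alt (L ^ 2)); last by apply: pow2_ge_0.
  by rewrite !sqrt_pow2 //; lra.
apply: (Rmult_le_reg_l L); first lra.
apply: (Rle_trans _ _ _ hS).
have -> : L * ((1 + sqrt A) * h / sqrt L + sqrt (2 * h * La) + 2 * La + sqrt (h * B)) =
  (1 + sqrt A) * h * sqrt L + L * sqrt (2 * h * La) + 2 * L * La + L * sqrt (h * B).
  have e3 : L * ((1 + sqrt A) * h / sqrt L) = (1 + sqrt A) * h * sqrt L.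
    by rewrite -{1}sLL; field; lra.
  by rewrite !Rmult_plus_distr_l e3; ring.
lra.
Qed.

Definition twisted_logsum (f : nat -> C) (a : R) (M N : nat) : C :=
  (\Csum_(M.+1 <= n < N.+1) (f n * expi (INR n * a) * RtoC (/ INR n)))%C.

Definition katai_error (H N : nat) (A B : R) : R :=
  (1 + sqrt A) * hsum N / sqrt (psum H) + sqrt (2 * hsum N * (1 + ln (INR H))) +
  2 * (1 + ln (INR H)) + sqrt (hsum N * B).

(** If no multiple k a with 0 < k < K is near an integer, then for fixed p the l for which (p - l) a
    is near an integer are K-spaced. Their reciprocals sum to at most 1 + hsum H / K <= 3, which is
    the 3 in [katai_error]; for the other l the kernel is at most 2 + ln (1/e). *)
Lemma katai_minor (H N K : nat) (f : nat -> C) (a e : R) :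
  (0 < K)%N -> hsum H <= 2 * INR K -> unimodular_mult f -> 0 < e <= 1 -> 1 <= psum H ->
  (forall k, (0 < k)%N -> (k < K)%N -> 2 * e <= Rabs (sin (PI * (INR k * a)))) ->
  Cmod (twisted_logsum f a 0 N) <= katai_error H N 3 (2 + ln (/ e)).
Proof.
move=> K0 HK fP he L1 hk; have Kp := INR_pos K K0.
have lH := ln_INR_ge0 H; have hN := hsum_ge0 N.
have ie : 1 <= / e by rewrite -Rinv_1; apply: Rinv_le_contravar; lra.
have le0 : 0 <= ln (/ e) by rewrite -ln_1; apply: ln_mono; lra.
apply: (katai_divide (psum H) (hsum N) (1 + ln (INR H)) (katai_kernel_sum H 0 N a)) => //; try lra; last first.
  exact: katai_bound.
rewrite /katai_kernel_sum.
have -> : 3 * hsum N * psum H + psum H ^ 2 * (2 + ln (/ e)) =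
  psum H * (3 * hsum N + psum H * (2 + ln (/ e))) by ring.
rewrite {1}/psum big_distrl /=; apply: Rsum_le => p pp.
under eq_bigr do rewrite Rmult_assoc.
rewrite -big_distrr /=; apply: Rmult_le_compat_l; first exact: inv_INR_ge0.
pose b l := if Rlt_dec (Rabs (sin (PI * ((INR p - INR l) * a)))) e then true else false.
have bP l : b l -> Rabs (sin (PI * ((INR p - INR l) * a))) < e by rewrite /b; case: Rlt_dec.
apply: (Rle_trans _ (\Rsum_(1 <= l < H.+1 | prime l) ((if b l then / INR l else 0) * hsum N + / INR l * (2 + ln (/ e))))).
  apply: Rsum_le => l pl; have il := inv_INR_ge0 l.
  have t0 : 0 <= / INR l * (2 + ln (/ e)) by apply: Rmult_le_pos; lra.
  rewrite /b; case: Rlt_dec => hl /=.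
    have := kern_le_hsum 0 N ((INR p - INR l) * a) isT; rewrite hsum0 Rminus_0_r => h.
    by have := Rmult_le_compat_l _ _ _ il h; lra.
  rewrite Rmult_0_l Rplus_0_l; apply: Rmult_le_compat_l => //.
  have s0 : sin (PI * ((INR p - INR l) * a)) <> 0.
    by move=> h; apply: hl; rewrite h Rabs_R0; lra.
  have := kern0_le N _ s0; have := Rabs_pos_lt _ s0 => h0.
  have : ln (/ Rabs (sin (PI * ((INR p - INR l) * a)))) <= ln (/ e).
    by apply: ln_mono; [apply: Rinv_0_lt_compat | apply: Rinv_le_contravar; lra].
  lra.
rewrite big_split /= -!big_distrl /= -/(psum H); apply: Rplus_le_compat_r.
apply: Rmult_le_compat_r => //.
apply: (Rle_trans _ (\Rsum_(1 <= l < H.+1 | b l) / INR l)).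
  rewrite -big_mkcondr; apply: Rsum_le_sub => [l /andP[] //|l _]; exact: inv_INR_ge0.
apply: (Rle_trans _ _ _ (spaced_sum b K H K0 _)).
  move=> m n hm hn mn; rewrite leqNgt; apply/negP => nm.
  have := hk (n - m)%N ltac:(lia) ltac:(lia).
  have -> : INR (n - m) * a = (INR p - INR m) * a + - ((INR p - INR n) * a).
    by rewrite minus_INR; [ring | lia].
  have := abs_sin_add ((INR p - INR m) * a) (- ((INR p - INR n) * a)).
  by rewrite abs_sin_opp; have := bP m hm; have := bP n hn; lra.
have : hsum H / INR K <= 2; last lra.
by apply: (Rmult_le_reg_r (INR K)) => //; rewrite /Rdiv Rmult_assoc Rinv_l; lra.
Qed.

(** On the tail of a major arc only p = l resonates, whence the 1. If r divides (p - l) b, then (p -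
    l) a differs from an integer by at least |be|, and summation starts so late that the kernel is
    at most 1. Otherwise |sin (PI (p - l) b / r)| >= 2/r, of which the perturbation by [be] takes at
    most half. *)
Lemma katai_major_tail (H M N r : nat) (b : Z) (f : nat -> C) (be : R) :
  (M <= N)%N -> unimodular_mult f -> 1 <= psum H -> (0 < r)%N ->
  Z.gcd b (Z.of_nat r) = 1%Z -> 1 <= (INR M + 1) * Rabs be ->
  PI * INR H * Rabs be <= / INR r ->
  Cmod (twisted_logsum f (IZR b / INR r + be) M N) <= katai_error H N 1 (2 * (2 + ln (INR r))).
Proof.
move=> MN fP L1 r0 gb hM hH; have rp := INR_pos r r0; have lr := ln_INR_ge0 r.
have lH := ln_INR_ge0 H; have hN := hsum_ge0 N; have pi3 := PI2_3_2.
have r1 : / INR r <= 1 by rewrite -Rinv_1; apply: Rinv_le_contravar; [lra | apply: INR_ge1].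
have be0 : 0 < Rabs be by have := Rabs_pos be; have := pos_INR M; nra.
set a := IZR b / INR r + be.
apply: (katai_divide (psum H) (hsum N) (1 + ln (INR H)) (katai_kernel_sum H M N a)) => //; try lra; last first.
  exact: katai_bound.
have off p l : (1 <= p < H.+1)%N -> (1 <= l < H.+1)%N -> p <> l ->
    Cmod (kern M N ((INR p - INR l) * a)) <= 2 * (2 + ln (INR r)).
  move=> hp hl pl; set m := (Z.of_nat p - Z.of_nat l)%Z.
  have em : INR p - INR l = IZR m by rewrite /m minus_IZR -!INR_IZR_INZ.
  have m1 : 1 <= Rabs (IZR m) by rewrite -abs_IZR; apply: (IZR_le 1); rewrite /m; lia.
  have mH : Rabs (IZR m) <= INR H.
    by rewrite -abs_IZR INR_IZR_INZ; apply: IZR_le; rewrite /m; lia.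
  have mb : PI * (Rabs (IZR m) * Rabs be) <= / INR r.
    by apply: Rle_trans hH; rewrite Rmult_assoc; apply: Rmult_le_compat_l; nra.
  rewrite em; case: (classic (exists k : Z, (m * b = k * Z.of_nat r)%Z)) => [[k ek]|nk].
    have ea : IZR m * a = IZR m * be + IZR k.
      have := f_equal IZR ek; rewrite !mult_IZR -INR_IZR_INZ => e.
      rewrite /a; have -> : IZR m * (IZR b / INR r + be) = IZR m * IZR b / INR r + IZR m * be by field; lra.
      by rewrite e; field; lra.
    have le : Rabs (IZR m * be) <= / 2 by rewrite Rabs_mult; nra.
    have := abs_sin_ge _ le; rewrite -(abs_sin_period _ k) -ea Rabs_mult => hs.
    have s0 : sin (PI * (IZR m * a)) <> 0 by move=> h; move: hs; rewrite h Rabs_R0; nra.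
    apply: (Rle_trans _ _ _ (kern_abel M N _ MN s0)); apply: (Rle_trans _ 1); last lra.
    rewrite -Rinv_mult -Rinv_1; apply: Rinv_le_contravar; first lra.
    rewrite S_INR; have := pos_INR M; nra.
  have hs : 2 / INR r <= Rabs (sin (PI * (IZR (m * b) / INR r))).
    by apply: abs_sin_frac => // k hk; apply: nk; exists k.
  have hs2 : / INR r <= Rabs (sin (PI * (IZR m * a))).
    have := abs_sin_add (IZR m * a) (- (IZR m * be)); rewrite abs_sin_opp.
    have -> : IZR m * a + - (IZR m * be) = IZR (m * b) / INR r.
      by rewrite mult_IZR /a; field; lra.
    have := abs_sin_le (IZR m * be); rewrite Rabs_mult; rewrite /Rdiv in hs; lra.
  have ir := Rinv_0_lt_compat _ rp.
  have s0 : sin (PI * (IZR m * a)) <> 0 by move=> h; move: hs2; rewrite h Rabs_R0; lra.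
  have := kern_le M N _ MN s0; have := ln_mono _ _ (Rinv_0_lt_compat _ (Rabs_pos_lt _ s0)) (Rinv_le_contravar _ _ ir hs2).
  by rewrite Rinv_inv; lra.
rewrite /katai_kernel_sum.
apply: (Rle_trans _ (\Rsum_(1 <= p < H.+1 | prime p) \Rsum_(1 <= l < H.+1 | prime l)
   ((if l == p then / INR p * hsum N else 0) + / INR p * / INR l * (2 * (2 + ln (INR r)))))).
  apply: Rsum_le_nat => p hp pp; apply: Rsum_le_nat => l hl pl.
  have ip := inv_INR_ge0 p; have il := inv_INR_ge0 l.
  have ipl := Rmult_le_pos _ _ ip il.
  case: eqP => [->|lp]; last first.
    rewrite Rplus_0_l; apply: Rmult_le_compat_l => //; apply: off => //; exact: nesym.
  have i1 : / INR p <= 1.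
    rewrite -Rinv_1; apply: Rinv_le_contravar; [lra | apply: INR_ge1]; exact: prime_gt0.
  have : / INR p * / INR p * Cmod (kern M N ((INR p - INR p) * a)) <= / INR p * hsum N.
    have h1 := kern_le_hsum M N ((INR p - INR p) * a) MN; have h2 := hsum_ge0 M.
    rewrite Rmult_assoc; apply: Rmult_le_compat_l => //.
    by have := Cmod_ge_0 (kern M N ((INR p - INR p) * a)); nra.
  have : 0 <= / INR p * / INR p * (2 * (2 + ln (INR r))) by apply: Rmult_le_pos; [exact: Rmult_le_pos | lra].
  lra.
right; transitivity (\Rsum_(1 <= p < H.+1 | prime p) (/ INR p * hsum N + / INR p * (psum H * (2 * (2 + ln (INR r)))))).
  rewrite big_seq_cond [RHS]big_seq_cond; apply: eq_bigr => p /andP[hp pp].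
  rewrite big_split /=.
  have -> : \Rsum_(1 <= l < H.+1 | prime l) (if l == p then / INR p * hsum N else 0) = / INR p * hsum N.
    rewrite big_mkcond (bigD1_seq p) ?iota_uniq //= pp eqxx.
    by rewrite big1 ?Rplus_0_r // => l /negbTE ->; case: ifP.
  by rewrite -big_distrl /= -big_distrr /= -/(psum H); ring.
by rewrite big_split /= -!big_distrl /= -/(psum H); ring.
Qed.

(** * Major arcs *)

Definition mean_bound (T D : R) : R := 8 * exp 8 * (T * exp (- D / 8) + sqrt T).

Lemma mean_bound_anti T D D' : 0 <= T -> D <= D' -> mean_bound T D' <= mean_bound T D.
Proof.
move=> T0 h; apply: Rmult_le_compat_l; first by have := exp_pos 8; lra.
apply: Rplus_le_compat_r; apply: Rmult_le_compat_l => //; apply: exp_mono; lra.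
Qed.

Lemma mean_bound_ge0 T D : 0 <= T -> 0 <= mean_bound T D.
Proof.
move=> T0; apply: Rmult_le_pos; first by have := exp_pos 8; lra.
by have := sqrt_pos T; have := Rmult_le_pos _ _ T0 (Rlt_le _ _ (exp_pos (- D / 8))); lra.
Qed.

Section MajorArcs.
Variables (T : R) (y : nat) (f : nat -> C).
Hypotheses (T1 : 1 <= T) (y0 : (0 < y)%N) (hy : T * pw T y <= / 2) (Ty : T <= ln (INR y)).
Hypothesis fP : unimodular_mult f.

(* Two different odd characters cannot both be close to [f], so all but one of the terms of the
   character expansion of [phi] are very small. *)
Lemma odd_twist_bound (r K : nat) (D0 D1 : R) (phi : nat -> C) : (0 < r)%N ->
  2 * D1 <= ln T - ln (2 + ln (INR r)) - 7 ->
  (forall xi, is_dirichlet_char r xi -> odd_char r xi -> D0 <= dist2 T y (fun n => f n * xi n)%C) ->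
  periodic_on_units r phi -> odd_char r phi -> (forall b, Cmod (phi b) <= 1) ->
  ln (INR K) <= T ->
  Cmod (\Csum_(1 <= m < K.+1) (f m * phi m * RtoC (/ INR m)))%C <=
  mean_bound T D0 + INR r * mean_bound T D1.
Proof.
move=> r0 hD1 hD0 phiP odd phi1 KT; have T0 : 0 < T by lra.
have [I [X [xi [cX [chX [sepX exX]]]]]] := odd_function_expansion r r0.
have [c [c1 hc]] := exX phi phiP odd phi1.
pose Q w := (w \in X) && (if excluded_middle_informative (odd_char r (xi w)) then true else false).
have QP w : Q w -> w \in X /\ odd_char r (xi w).
  by rewrite /Q => /andP[? ]; case: excluded_middle_informative.
have um w : w \in X -> unimodular_mult (xi w).
  by move=> hw; apply: (char_unimodular r) => //; apply: chX.
have umf w : w \in X -> unimodular_mult (fun n => f n * xi w n)%C.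
  by move=> hw; apply: unimodular_multM => //; apply: um.
have lb w D : Q w -> D <= dist2 T y (fun n => f n * xi w n)%C ->
    Cmod (logsum (fun n => f n * xi w n)%C K) <= mean_bound T D.
  move=> /QP[hw ow] hd.
  apply: Rle_trans (logsum_dist2_bound T y K _ T1 y0 hy Ty (umf w hw) KT) _.
  by apply: mean_bound_anti => //; lra.
have e : (\Csum_(1 <= m < K.+1) (f m * phi m * RtoC (/ INR m)) =
   \Csum_(w | Q w) (c w * logsum (fun n => f n * xi w n) K))%C.
  transitivity (\Csum_(1 <= m < K.+1) \Csum_(w | Q w) (c w * (f m * xi w m * RtoC (/ INR m))))%C.
    apply: eq_bigr => m _; rewrite hc big_distrr big_distrl /=; apply: eq_bigr => w _; ring.
  by rewrite exchange_big /=; apply: eq_bigr => w _; rewrite /logsum big_distrr.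
rewrite e; apply: Cmod_sum_le.
apply: (Rle_trans _ (\Rsum_(w | Q w) Cmod (logsum (fun n => f n * xi w n)%C K))).
  apply: Rsum_le => w _; rewrite Cmod_mult; have := c1 w; have := Cmod_ge_0 (c w).
  by have := Cmod_ge_0 (logsum (fun n => f n * xi w n)%C K); nra.
have E0 := mean_bound_ge0 T D0 ltac:(lra); have E1 := mean_bound_ge0 T D1 ltac:(lra).
have cnt (P : pred I) : (forall w, P w -> Q w /\ D1 <= dist2 T y (fun n => f n * xi w n)%C) ->
    \Rsum_(w | P w) Cmod (logsum (fun n => f n * xi w n)%C K) <= INR r * mean_bound T D1.
  move=> hP; apply: (Rle_trans _ (\Rsum_(w | w \in X) mean_bound T D1)).
    apply: (Rle_trans _ (\Rsum_(w | P w) mean_bound T D1)).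
      by apply: Rsum_le => w /hP[qw dw]; apply: lb.
    by apply: Rsum_le_sub => // w /hP[/QP[]].
  rewrite Rsum_const.
  apply: Rmult_le_compat_r => //; apply: INR_leq; apply: leq_trans cX.
  by rewrite cardE size_filter.
case: (classic (exists w, Q w /\ dist2 T y (fun n => f n * xi w n)%C < D1)) => [[w0 [q0 d0]]|H]; last first.
  have := cnt Q; move/(_ _) => h; apply: (Rle_trans _ (INR r * mean_bound T D1)); last lra.
  by apply: h => w qw; split=> //; apply: Rnot_lt_le => h2; apply: H; exists w.
rewrite (bigD1 w0) //=; apply: Rplus_le_compat.
  by apply: lb => //; case/QP: q0 => hw ow; apply: hD0 => //; apply: chX.
apply: cnt => w /andP[qw ww0]; split=> //; apply: Rnot_lt_le => dw.
have [hw ow] := QP w qw; have [hw0 ow0] := QP w0 q0.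
have [a [ca na]] := sepX w w0 hw hw0 ltac:(by move=> h; rewrite h eqxx in ww0).
have := dist2_repulsion T y r f (xi w) (xi w0) T0 y0 hy fP (um w hw) (um w0 hw0) r0.
move/(_ _ _) => h; have : ln T - ln (2 + ln (INR r)) - 7 <= dist2 T y (fun n => f n * xi w n)%C +
   dist2 T y (fun n => f n * xi w0 n)%C; last lra.
apply: h; first by apply: is_char_mul_same => //; [apply: chX | apply: is_char_conj; apply: chX].
exists a; split=> // h; case: na.
have n0 : (xi w0 a * Cconj (xi w0 a) = 1)%C.
  by rewrite -Cmod2_conj (char_nz r) //=; [rewrite !Rmult_1_r | apply: chX].
rewrite -(Cmult_1_l (xi w0 a)) -h -Cmult_assoc [(Cconj _ * _)%C]Cmult_comm n0; ring.
Qed.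

(** Sorted by g = gcd(n, r), n is g m with m prime to r / g. A function of n modulo r becomes one
    supported on the units modulo r / g, where characters can be used. *)
Lemma big_gcd_split (r M : nat) (F : nat -> C) : (0 < r)%N ->
  (\Csum_(1 <= n < M.+1) F n =
   \Csum_(1 <= g < r.+1 | (g %| r)%N)
     \Csum_(1 <= m < (M %/ g).+1) (if coprime m (r %/ g) then F (g * m)%N else 0))%C.
Proof.
move=> r0.
transitivity (\Csum_(1 <= n < M.+1) \Csum_(1 <= g < r.+1 | (g %| r)%N) (if gcdn n r == g then F n else 0))%C.
  apply: eq_big_nat => n /andP[n0 _]; symmetry.
  have g0 : (0 < gcdn n r)%N by rewrite gcdn_gt0 r0 orbT.
  have gr : (gcdn n r < r.+1)%N by rewrite ltnS dvdn_leq // dvdn_gcdr.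
  rewrite big_mkcond (bigD1_seq (gcdn n r)) ?iota_uniq ?mem_index_iota ?g0 //= dvdn_gcdr eqxx.
  rewrite big1 ?Cplus_0_r // => g /negbTE; rewrite eq_sym => ->; by case: ifP.
rewrite exchange_big /=; apply: eq_bigr => g gr.
have [r' er] := dvdnP gr; have g0 : (0 < g)%N by case: g er {gr} => // ; rewrite muln0; lia.
transitivity (\Csum_(1 <= n < M.+1 | (g %| n)%N) (if gcdn n r == g then F n else 0))%C.
  rewrite [RHS]big_mkcond; apply: eq_bigr => n _; case: eqP => [e|_]; last by case: ifP.
  by rewrite -{1}e dvdn_gcdl.
rewrite big_multiples //; apply: eq_bigr => m _.
rewrite er mulnK // [(r' * g)%N]mulnC -muln_gcdr -{2}(muln1 g) eqn_pmul2l // /coprime.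
Qed.

Definition sinsum (a : R) (M N : nat) : C :=
  (\Csum_(M.+1 <= n < N.+1) (f n * RtoC (sin (2 * PI * (INR n * a))) * RtoC (/ INR n)))%C.

Lemma sin_int_period (x : R) (k : Z) : sin (2 * PI * (x + IZR k)) = sin (2 * PI * x).
Proof. by have := f_equal snd (expi_period x k). Qed.

(** For each g the sine restricted to the units modulo s = r / g is periodic and odd, hence a
    combination of odd characters, to which [odd_twist_bound] applies. The factor 1/g coming from
    1/n makes the sum over g at most [hsum R0]. *)
Lemma sinsum_rational (r R0 M : nat) (b : Z) (D0 D1 : R) : (0 < r)%N -> (r <= R0)%N ->
  2 * D1 <= ln T - ln (2 + ln (INR R0)) - 7 ->
  (forall s xi, (0 < s)%N -> (s <= R0)%N -> is_dirichlet_char s xi -> odd_char s xi ->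
     D0 <= dist2 T y (fun n => f n * xi n)%C) ->
  ln (INR M) <= T ->
  Cmod (sinsum (IZR b / INR r) 0 M) <=
  hsum R0 * (mean_bound T D0 + INR R0 * mean_bound T D1).
Proof.
move=> r0 rR hD1 hD0 MT; have rp := INR_pos r r0.
have E0 := mean_bound_ge0 T D0 ltac:(lra); have E1 := mean_bound_ge0 T D1 ltac:(lra).
have [_ [fM _]] := fP.
set Bd := mean_bound T D0 + INR R0 * mean_bound T D1.
have Bd0 : 0 <= Bd by have := Rmult_le_pos _ _ (pos_INR R0) E1; rewrite /Bd; lra.
rewrite /sinsum (big_gcd_split r) //.
apply: Cmod_sum_le.
apply: (Rle_trans _ (\Rsum_(1 <= g < r.+1 | (g %| r)%N) (/ INR g * Bd))); last first.
  apply: (Rle_trans _ (\Rsum_(1 <= g < r.+1) (/ INR g * Bd))).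
    by apply: Rsum_le_sub => // g _; apply: Rmult_le_pos => //; apply: inv_INR_ge0.
  rewrite -big_distrl /= -/(hsum r); apply: Rmult_le_compat_r => //; exact: hsum_mono.
apply: Rsum_le_nat => g /andP[g0 gr] gdr.
set s := (r %/ g)%N; have er : r = (s * g)%N by rewrite /s divnK.
have s0 : (0 < s)%N by rewrite /s divn_gt0.
have sp := INR_pos s s0; have gp := INR_pos g g0.
pose phi m := if coprime m s then RtoC (sin (2 * PI * (INR m * (IZR b / INR s)))) else RtoC 0.
have -> : (\Csum_(1 <= m < (M %/ g).+1) (if coprime m s then f (g * m)%N *
      RtoC (sin (2 * PI * (INR (g * m) * (IZR b / INR r)))) * RtoC (/ INR (g * m)) else 0) =
   f g * RtoC (/ INR g) * \Csum_(1 <= m < (M %/ g).+1) (f m * phi m * RtoC (/ INR m)))%C.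
  rewrite big_distrr /=; apply: eq_bigr => m _; rewrite /phi; case: ifP => _; last ring.
  rewrite fM INRM Rinv_mult RtoC_mult.
  have -> : INR g * INR m * (IZR b / INR r) = INR m * (IZR b / INR s).
    by rewrite {1}er INRM; field; lra.
  ring.
rewrite Cmod_mult; apply: Rmult_le_compat; try exact: Cmod_ge_0.
  rewrite Cmod_mult Cmod_R Rabs_pos_eq; last exact: inv_INR_ge0.
  have := unimodular_mult_le1 f g fP; have := Cmod_ge_0 (f g); have := inv_INR_ge0 g; nra.
have sR : (s <= R0)%N by apply: leq_trans rR; apply: leq_div.
have per m m' : m = m' %[mod s] -> sin (2 * PI * (INR m * (IZR b / INR s))) = sin (2 * PI * (INR m' * (IZR b / INR s))).
  suff H k : sin (2 * PI * (INR k * (IZR b / INR s))) = sin (2 * PI * (INR (k %% s) * (IZR b / INR s))).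
    by move=> e; rewrite H e -H.
  rewrite {1}(divn_eq k s) INRD INRM.
  have -> : (INR (k %/ s) * INR s + INR (k %% s)) * (IZR b / INR s) =
    INR (k %% s) * (IZR b / INR s) + IZR (Z.of_nat (k %/ s) * b).
    by rewrite mult_IZR -INR_IZR_INZ; field; lra.
  exact: sin_int_period.
apply: Rle_trans (odd_twist_bound s (M %/ g) D0 D1 phi s0 _ _ _ _ _ _) _.
- have := ln_mono _ _ sp (INR_leq _ _ sR) => h; have := ln_INR_ge0 s => h0.
  by have := ln_mono (2 + ln (INR s)) (2 + ln (INR R0)) ltac:(lra) ltac:(lra); lra.
- by move=> xi; apply: hD0.
- split=> [x|x /negbTE cx]; last by rewrite /phi cx.
  by rewrite /phi coprime_modl (per (x %% s)%N x) ?modn_mod.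
- move=> u v suv; rewrite /phi.
  have -> : coprime u s = coprime v s.
    have h x z : (s %| x + z)%N -> coprime x s -> coprime z s.
      move=> /dvdnP[j ej] cx; rewrite /coprime -dvdn1; move: cx => /eqP <-.
      rewrite dvdn_gcd dvdn_gcdr andbT -(dvdn_addl x (dvdn_gcdl z s)) ej.
      by rewrite dvdn_mull // dvdn_gcdr.
    by apply/idP/idP; apply: h => //; rewrite addnC.
  case: ifP => _; last by ring.
  rewrite -RtoC_opp -sin_neg; congr RtoC.
  have [k ek] := dvdnP suv.
  have -> : - (2 * PI * (INR v * (IZR b / INR s))) = 2 * PI * (INR u * (IZR b / INR s) + IZR (- (Z.of_nat k * b))).
    rewrite opp_IZR mult_IZR -INR_IZR_INZ.
    have := f_equal INR ek; rewrite INRD INRM => e.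
    have -> : INR u = INR k * INR s - INR v by lra.
    by field; lra.
  by rewrite sin_int_period.
- move=> m; rewrite /phi; case: ifP => _; last by rewrite Cmod_0; lra.
  by rewrite Cmod_R; apply: Rabs_le; have := SIN_bound (2 * PI * (INR m * (IZR b / INR s))); lra.
- case: (posnP (M %/ g)) => [->|q0].
    by have : ln (INR 0) <= ln (INR 1) by [have := ln_INR_ge0 1; rewrite /= ln_1 /ln; case: Rlt_dec => h; [exfalso; lra | lra]]; rewrite /= ln_1; lra.
  by have := ln_mono _ _ (INR_pos _ q0) (INR_leq _ _ (leq_div M g)); lra.
by rewrite /Bd; have := Rmult_le_compat_r _ _ _ E1 (INR_leq _ _ sR); lra.
Qed.

Lemma sinsum_twisted (a : R) (M N : nat) (B : R) :
  Cmod (twisted_logsum f a M N) <= B -> Cmod (twisted_logsum f (- a) M N) <= B ->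
  Cmod (sinsum a M N) <= B.
Proof.
move=> h1 h2.
have e : (RtoC 2 * Ci * sinsum a M N = twisted_logsum f a M N - twisted_logsum f (- a) M N)%C.
  rewrite /sinsum /twisted_logsum -Csum_sub big_distrr /=; apply: eq_bigr => n _.
  have -> : (f n * expi (INR n * a) * RtoC (/ INR n) - f n * expi (INR n * - a) * RtoC (/ INR n) =
    f n * RtoC (/ INR n) * (expi (INR n * a) - expi (INR n * - a)))%C by ring.
  have -> : (expi (INR n * a) - expi (INR n * - a) = RtoC 2 * Ci * RtoC (sin (2 * PI * (INR n * a))))%C.
    rewrite Ropp_mult_distr_r_reverse -expi_conj /expi /Cconj /Ci /RtoC /Cminus /Copp /Cplus /Cmult /=.
    by f_equal; ring.
  ring.
have := f_equal Cmod e; rewrite !Cmod_mult Cmod_R Cmod_Ci (Rabs_pos_eq 2); last lra.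
have := Cmod_triangle (twisted_logsum f a M N) (- twisted_logsum f (- a) M N)%C.
by rewrite Cmod_opp -/(Cminus _ _); lra.
Qed.

Lemma sinsum_perturb (a a' : R) (M : nat) : INR M * Rabs (a - a') <= 1 ->
  Cmod (sinsum a 0 M - sinsum a' 0 M)%C <= 7.
Proof.
move=> hM; rewrite /sinsum -Csum_sub; apply: Cmod_sum_le.
have pi4 := PI_4; have pi0 := PI_RGT_0.
suff : \Rsum_(1 <= n < M.+1) Cmod (f n * RtoC (sin (2 * PI * (INR n * a))) * RtoC (/ INR n) -
   f n * RtoC (sin (2 * PI * (INR n * a'))) * RtoC (/ INR n))%C <= \Rsum_(1 <= n < M.+1) (2 * PI * Rabs (a - a')).
  (* [PI_ineq 1] gives PI / 4 <= 1 - 1/3 + 1/5; the bound PI <= 4 is too weak for 2 PI <= 7. *)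
  rewrite Rsum_const count_predT size_iota subn1 /=; have := PI_ineq 1; rewrite /tg_alt /PI_tg /= => h.
  have : 2 * PI <= 7 by lra.
  nra.
apply: Rsum_le_nat => n /andP[n0 _] _; have np := INR_pos n n0.
have -> : (f n * RtoC (sin (2 * PI * (INR n * a))) * RtoC (/ INR n) -
   f n * RtoC (sin (2 * PI * (INR n * a'))) * RtoC (/ INR n) =
   f n * RtoC ((sin (2 * PI * (INR n * a)) - sin (2 * PI * (INR n * a'))) * / INR n))%C.
  by rewrite RtoC_mult RtoC_minus; ring.
rewrite Cmod_mult Cmod_R Rabs_mult (Rabs_pos_eq (/ INR n)); last exact: inv_INR_ge0.
have lip : Rabs (sin (2 * PI * (INR n * a)) - sin (2 * PI * (INR n * a'))) <= 2 * PI * INR n * Rabs (a - a').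
  have h : Rabs (sin (2 * PI * (INR n * a)) - sin (2 * PI * (INR n * a'))) <= Cmod (expi (INR n * a) - expi (INR n * a'))%C.
    have := Rmax_Cmod (expi (INR n * a) - expi (INR n * a'))%C; have := Rmax_r (Rabs (fst (expi (INR n * a) - expi (INR n * a'))%C)) (Rabs (snd (expi (INR n * a) - expi (INR n * a'))%C)).
    by rewrite /=; rewrite /Rminus; lra.
  apply: (Rle_trans _ _ _ h).
  have -> : (expi (INR n * a) - expi (INR n * a') = - (expi (INR n * a') * (1 - expi (INR n * (a - a')))))%C.
    have -> : INR n * a = INR n * a' + INR n * (a - a') by ring.
    by rewrite expi_add; ring.
  rewrite Cmod_opp Cmod_mult Cmod_expi Cmod_1sub_expi.
  by have := abs_sin_le (INR n * (a - a')); rewrite Rabs_mult (Rabs_pos_eq (INR n)); lra.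
have f1 := unimodular_mult_le1 f n fP; have f0 := Cmod_ge_0 (f n).
have ab := Rabs_pos (sin (2 * PI * (INR n * a)) - sin (2 * PI * (INR n * a'))).
have ip := Rinv_0_lt_compat _ np.
apply: (Rle_trans _ (1 * (2 * PI * INR n * Rabs (a - a') * / INR n))).
  apply: Rmult_le_compat => //; first by apply: Rmult_le_pos; lra.
  by apply: Rmult_le_compat_r; lra.
by right; field; lra.
Qed.

Lemma katai_error_mono H N A B B' : 0 <= B -> B <= B' -> katai_error H N A B <= katai_error H N A B'.
Proof.
move=> B0 h; apply: Rplus_le_compat_l; apply: sqrt_le_1_alt.
by apply: Rmult_le_compat_l => //; apply: hsum_ge0.
Qed.

Lemma katai_error_ge0 H N A B : 0 <= katai_error H N A B.
Proof.
have h0 := hsum_ge0 N; have lH := ln_INR_ge0 H; have s := sqrt_pos.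
have h1 : 0 <= (1 + sqrt A) * hsum N / sqrt (psum H).
  apply: Rmult_le_pos; first by apply: Rmult_le_pos => //; have := s A; lra.
  case: (Req_dec (sqrt (psum H)) 0) => [->|h]; first by rewrite Rinv_0; lra.
  by left; apply: Rinv_0_lt_compat; have := s (psum H); lra.
rewrite /katai_error; have := s (2 * hsum N * (1 + ln (INR H))); have := s (hsum N * B); lra.
Qed.

Lemma sinsum_cat a M N : (M <= N)%N -> sinsum a 0 N = (sinsum a 0 M + sinsum a M N)%C.
Proof. by move=> MN; rewrite /sinsum (big_cat_nat (n := M.+1)). Qed.

(** Either no small multiple of [a] is near an integer, and [katai_minor] applies, or a = c/s + be
    with s <= K and |be| <= e. Then the sum is cut at J, the integer part of 1 / |be|: up to J the
    sine hardly changes when [a] is replaced by c/s, which costs 7, and beyond J the phase n be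
    oscillates and [katai_major_tail] applies. *)
Lemma sinsum_bound (H N K : nat) (a e D0 D1 : R) :
  (0 < K)%N -> hsum H <= 2 * INR K -> 0 < e <= 1 -> 1 <= psum H ->
  PI * INR H * e * INR K <= 1 ->
  2 * D1 <= ln T - ln (2 + ln (INR K)) - 7 ->
  (forall s xi, (0 < s)%N -> (s <= K)%N -> is_dirichlet_char s xi -> odd_char s xi ->
     D0 <= dist2 T y (fun n => f n * xi n)%C) ->
  ln (INR N) <= T ->
  Cmod (sinsum a 0 N) <=
  katai_error H N 3 (2 + ln (/ e)) + katai_error H N 1 (2 * (2 + ln (INR K))) +
  hsum K * (mean_bound T D0 + INR K * mean_bound T D1) + 7.
Proof.
move=> K0 HK he L1 hH hD1 hD0 NT.
set E1 := katai_error H N 3 _; set E2 := katai_error H N 1 _.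
set Hd := hsum K * _.
have E10 : 0 <= E1 by apply: katai_error_ge0.
have E20 : 0 <= E2 by apply: katai_error_ge0.
have Hd0 : 0 <= Hd.
  apply: Rmult_le_pos; first exact: hsum_ge0.
  have := mean_bound_ge0 T D0 ltac:(lra); have := mean_bound_ge0 T D1 ltac:(lra) => h1 h2.
  by have := Rmult_le_pos _ _ (pos_INR K) h1; lra.
case: (classic (forall k, (0 < k)%N -> (k < K)%N -> 2 * e <= Rabs (sin (PI * (INR k * a))))) => [hk|nk].
  have h1 := katai_minor H N K f a e K0 HK fP he L1 hk.
  have h2 : Cmod (twisted_logsum f (- a) 0 N) <= E1.
    apply: (katai_minor H N K f (- a) e) => // k k0 kK.
    by rewrite Ropp_mult_distr_r_reverse abs_sin_opp; apply: hk.
  by have := sinsum_twisted a 0 N E1 h1 h2; lra.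
have [r [r0 [rK hr]]] : exists r, (0 < r)%N /\ (r < K)%N /\ Rabs (sin (PI * (INR r * a))) < 2 * e.
  apply: NNPP => h; apply: nk => k k0 kK; apply: Rnot_lt_le => h2; apply: h; by exists k.
have [b [_ hb]] := near_integer (INR r * a).
have {hr}hb : Rabs (INR r * a - IZR b) <= e by lra.
(* Division by gcd(b, r) also divides the approximation error, so the reduced fraction inherits the
   bound [e]. *)
have [s [c [s0 [sK [gc hc]]]]] : exists (s : nat) (c : Z), (0 < s)%N /\ (s <= K)%N /\
    Z.gcd c (Z.of_nat s) = 1%Z /\ Rabs (INR s * a - IZR c) <= e.
  set g := Z.gcd b (Z.of_nat r).
  have g0 : (0 < g)%Z by have := Z.gcd_nonneg b (Z.of_nat r); have := Z.gcd_eq_0_r b (Z.of_nat r); rewrite -/g; lia.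
  have [c ec] := Z.gcd_divide_l b (Z.of_nat r); have [s es] := Z.gcd_divide_r b (Z.of_nat r).
  rewrite -/g in ec es.
  have s0 : (0 < s)%Z by nia.
  exists (Z.to_nat s), c.
  have eZ : Z.of_nat (Z.to_nat s) = s by lia.
  split; first by lia.
  split; first by nia.
  split.
    rewrite eZ; have := Z.gcd_div_gcd b (Z.of_nat r) g ltac:(lia) erefl.
    by rewrite {1}ec es !Z.div_mul //; lia.
  have gR : 1 <= IZR g by apply: (IZR_le 1); lia.
  have e1 : INR r * a - IZR b = IZR g * (INR (Z.to_nat s) * a - IZR c).
    by rewrite {1}ec (INR_IZR_INZ r) es !mult_IZR INR_IZR_INZ eZ; ring.
  rewrite e1 Rabs_mult (Rabs_pos_eq (IZR g)) in hb; last lra.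
  by have := Rabs_pos (INR (Z.to_nat s) * a - IZR c); nra.
have sp := INR_pos s s0; have s1 := INR_ge1 s s0.
set be := a - IZR c / INR s.
have ebe : Rabs be <= e.
  have : INR s * be = INR s * a - IZR c by rewrite /be; field; lra.
  move=> h; rewrite -h Rabs_mult (Rabs_pos_eq (INR s)) in hc; last lra.
  by have := Rabs_pos be; nra.
have ea : a = IZR c / INR s + be by rewrite /be; ring.
have head M : (M <= N)%N -> INR M * Rabs be <= 1 -> Cmod (sinsum a 0 M) <= Hd + 7.
  move=> MN hM; have h1 := sinsum_perturb a (IZR c / INR s) M hM.
  have MT : ln (INR M) <= T.
    case: (posnP M) => [->|M0]; last by have := ln_mono _ _ (INR_pos _ M0) (INR_leq _ _ MN); lra.
    by rewrite /= /ln; case: (Rlt_dec 0 0) => h; [exfalso; lra | lra].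
  have h2 := sinsum_rational s K M c D0 D1 s0 sK hD1 hD0 MT.
  have -> : sinsum a 0 M = ((sinsum a 0 M - sinsum (IZR c / INR s) 0 M) + sinsum (IZR c / INR s) 0 M)%C by ring.
  by apply: Cmod_add_le; rewrite -/Hd in h2; lra.
case: (Rle_lt_dec (INR N * Rabs be) 1) => hN.
  by have := head N (leqnn N) hN; lra.
have be0 : 0 < Rabs be.
  case: (Req_dec (Rabs be) 0) => h; last by have := Rabs_pos be; lra.
  by move: hN; rewrite h Rmult_0_r; lra.
have [J [J1 J2]] := nfloor_ex (/ Rabs be) (Rlt_le _ _ (Rinv_0_lt_compat _ be0)).
have hJ1 : INR J * Rabs be <= 1.
  by have := Rmult_le_compat_r _ _ _ (Rlt_le _ _ be0) J1; rewrite Rinv_l; lra.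
have hJ2 : 1 <= (INR J + 1) * Rabs be.
  by have := Rmult_le_compat_r _ _ _ (Rlt_le _ _ be0) (Rlt_le _ _ J2); rewrite Rinv_l; lra.
have JN : (J <= N)%N.
  by rewrite leqNgt; apply/negP => /ltnW /INR_leq h; nra.
have lss : ln (INR s) <= ln (INR K) by apply: ln_mono => //; apply: INR_leq.
have ls0 := ln_INR_ge0 s.
have hHs : PI * INR H * Rabs be <= / INR s.
  apply: (Rmult_le_reg_r (INR s)) => //; rewrite Rinv_l; last lra.
  apply: Rle_trans hH; have PI0 := PI_RGT_0; have H0 := pos_INR H.
  have PH : 0 <= PI * INR H by apply: Rmult_le_pos; lra.
  apply: Rmult_le_compat; [|lra| |exact: INR_leq]; first by apply: Rmult_le_pos; lra.
  exact: Rmult_le_compat_l.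
have tl : Cmod (sinsum a J N) <= E2.
  apply: Rle_trans (katai_error_mono H N 1 (2 * (2 + ln (INR s))) _ _ _); [|lra|lra].
  apply: sinsum_twisted.
    by rewrite ea; apply: katai_major_tail.
  have -> : - a = IZR (- c) / INR s + - be by rewrite opp_IZR ea; field; lra.
  apply: katai_major_tail => //; rewrite ?Rabs_Ropp //.
  by rewrite Z.gcd_opp_l.
rewrite (sinsum_cat a J N JN); apply: Cmod_add_le.
by have := head J JN hJ1; lra.
Qed.
End MajorArcs.

(** * Gauss sums and the Pólya-Vinogradov inequality *)

Lemma x_sub_sin_le x : 0 <= x -> x - sin x <= x ^ 3 / 2.
Proof.
case=> [x0|<-]; last by rewrite sin_0; lra.
have [c [e hc]] := MVT_cor2 sin cos 0 x x0 (fun c _ => derivable_pt_lim_sin c).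
rewrite sin_0 Rminus_0_r Rminus_0_r in e; rewrite e.
have -> : cos c = 1 - 2 * sin (c / 2) * sin (c / 2) by rewrite -cos_2a_sin; congr cos; field.
have h1 : Rabs (sin (c / 2)) <= c / 2.
  have := abs_sin_le (c / 2 / PI); have PI0 := PI_RGT_0.
  have -> : PI * (c / 2 / PI) = c / 2 by field; lra.
  rewrite (Rabs_pos_eq (c / 2 / PI)); last by apply: Rmult_le_pos; [lra | left; apply: Rinv_0_lt_compat].
  by have -> : PI * (c / 2 / PI) = c / 2 by field; lra.
have h2 : sin (c / 2) * sin (c / 2) <= (c / 2) * (c / 2).
  by apply: Rsqr_le_abs_1; rewrite (Rabs_pos_eq (c / 2)); lra.
have h3 : sin (c / 2) * sin (c / 2) <= x * x / 4 by nra.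
have := Rmult_le_compat_r x _ _ (Rlt_le _ _ x0) h3; rewrite /=; lra.
Qed.

Lemma inv_sin_sub_inv x : 0 < x <= PI / 2 -> Rabs (/ sin x - / x) <= 2.
Proof.
move=> hx; have pi4 := PI_4; have PI0 := PI_RGT_0.
have h1 := x_sub_sin_le x ltac:(lra); have h2 := sin_lt_x x ltac:(lra).
have h3 : x / 2 <= sin x.
  have := jordan (x / PI); have -> : PI * (x / PI) = x by field; lra.
  move=> h; have : 2 * (x / PI) <= sin x.
    apply: h; split; first by apply: Rmult_le_pos; [lra | left; apply: Rinv_0_lt_compat; lra].
    by apply: (Rmult_le_reg_r PI) => //; rewrite /Rdiv Rmult_assoc Rinv_l; lra.
  suff : x / 2 <= 2 * (x / PI) by lra.
  apply: (Rmult_le_reg_r PI) => //; have -> : 2 * (x / PI) * PI = 2 * x by field; lra.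
  nra.
have e : / sin x - / x = (x - sin x) / (x * sin x) by field; lra.
rewrite e Rabs_pos_eq; last by apply: Rmult_le_pos; [lra | left; apply: Rinv_0_lt_compat; nra].
apply: (Rmult_le_reg_r (x * sin x)); first nra.
rewrite /Rdiv Rmult_assoc Rinv_l; last nra.
rewrite /= in h1; nra.
Qed.

Lemma char_sumE psi t : char_sum psi t = (\Csum_(1 <= n < t.+1) psi n)%C.
Proof.
elim: t => [|t IH]; first by rewrite big_geq.
by rewrite big_nat_recr //= IH.
Qed.

Definition exp_sum_upto (t : nat) (x : R) : C := (\Csum_(1 <= n < t.+1) expi (INR n * x))%C.

Lemma exp_sum_upto_opp t x : exp_sum_upto t (- x) = Cconj (exp_sum_upto t x).
Proof.
rewrite /exp_sum_upto Cconj_sum; apply: eq_bigr => n _.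
by rewrite Ropp_mult_distr_r_reverse expi_conj.
Qed.

(** The Dirichlet kernel. Its shift by 1/2 is the reason why the sine sums are later taken at (t +
    1/2) / q. *)
Lemma exp_sum_upto_Re t x : sin (PI * x) <> 0 ->
  2 * Re (exp_sum_upto t x) = sin (2 * PI * (x * (INR t + / 2))) / sin (PI * x) - 1.
Proof.
move=> s0; apply: (Rmult_eq_reg_l (sin (PI * x))) => //.
have -> : sin (PI * x) * (sin (2 * PI * (x * (INR t + / 2))) / sin (PI * x) - 1) =
  sin (2 * PI * (x * (INR t + / 2))) - sin (PI * x) by field.
rewrite /exp_sum_upto Re_sum; elim: t {s0} => [|t IH].
  rewrite big_geq // /= Rplus_0_l; have -> : 2 * PI * (x * / 2) = PI * x by field.
  ring.
have -> : \Rsum_(1 <= i < t.+2) Re (expi (INR i * x)) =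
  \Rsum_(1 <= i < t.+1) Re (expi (INR i * x)) + cos (2 * PI * (INR t.+1 * x)) by rewrite big_nat_recr.
rewrite Rmult_plus_distr_l Rmult_plus_distr_l IH S_INR.
have -> : 2 * PI * (x * (INR t + 1 + / 2)) = 2 * PI * ((INR t + 1) * x) + PI * x by field.
have -> : 2 * PI * (x * (INR t + / 2)) = 2 * PI * ((INR t + 1) * x) - PI * x by field.
by rewrite sin_plus sin_minus; ring.
Qed.

Section GaussSum.
Variables (q : nat) (psi : nat -> C).
Hypotheses (pq : prime q) (psiP : is_dirichlet_char q psi) (nt : nontrivial_char q psi).

Let q0 : (0 < q)%N. Proof. exact: prime_gt0. Qed.
Let qp : 0 < INR q. Proof. exact: INR_pos. Qed.
Let cpsi (n : nat) : C := Cconj (psi n).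

Lemma cpsi_char : is_dirichlet_char q cpsi.
Proof. exact: is_char_conj. Qed.

Lemma cpsi_nontrivial : nontrivial_char q cpsi.
Proof.
have [a [ca na]] := nt; exists a; split=> // h; apply: na.
by rewrite -(Cconj_conj (psi a)) -/(cpsi a) h Cconj_R.
Qed.

Definition gauss_sum : C := (\Csum_(0 <= a < q) (cpsi a * expi (INR a / INR q)))%C.

Lemma gauss_sum_twist n :
  (\Csum_(0 <= a < q) (cpsi a * expi (INR n * (INR a / INR q))) = psi n * gauss_sum)%C.
Proof.
case cn: (coprime n q); last first.
  rewrite (char_zero q) ?cn // Cmult_0_l; transitivity (\Csum_(0 <= a < q) cpsi a)%C; last first.
    exact: (char_sum_period q cpsi q0 cpsi_char cpsi_nontrivial).
  apply: eq_bigr => a _; have [k ->] : exists k, n = (k * q)%N.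
    by apply/dvdnP; move: cn; rewrite coprime_sym prime_coprime // => /negbFE.
  rewrite INRM; have -> : INR k * INR q * (INR a / INR q) = INR (k * a) by rewrite INRM; field; lra.
  by rewrite expi_INR Cmult_1_r.
have u : (psi n * cpsi n = 1)%C by rewrite /cpsi -Cmod2_conj (char_nz q) //= !Rmult_1_r.
have e : gauss_sum = (cpsi n * \Csum_(0 <= a < q) (cpsi a * expi (INR n * (INR a / INR q))))%C.
  rewrite /gauss_sum -(big_mul_mod _ _ _ n q (fun a => cpsi a * expi (INR a / INR q))%C) // big_distrr /=.
  apply: eq_bigr => a _; rewrite -(char_mod q cpsi cpsi_char) expi_mod // INRM.
  case: cpsi_char => -> _; rewrite -Cmult_assoc; congr (_ * (_ * expi _))%C.
  by rewrite /Rdiv; ring.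
by rewrite e Cmult_assoc u Cmult_1_l.
Qed.

Lemma expi_orthogonality a b : (a < q)%N -> (b < q)%N ->
  (\Csum_(0 <= n < q) (expi (INR n * (INR a / INR q)) * Cconj (expi (INR n * (INR b / INR q)))) =
   if a == b then RtoC (INR q) else 0)%C.
Proof.
move=> aq bq.
have main a' b' : (a' <= b')%N -> (b' < q)%N ->
   (\Csum_(0 <= n < q) (expi (INR n * (INR a' / INR q)) * Cconj (expi (INR n * (INR b' / INR q)))) =
   if a' == b' then RtoC (INR q) else 0)%C.
  move=> ab b'q; have := expi_root_sum (b' - a') q q0 ltac:(lia).
  have -> : (b' - a' == 0)%N = (a' == b') by apply/eqP/eqP; lia.
  move=> <-; apply: eq_bigr => n _; rewrite expi_conj -expi_add; congr expi.
  by rewrite minus_INR; [field; lra | lia].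
case: (leqP a b) => [ab|/ltnW ab]; first exact: main.
have := f_equal Cconj (main b a ab aq); rewrite Cconj_sum eq_sym.
have -> : Cconj (if a == b then RtoC (INR q) else 0)%C = (if a == b then RtoC (INR q) else 0)%C.
  by case: ifP => _; rewrite Cconj_R.
by move=> <-; apply: eq_bigr => n _; rewrite Cconj_mult Cconj_conj Cmult_comm.
Qed.

(** Parseval: the sum over n of |psi n|^2 |G|^2 equals q times the sum of |psi a|^2. The common sum
    is at least |psi 1|^2 = 1 and cancels. *)
Lemma gauss_sum_norm : Cmod gauss_sum = sqrt (INR q).
Proof.
set S := \Rsum_(0 <= a < q) Cmod (psi a) ^ 2.
have S1 : 1 <= S.
  rewrite /S (bigD1_seq 1%N) ?iota_uniq ?mem_index_iota ?prime_gt1 //= (char_one q) // Cmod_1.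
  have : 0 <= \Rsum_(0 <= i < q | i != 1%N) (Cmod (psi i) * (Cmod (psi i) * 1)).
    by apply: Rsum_ge0 => i _; have := Cmod_ge_0 (psi i); nra.
  lra.
have e : RtoC (Cmod gauss_sum ^ 2 * S) = RtoC (INR q * S).
  transitivity (\Csum_(0 <= n < q) RtoC (Cmod (psi n * gauss_sum)%C ^ 2))%C.
    rewrite /S -RtoC_sum big_distrr /=; congr RtoC; apply: eq_bigr => n _.
    by rewrite Cmod_mult; ring.
  transitivity (\Csum_(0 <= a < q) \Csum_(0 <= b < q) (cpsi a * Cconj (cpsi b) *
     \Csum_(0 <= n < q) (expi (INR n * (INR a / INR q)) * Cconj (expi (INR n * (INR b / INR q))))))%C.
    transitivity (\Csum_(0 <= n < q) \Csum_(0 <= a < q) \Csum_(0 <= b < q)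
      (cpsi a * Cconj (cpsi b) * (expi (INR n * (INR a / INR q)) * Cconj (expi (INR n * (INR b / INR q))))))%C.
      apply: eq_bigr => n _; rewrite -gauss_sum_twist Cmod2_conj Cconj_sum big_distrlr /=.
      by apply: eq_bigr => a _; apply: eq_bigr => b _; rewrite Cconj_mult; ring.
    rewrite exchange_big /=; apply: eq_bigr => a _; rewrite exchange_big /=.
    by apply: eq_bigr => b _; rewrite big_distrr.
  rewrite RtoC_mult /S RtoC_sum big_distrr /=.
  rewrite big_seq_cond [RHS]big_seq_cond; apply: eq_bigr => a; rewrite mem_index_iota => /andP[/andP[_ aq] _].
  rewrite (bigD1_seq a) ?iota_uniq ?mem_index_iota //= expi_orthogonality // eqxx.
  rewrite [X in (_ + X)%C]big1_seq => [|b /andP[ba]]; last first.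
    by rewrite mem_index_iota => /andP[_ bq]; rewrite expi_orthogonality // eq_sym (negbTE ba) Cmult_0_r.
  rewrite Cplus_0_r Cmult_comm; congr Cmult; rewrite -Cmod2_conj /cpsi Cmod_conj //.
have {}e : Cmod gauss_sum ^ 2 * S = INR q * S by case: e.
have c0 := Cmod_ge_0 gauss_sum.
have e2 : Cmod gauss_sum ^ 2 = INR q by apply: (Rmult_eq_reg_r S) => //; lra.
by rewrite -e2 sqrt_pow2.
Qed.

Lemma char_sum_gauss t :
  (gauss_sum * char_sum psi t = \Csum_(1 <= a < q) (cpsi a * exp_sum_upto t (INR a / INR q)))%C.
Proof.
rewrite char_sumE big_distrr /=.
transitivity (\Csum_(0 <= a < q) (cpsi a * exp_sum_upto t (INR a / INR q)))%C.
  rewrite /exp_sum_upto; under [RHS]eq_bigr do rewrite big_distrr /=.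
  rewrite exchange_big /=; apply: eq_bigr => n _.
  by rewrite gauss_sum_twist Cmult_comm.
rewrite big_ltn // (char_zero q cpsi cpsi_char) ?Cmult_0_l ?Cplus_0_l //.
by rewrite /coprime gcd0n neq_ltn prime_gt1 ?orbT.
Qed.

Lemma char_sum_norm t B :
  Cmod (\Csum_(1 <= a < q) (cpsi a * exp_sum_upto t (INR a / INR q)))%C <= INR q * B ->
  Cmod (char_sum psi t) <= sqrt (INR q) * B.
Proof.
rewrite -char_sum_gauss Cmod_mult gauss_sum_norm => h.
have s0 := sqrt_lt_R0 _ qp; apply: (Rmult_le_reg_l (sqrt (INR q))) => //.
by rewrite -Rmult_assoc sqrt_sqrt; lra.
Qed.

Lemma cpsi_le1 a : Cmod (cpsi a) <= 1.
Proof. exact/unimodular_mult_le1/(char_unimodular q)/cpsi_char. Qed.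

Lemma inv_abs_sin_le a : (0 < a)%N -> (a < q)%N ->
  / Rabs (sin (PI * (INR a / INR q))) <= INR q / 2 * (/ INR a + / INR (q - a)).
Proof.
move=> a0 aq; have ap := INR_pos a a0; have bp : 0 < INR (q - a) by apply: INR_pos; lia.
have eb : INR (q - a) = INR q - INR a by rewrite minus_INR; [by [] | lia].
have PI0 := PI_RGT_0.
have key x : 0 < x -> 2 * (x / INR q) <= Rabs (sin (PI * (INR a / INR q))) ->
    / Rabs (sin (PI * (INR a / INR q))) <= INR q / 2 * / x.
  move=> x0 h; have -> : INR q / 2 * / x = / (2 * (x / INR q)) by field; lra.
  apply: Rinv_le_contravar => //; apply: Rmult_lt_0_compat; first lra.
  exact: Rdiv_lt_0_compat.
have ia := Rinv_0_lt_compat _ ap; have ib := Rinv_0_lt_compat _ bp.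
have iq := Rinv_0_lt_compat _ qp.
case: (Rle_lt_dec (INR a / INR q) (/ 2)) => h.
  have h0 : 0 <= INR a / INR q by apply: Rmult_le_pos; lra.
  have := key (INR a) ap; rewrite -{1}(Rabs_pos_eq (INR a / INR q)) // => /(_ (abs_sin_ge _ _)).
  by rewrite Rabs_pos_eq // => /(_ h); have := Rmult_lt_0_compat _ _ qp ib; lra.
have e : INR (q - a) / INR q = 1 - INR a / INR q by rewrite eb; field; lra.
have h1 : 0 <= INR (q - a) / INR q by apply: Rmult_le_pos; lra.
have h2 : Rabs (INR (q - a) / INR q) <= / 2 by rewrite Rabs_pos_eq //; lra.
have h3 := abs_sin_ge _ h2; rewrite Rabs_pos_eq // in h3.
have e2 : Rabs (sin (PI * (INR (q - a) / INR q))) = Rabs (sin (PI * (INR a / INR q))).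
  rewrite -(abs_sin_opp (INR a / INR q)) -(abs_sin_period (- (INR a / INR q)) 1) e.
  by congr (Rabs (sin (PI * _))); rewrite /=; lra.
rewrite e2 in h3; have := key _ bp h3; have := Rmult_lt_0_compat _ _ qp ia; lra.
Qed.

Lemma polya_vinogradov t : Cmod (char_sum psi t) <= sqrt (INR q) * (1 + ln (INR q)).
Proof.
apply: char_sum_norm; apply: Cmod_sum_le.
apply: (Rle_trans _ (\Rsum_(1 <= a < q) (INR q / 2 * (/ INR a + / INR (q - a))))).
  apply: Rsum_le_nat => a /andP[a0 aq] _; rewrite Cmod_mult.
  apply: Rle_trans (inv_abs_sin_le a a0 aq).
  have s0 : sin (PI * (INR a / INR q)) <> 0.
    have h := abs_sin_frac (Z.of_nat a) q q0; rewrite -INR_IZR_INZ in h.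
    have {}h : 2 / INR q <= Rabs (sin (PI * (INR a / INR q))).
      apply: h => k hk; have : (0 < k)%Z by nia.
      by nia.
    by move=> e; move: h; rewrite e Rabs_R0; have := Rdiv_lt_0_compat 2 (INR q) ltac:(lra) qp; lra.
  have := expi_sum_le (INR a / INR q) 1 t.+1 isT s0; rewrite -/(exp_sum_upto t (INR a / INR q)).
  have := cpsi_le1 a; have := Cmod_ge_0 (cpsi a); have := Cmod_ge_0 (exp_sum_upto t (INR a / INR q)); nra.
rewrite -big_distrr big_split /=.
have -> : \Rsum_(1 <= i < q) / INR (q - i) = \Rsum_(1 <= i < q) / INR i.
  rewrite big_nat_rev /=; apply: eq_big_nat => i /andP[i0 iq].
  by congr (/ INR _); lia.
have : \Rsum_(1 <= i < q) / INR i <= 1 + ln (INR q); last by nra.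
apply: Rle_trans (hsum_le_ln q); apply: Rle_trans (hsum_mono q.-1 q (leq_pred q)).
by rewrite /hsum prednK //; lra.
Qed.

Lemma sum_symmetric_range (N : nat) (F : nat -> C) :
  (\Csum_(1 <= a < N.*2.+1) F a = \Csum_(1 <= a < N.+1) (F a + F (N.*2.+1 - a)%N))%C.
Proof.
rewrite (big_cat_nat (n := N.+1)) //=; last by rewrite ltnS -addnn leq_addr.
rewrite big_split /=; congr Cplus.
have -> : (\Csum_(N.+1 <= i < N.*2.+1) F i = \Csum_(1 <= i < N.+1) F (i + N)%N)%C.
  by rewrite -{1}(add1n N) big_addn; congr bigop; congr index_iota; lia.
rewrite big_nat_rev /=; apply: eq_big_nat => i /andP[i0 iN]; congr F; lia.
Qed.

(** A finite form of Pólya's expansion. As psi is even, a and q - a combine to the real part of the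
    exponential sum, a Dirichlet kernel; replacing 1 / sin(PI a / q) by q / (PI a) costs 2 and the
    constant term of the kernel 1, so at most 3 for each of the (q - 1) / 2 values of a, less than 2
    q in all. *)
Lemma even_char_sum_bound t B : odd q -> psi q.-1 = RtoC 1 ->
  Cmod (sinsum cpsi ((INR t + / 2) / INR q) 0 q./2) <= B ->
  Cmod (char_sum psi t) <= sqrt (INR q) * (B + 2).
Proof.
move=> oq ev hB; apply: char_sum_norm.
set N := q./2 in hB *; have eq : q = N.*2.+1 by rewrite /N -[LHS]odd_double_half oq.
set al := (INR t + / 2) / INR q in hB *.
have cev a : (a <= q)%N -> cpsi (q - a) = cpsi a.
  move=> aq; rewrite /cpsi; congr Cconj.
  have -> : psi a = psi (q.-1 * a)%N by case: psiP => -> _; rewrite ev Cmult_1_l.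
  apply: (char_congr q) => //; apply/eqP; rewrite -(eqn_modDr a) subnK // -mulSnr prednK //.
  by rewrite modnn modnMr.
have cpi : INR q / PI <= INR q.
  have := PI2_3_2; have PI0 := PI_RGT_0 => h.
  by apply: (Rmult_le_reg_r PI) => //; rewrite /Rdiv Rmult_assoc Rinv_l; nra.
have -> : (\Csum_(1 <= a < q) (cpsi a * exp_sum_upto t (INR a / INR q)) =
   \Csum_(1 <= a < N.+1) (cpsi a * RtoC (2 * Re (exp_sum_upto t (INR a / INR q)))))%C.
  rewrite {1}eq sum_symmetric_range -eq; apply: eq_big_nat => a /andP[a0 aN].
  have aq : (a <= q)%N by rewrite eq; lia.
  rewrite cev //; have -> : exp_sum_upto t (INR (q - a) / INR q) = Cconj (exp_sum_upto t (INR a / INR q)).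
    rewrite -exp_sum_upto_opp /exp_sum_upto; apply: eq_bigr => n _.
    rewrite minus_INR; last by lia.
    have -> : INR n * ((INR q - INR a) / INR q) = INR n * - (INR a / INR q) + IZR (Z.of_nat n).
      by rewrite -INR_IZR_INZ; field; lra.
    exact: expi_period.
  case: (exp_sum_upto t (INR a / INR q)) => u v.
  rewrite -Cmult_plus_distr_l; congr Cmult; rewrite /Cconj /Cplus /RtoC /=; f_equal; ring.
have -> : (\Csum_(1 <= a < N.+1) (cpsi a * RtoC (2 * Re (exp_sum_upto t (INR a / INR q)))) =
   RtoC (INR q / PI) * sinsum cpsi al 0 N +
   \Csum_(1 <= a < N.+1) (cpsi a * RtoC (2 * Re (exp_sum_upto t (INR a / INR q)) -
      sin (2 * PI * (INR a * al)) * / (PI * (INR a / INR q)))))%C.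
  rewrite /sinsum big_distrr /= -big_split /=; apply: eq_big_nat => a /andP[a0 aN].
  have ap := INR_pos a a0; have PI0 := PI_RGT_0.
  have -> : / (PI * (INR a / INR q)) = INR q / PI * / INR a by field; lra.
  by rewrite !RtoC_minus !RtoC_mult; ring.
apply: Cmod_add_le.
have e1 : Cmod (RtoC (INR q / PI) * sinsum cpsi al 0 N)%C <= INR q * B.
  have PI0 := PI_RGT_0; rewrite Cmod_mult Cmod_R Rabs_pos_eq; last by left; apply: Rdiv_lt_0_compat.
  apply: Rmult_le_compat => //; last exact: Cmod_ge_0.
  by left; apply: Rdiv_lt_0_compat.
suff e2 : Cmod (\Csum_(1 <= a < N.+1) (cpsi a * RtoC (2 * Re (exp_sum_upto t (INR a / INR q)) -
      sin (2 * PI * (INR a * al)) * / (PI * (INR a / INR q)))))%C <= INR q * 2 by lra.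
apply: Cmod_sum_le.
apply: (Rle_trans _ (\Rsum_(1 <= a < N.+1) 3)); last first.
  rewrite Rsum_const count_predT size_iota subn1 /=.
  have : INR q = 2 * INR N + 1 by rewrite {1}eq S_INR -addnn INRD; lra.
  by have := pos_INR N; lra.
apply: Rsum_le_nat => a /andP[a0 aN] _.
have ap := INR_pos a a0; have PI0 := PI_RGT_0.
have hx : 0 < PI * (INR a / INR q) <= PI / 2.
  split; first by apply: Rmult_lt_0_compat => //; apply: Rdiv_lt_0_compat.
  apply: Rmult_le_compat_l; first lra.
  apply: (Rmult_le_reg_r (INR q)) => //; rewrite /Rdiv Rmult_assoc Rinv_l; last lra.
  have : INR q = 2 * INR N + 1 by rewrite {1}eq S_INR -addnn INRD; lra.
  by have := INR_leq a N ltac:(lia); lra.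
have s0 : sin (PI * (INR a / INR q)) <> 0.
  by have := sin_gt_0 (PI * (INR a / INR q)) ltac:(lra) ltac:(lra); lra.
rewrite exp_sum_upto_Re //.
have -> : INR a / INR q * (INR t + / 2) = INR a * al by rewrite /al; field; lra.
set s := sin (2 * PI * (INR a * al)).
have -> : s / sin (PI * (INR a / INR q)) - 1 - s * / (PI * (INR a / INR q)) =
  s * (/ sin (PI * (INR a / INR q)) - / (PI * (INR a / INR q))) + - (1) by rewrite /Rdiv; ring.
rewrite Cmod_mult Cmod_R.
have h1 := inv_sin_sub_inv _ hx.
have h2 : Rabs s <= 1 by apply: Rabs_le; have := SIN_bound (2 * PI * (INR a * al)); rewrite -/s; lra.
have h3 := Rabs_triang (s * (/ sin (PI * (INR a / INR q)) - / (PI * (INR a / INR q)))) (- (1)).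
rewrite Rabs_mult Rabs_Ropp Rabs_R1 in h3.
have h4 := cpsi_le1 a; have h5 := Cmod_ge_0 (cpsi a).
have h6 := Rabs_pos s; have h7 := Rabs_pos (/ sin (PI * (INR a / INR q)) - / (PI * (INR a / INR q))).
have h8 := Rmult_le_compat _ _ _ _ h6 h7 h2 h1.
have h9 := Rabs_pos (s * (/ sin (PI * (INR a / INR q)) - / (PI * (INR a / INR q))) + - (1)).
have := Rmult_le_compat _ _ _ _ h5 h9 h4 (Rle_refl _); lra.
Qed.
End GaussSum.

(** * Difference sets in finite groups, and the choice of parameters *)

Section SumSet.
Variables (gT : finGroupType) (S : {set gT}) (x0 : gT).
Hypothesis x0S : x0 \in S.

Fixpoint diff_ball (j : nat) : {set gT} :=
  if j is j'.+1 then (S^-1 * S * diff_ball j')%g else [set 1%g].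

Let T : {set gT} := (S^-1 * S)%g.

Lemma diff_one : 1%g \in T.
Proof. by rewrite -(mulVg x0) mem_mulg // memV_invg. Qed.

Lemma diff_ball_mono j : diff_ball j \subset diff_ball j.+1.
Proof. by apply/subsetP => x hx; rewrite /= -(mul1g x) mem_mulg // diff_one. Qed.

(** A new element z yields a translate S z that is disjoint from S times ball j: a common point s b
    = s' z would put z = s'^-1 s b into ball j + 1. Both sets lie in S times ball j + 2. *)
Lemma diff_ball_growth j : diff_ball j.+2 != diff_ball j.+1 ->
  (#|(S * diff_ball j)%g| + #|S| <= #|(S * diff_ball j.+2)%g|)%N.
Proof.
move=> ne; have [z z2 z1] : exists2 z, z \in diff_ball j.+2 & z \notin diff_ball j.+1.
  by apply/subsetPn; apply: contra ne => h; rewrite eqEsubset h diff_ball_mono.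
rewrite -(card_rcoset S z) -cardsUI.
have -> : (S * diff_ball j :&: (S :* z))%g = set0.
  apply/setP => w; rewrite !inE; apply/negP => /andP[/mulsgP[s b sS bB ->] /rcosetP[s' s'S e]].
  case/negP: z1; have -> : z = (s'^-1 * s * b)%g by rewrite -mulgA e mulKg.
  by rewrite /= mem_mulg // mem_mulg // memV_invg.
rewrite cards0 addn0; apply: subset_leq_card; rewrite subUset; apply/andP; split.
  apply: mulgS; apply: subset_trans (diff_ball_mono _) (diff_ball_mono _).
by apply/subsetP => w /rcosetP[s sS ->]; rewrite mem_mulg.
Qed.

(** Every two steps without stabilisation add at least #|S| elements to S times the ball, which
    already starts with #|S| elements and cannot outgrow the group. *)
Lemma diff_ball_stable : exists j, (j <= 2 * (#|gT| %/ #|S|))%N /\ diff_ball j.+1 = diff_ball j.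
Proof.
have S0 : (0 < #|S|)%N by apply/card_gt0P; exists x0.
have H k : (exists j, (j <= 2 * k)%N /\ diff_ball j.+1 = diff_ball j) \/
    (k.+1 * #|S| <= #|(S * diff_ball (2 * k))%g|)%N.
  elim: k => [|k [[j [jk e]]|IH]].
  - by right; rewrite mul1n muln0 /= mulg1.
  - by left; exists j; split=> //; lia.
  - case: (eqVneq (diff_ball (2 * k).+2) (diff_ball (2 * k).+1)) => [e|ne].
      by left; exists (2 * k).+1; split=> //; lia.
    right; have -> : (2 * k.+1 = (2 * k).+2)%N by lia.
    apply: leq_trans (diff_ball_growth _ ne); by rewrite mulSn addnC leq_add2r.
case: (H (#|gT| %/ #|S|)%N) => // h.
by have := leq_trans h (max_card _); rewrite leqNgt ltn_ceil.
Qed.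

(** A stable ball is a subgroup, and it contains x0^-1 S. Its index is a divisor of #|gT| smaller
    than the least prime factor, hence 1. *)
Lemma diff_ball_full : (#|gT| < #|S| * pdiv #|gT|)%N ->
  exists j, (j <= 2 * (#|gT| %/ #|S|))%N /\ x0 \in diff_ball j.
Proof.
move=> big; have [j [hj e]] := diff_ball_stable; exists j; split=> //.
set B := diff_ball j in e *.
have B1 : 1%g \in B.
  rewrite /B; elim: (j) => [|i IH] /=; first by rewrite inE.
  by apply: (subsetP (diff_ball_mono i)).
have TB : (T * B)%g = B by rewrite -[RHS]e.
have BB i : (diff_ball i * B)%g = B.
  elim: i => [|i IH] /=; first exact: mul1g.
  by rewrite -mulgA IH.
have gB : group_set B by apply/group_setP; split=> // x y hx hy; rewrite -(BB j) mem_mulg.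
have SB : (#|S| <= #|B|)%N.
  rewrite -(card_lcoset B x0); apply: subset_leq_card; apply/subsetP => s sS.
  apply/lcosetP; exists (x0^-1 * s)%g; last by rewrite mulKVg.
  rewrite -TB -(mulg1 (x0^-1 * s)%g) mem_mulg // mem_mulg // memV_invg //.
have : (#|Group gB| %| #|[set: gT]|)%N by apply: cardSg; apply: subsetT.
rewrite cardsT /= => /dvdnP[k ek].
have k1 : k = 1%N.
  have g0 : (0 < #|gT|)%N by apply/card_gt0P; exists x0.
  have k0 : (0 < k)%N by case: (posnP k) => // k0; move: g0; rewrite ek k0.
  case: (leqP k 1) => [|k2]; first by lia.
  have := pdiv_min_dvd k2 (_ : (k %| #|gT|)%N); rewrite ek dvdn_mulr // -ek => /(_ isT) hk.
  by have := leq_trans big (leq_mul SB hk); rewrite mulnC -ek ltnn.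
have : B = [set: gT] by apply/eqP; rewrite eqEcard subsetT cardsT ek k1 mul1n leqnn.
by move=> ->; rewrite inE.
Qed.

(** By commutativity the inverses move to the other side: u = w v^-1 with v and w each x0 times j
    elements of [S]. [P] carries whatever property such products inherit. *)
Lemma diff_ball_represent (P : nat -> gT -> Prop) : (forall x y : gT, x * y = y * x)%g ->
  P 0%N x0 -> (forall j v s, P j v -> s \in S -> P j.+1 (v * s)%g) ->
  forall j u, u \in diff_ball j -> exists v w, P j v /\ P j w /\ (v * u = w)%g.
Proof.
move=> comm P0 PS; elim=> [|j IH] u /=; first by rewrite inE => /eqP ->; exists x0, x0; rewrite mulg1.
case/mulsgP => t b /mulsgP[s' s]; rewrite inE => hs' hs -> hb ->.
have [v [w [Pv [Pw e]]]] := IH b hb.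
exists (v * s'^-1)%g, (w * s)%g; split; [exact: PS | split; first exact: PS].
by rewrite -e !mulgA mulgKV -!mulgA (comm s b).
Qed.
End SumSet.

(** * Explicit inequalities for the choice of parameters *)

Lemma exp_ge_pow4 x : 0 <= x -> x ^ 4 / 256 <= exp x.
Proof.
move=> x0; have -> : exp x = exp (x / 4) ^ 4.
  have -> : x = x / 4 + (x / 4 + (x / 4 + x / 4)) by field.
  rewrite !exp_plus; have -> : (x / 4 + (x / 4 + (x / 4 + x / 4))) / 4 = x / 4 by field.
  by rewrite /=; ring.
have -> : x ^ 4 / 256 = (x / 4) ^ 4 by field.
by apply: pow_incr; have := exp_ineq1_le (x / 4); lra.
Qed.

Lemma ln_le_small u : 100000000 <= u -> ln u <= u / 10000.
Proof.
move=> hu; apply: Rnot_lt_le => h.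
have := exp_ge_pow4 (ln u) ltac:(lra); rewrite exp_ln; last lra.
have h4 : (u / 10000) ^ 4 <= (ln u) ^ 4 by apply: pow_incr; lra.
have : u * (10000 ^ 4 * 256) < u * u ^ 3; last by move: h4; rewrite /=; nra.
apply: Rmult_lt_compat_l; first lra.
have : 100000000 ^ 3 <= u ^ 3 by apply: pow_incr; lra.
rewrite /=; lra.
Qed.

Lemma exp_128_ge u : 100000000 <= u -> u ^ 2 <= exp (u / 128).
Proof.
move=> hu; have := exp_ge_pow4 (u / 128) ltac:(lra); apply: Rle_trans.
have -> : (u / 128) ^ 4 / 256 = u ^ 2 * (u ^ 2 / 68719476736) by field.
rewrite -{1}(Rmult_1_r (u ^ 2)); apply: Rmult_le_compat_l; first exact: pow2_ge_0.
have : 100000000 ^ 2 <= u ^ 2 by apply: pow_incr; lra.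
rewrite /=; lra.
Qed.

Lemma exp_mul_INR x n : exp (INR n * x) = exp x ^ n.
Proof.
elim: n => [|n IH]; first by rewrite Rmult_0_l exp_0.
by rewrite S_INR Rmult_plus_distr_r exp_plus IH Rmult_1_l /=; ring.
Qed.

Lemma mul_exp_opp_le x : x * exp (- x) <= / 2.
Proof.
rewrite exp_Ropp; have h := exp_pos x; apply: (Rmult_le_reg_r (exp x)) => //.
rewrite Rmult_assoc Rinv_l; last lra.
have := exp_ineq1_le (x - 1); have -> : exp x = exp 1 * exp (x - 1) by rewrite -exp_plus; congr exp; ring.
have := exp_ineq1_le 1; have := exp_pos (x - 1); nra.
Qed.

Lemma INR_ceil x : 0 <= x -> exists n : nat, x <= INR n <= x + 1.
Proof. by move=> x0; have [n hn] := nfloor_ex x x0; exists n.+1; rewrite S_INR; lra. Qed.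

Lemma pow_cancel_le (V c : R) (m n k : nat) : 1 <= V -> c <= V ^ k -> (m + k <= n)%N ->
  c * V ^ m <= V ^ n.
Proof.
move=> V1 hc h; apply: (Rle_trans _ (V ^ (m + k))); last by apply: Rle_pow => //; lia.
rewrite pow_add Rmult_comm; apply: Rmult_le_compat_l => //; apply: pow_le; lra.
Qed.

Lemma sqrt_le_of_sq a b : 0 <= b -> a <= b ^ 2 -> sqrt a <= b.
Proof. by move=> b0 h; rewrite -(sqrt_pow2 b) //; apply: sqrt_le_1_alt. Qed.

Section ParameterChoice.
Variables (T u : R).
Hypotheses (uT : u = ln T) (T0 : 0 < T) (u_big : 100000000 <= u).
(** V = T^(1/128). Nearly every quantity becomes a power of [V], so that estimates reduce to
    comparing exponents with 128, and spare factors [V] absorb constants and powers of [u]. *)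
Let V := exp (u / 128).

Lemma param_V2 : u ^ 2 <= V. Proof. exact: exp_128_ge. Qed.

Lemma param_V : 10000000000 <= V.
Proof.
apply: Rle_trans param_V2; have : 100000000 ^ 2 <= u ^ 2 by apply: pow_incr; lra.
rewrite /=; lra.
Qed.

Lemma param_uV : u <= V.
Proof. by have := param_V2; rewrite /=; nra. Qed.

Lemma param_T : T = V ^ 128.
Proof.
rewrite /V -exp_mul_INR -[LHS]exp_ln // -uT; congr exp.
by have -> : INR 128 = 128 by [rewrite INR_IZR_INZ]; field.
Qed.

Lemma param_sqrtT : sqrt T = V ^ 64.
Proof.
have V0 : 0 <= V ^ 64 by apply: pow_le; have := param_V; lra.
rewrite param_T; have -> : V ^ 128 = (V ^ 64) ^ 2 by rewrite -pow_mult.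
exact: sqrt_pow2.
Qed.

(** The main term has the denominator sqrt(psum H) >= sqrt u / 23; 138 is 3 times 2 times 23. The
    other terms are at most V^97: the critical one is the square root of hsum N times B, that is of
    at most 6 V^192 <= V^194. *)
Lemma katai_error_small H N A B : 0 <= A <= 3 -> ln (INR N) <= T -> ln (INR H) <= V + 1 ->
  u / 512 <= psum H -> 0 <= B <= 2 + V ^ 64 ->
  katai_error H N A B <= 138 * (T / sqrt u) + 3 * V ^ 97.
Proof.
move=> hA hN hH hL hB; have V1 := param_V; have u0 : 0 < u by lra.
have su := sqrt_lt_R0 u u0; have suu := sqrt_sqrt u (Rlt_le _ _ u0).
have h0 := hsum_ge0 N; have lH := ln_INR_ge0 H.
have T1 : 1 <= T by rewrite param_T; apply: pow_R1_Rle; lra.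
have h2 : hsum N <= 2 * T by have := hsum_le_ln N; lra.
have sA : sqrt A <= 2 by apply: sqrt_le_of_sq; lra.
have sA0 := sqrt_pos A.
have sL : sqrt u / 23 <= sqrt (psum H).
  rewrite -(sqrt_pow2 (sqrt u / 23)); last lra.
  by apply: sqrt_le_1_alt; rewrite /=; nra.
have V97 : 0 <= V ^ 97 by apply: pow_le; lra.
have e1 : (1 + sqrt A) * hsum N / sqrt (psum H) <= 138 * (T / sqrt u).
  have -> : 138 * (T / sqrt u) = 3 * (2 * T) * / (sqrt u / 23) by field; lra.
  apply: Rmult_le_compat; [apply: Rmult_le_pos; lra | left; apply: Rinv_0_lt_compat; lra | |].
    by apply: Rmult_le_compat; lra.
  by apply: Rinv_le_contravar; lra.
have V2 : V <= V ^ 97 by rewrite -{1}(pow_1 V); apply: Rle_pow; [lra | lia].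
have sq : (V ^ 97) ^ 2 = V * (V * V ^ 192) by rewrite -pow_mult /=; ring.
have e129 : V * V ^ 128 <= V * V ^ 192.
  by apply: Rmult_le_compat_l; [lra | apply: Rle_pow; [lra | lia]].
have V128 : 1 <= V ^ 128 by apply: pow_R1_Rle; lra.
have V192 : 1 <= V ^ 192 by apply: pow_R1_Rle; lra.
have e2 : sqrt (2 * hsum N * (1 + ln (INR H))) <= V ^ 97.
  apply: sqrt_le_of_sq => //; rewrite sq.
  apply: (Rle_trans _ (2 * (2 * T) * (2 * V))).
    by apply: Rmult_le_compat; lra.
  rewrite param_T; have := Rmult_le_compat 8 V (V * V ^ 128) (V * V ^ 192) ltac:(lra).
  by move/(_ ltac:(apply: Rmult_le_pos; lra) ltac:(lra) e129); lra.
have e4 : sqrt (hsum N * B) <= V ^ 97.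
  apply: sqrt_le_of_sq => //; rewrite sq.
  have V64 : 1 <= V ^ 64 by apply: pow_R1_Rle; lra.
  apply: (Rle_trans _ (2 * T * (3 * V ^ 64))).
    by apply: Rmult_le_compat; lra.
  have -> : 2 * T * (3 * V ^ 64) = 6 * V ^ 192.
    by rewrite param_T; have -> : V ^ 192 = V ^ 128 * V ^ 64 by [rewrite -pow_add]; ring.
  have := Rmult_le_compat 6 (V * V) (V ^ 192) (V ^ 192) ltac:(lra) ltac:(lra) ltac:(nra) ltac:(lra); lra.
have e3 : 2 * (1 + ln (INR H)) <= V ^ 97.
  have : V ^ 2 <= V ^ 97 by apply: Rle_pow; [lra | lia].
  rewrite /= in V2 *; move=> h; have := h; rewrite /=; nra.
rewrite /katai_error; lra.
Qed.

Lemma inv_u_le : / u <= / sqrt u.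
Proof.
apply: Rinv_le_contravar; first by apply: sqrt_lt_R0; lra.
by apply: sqrt_le_of_sq; rewrite /=; nra.
Qed.

Lemma param_pow_small m : (m + 2 <= 128)%N -> V ^ m <= T / u.
Proof.
move=> hm; have V1 := param_V; have V2 := param_V2.
apply: (Rmult_le_reg_r u); first lra.
have -> : T / u * u = T by field; lra.
rewrite param_T Rmult_comm; apply: (pow_cancel_le V u m 128 1); [lra | | lia].
by rewrite pow_1; apply: param_uV.
Qed.

(** At squared distance 32 ln u the mean gains exp(-4 ln u) = u^-4, which pays for hsum K <= u. At u
    / 4 it gains exp(-u/32) = V^-4, which pays for the up to K, about V, characters. *)
Lemma head_small K : V <= INR K <= V + 1 ->
  hsum K * (mean_bound T (32 * ln u) + INR K * mean_bound T (u / 4)) <=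
  64 * exp 8 * (T / u).
Proof.
move=> hK; have V1 := param_V; have V2 := param_V2; have uV := param_uV.
have c0 := exp_pos 8; have u0 : 0 < u by lra.
have hs : hsum K <= u.
  have h1 := hsum_le_ln K; have h2 := ln_mono (INR K) (exp 1 * V) ltac:(lra).
  have e1 := exp_ineq1_le 1.
  have := h2 ltac:(nra); rewrite ln_mult; [|lra|lra]; rewrite ln_exp /V ln_exp; lra.
have hs0 := hsum_ge0 K.
have m0 : mean_bound T (32 * ln u) = 8 * exp 8 * (T / u ^ 4 + V ^ 64).
  rewrite /mean_bound param_sqrtT; congr (_ * (_ + _)); congr Rmult.
  have -> : - (32 * ln u) / 8 = - (4 * ln u) by field.
  rewrite exp_Ropp; congr Rinv; have -> : 4 = INR 4 by rewrite /=; lra.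
  by rewrite exp_mul_INR exp_ln.
have m1 : mean_bound T (u / 4) = 8 * exp 8 * (V ^ 124 + V ^ 64).
  rewrite /mean_bound param_sqrtT; congr (_ * (_ + _)).
  have -> : exp (- (u / 4) / 8) = / V ^ 4.
    rewrite /V -exp_mul_INR -exp_Ropp; congr exp; have -> : INR 4 = 4 by rewrite /=; lra.
    field.
  rewrite param_T; have -> : V ^ 128 = V ^ 124 * V ^ 4 by rewrite -pow_add.
  by field; lra.
rewrite m0 m1.
have T1 : 0 < T / u by apply: Rdiv_lt_0_compat.
have a1 : u * (T / u ^ 4) <= T / u.
  have -> : u * (T / u ^ 4) = T / u * / u ^ 2 by field; lra.
  rewrite -{2}(Rmult_1_r (T / u)); apply: Rmult_le_compat_l; first lra.
  rewrite -Rinv_1; apply: Rinv_le_contravar; rewrite /=; nra.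
have V64 : 0 <= V ^ 64 by apply: pow_le; lra.
have a2 : u * V ^ 64 <= T / u.
  apply: (Rle_trans _ (V ^ 65)); last exact: param_pow_small.
  by rewrite /=; apply: Rmult_le_compat_r.
have V124 : 0 <= V ^ 124 by apply: pow_le; lra.
have a3 : u * (INR K * (V ^ 124 + V ^ 64)) <= 4 * (T / u).
  have h1 : V ^ 64 <= V ^ 124 by apply: Rle_pow; [lra | lia].
  apply: (Rle_trans _ (4 * (u * V * V ^ 124))).
    have : INR K * (V ^ 124 + V ^ 64) <= 2 * V * (2 * V ^ 124) by apply: Rmult_le_compat; lra.
    move=> h; have := Rmult_le_compat_l u _ _ (Rlt_le _ _ u0) h; lra.
  apply: Rmult_le_compat_l; first lra.
  apply: (Rmult_le_reg_r u) => //; have -> : T / u * u = T by field; lra.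
  have -> : u * V * V ^ 124 * u = u ^ 2 * V ^ 125 by rewrite [V ^ 125]/= /=; ring.
  by rewrite param_T; apply: (pow_cancel_le V (u ^ 2) 125 128 1); [lra | rewrite pow_1 | lia].
have b0 : 0 <= 8 * exp 8 * (T / u ^ 4 + V ^ 64) + INR K * (8 * exp 8 * (V ^ 124 + V ^ 64)).
  have t4 : 0 <= T / u ^ 4 by left; apply: Rdiv_lt_0_compat => //; apply: pow_lt.
  have := pos_INR K => k0; apply: Rplus_le_le_0_compat; first by apply: Rmult_le_pos; lra.
  by apply: Rmult_le_pos => //; apply: Rmult_le_pos; lra.
apply: (Rle_trans _ (u * (8 * exp 8 * (T / u ^ 4 + V ^ 64) + INR K * (8 * exp 8 * (V ^ 124 + V ^ 64))))).
  exact: Rmult_le_compat_r.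
have -> : u * (8 * exp 8 * (T / u ^ 4 + V ^ 64) + INR K * (8 * exp 8 * (V ^ 124 + V ^ 64))) =
  8 * exp 8 * (u * (T / u ^ 4) + u * V ^ 64 + u * (INR K * (V ^ 124 + V ^ 64))) by ring.
have -> : 64 * exp 8 * (T / u) = 8 * exp 8 * (8 * (T / u)) by ring.
by apply: Rmult_le_compat_l; lra.
Qed.

(** H is about exp V. The lower bound for [psum H] comes from the weighted prime sum at T1 =
    exp(u/256), that is sqrt V: then ln H >= T1^2 makes the tail condition hold, and ln T1 - 4 >=
    u/512. *)
Lemma param_H : exists H : nat, [/\ ln (INR H) <= V + 1, u / 512 <= psum H, INR H <= 2 * exp V & hsum H <= V + 2].
Proof.
have V1 := param_V; have eV := exp_ineq1_le V.
have [H hH] := INR_ceil (exp V) ltac:(lra).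
have Hp : (0 < H)%N by case: H hH => //=; lra.
have lnH : ln (INR H) <= V + 1.
  have := ln_mono (INR H) (exp 1 * exp V) ltac:(lra); have := exp_ineq1_le 1 => e1.
  by move=> h; have := h ltac:(nra); rewrite -exp_plus ln_exp; lra.
exists H; split=> //; last by have := hsum_le_ln H; lra.
  set T1 := exp (u / 256).
  have T10 : 0 < T1 by exact: exp_pos.
  have eT1 : T1 * T1 = V by rewrite /T1 /V -exp_plus; congr exp; field.
  have lnH2 : V <= ln (INR H) by have := ln_mono _ _ (exp_pos V) (proj1 hH); rewrite ln_exp.
  have hy : T1 * pw T1 H <= / 2.
    apply: Rle_trans (mul_exp_opp_le T1); apply: Rmult_le_compat_l; first lra.
    apply: exp_mono; apply: Ropp_le_contravar; apply: (Rmult_le_reg_r T1) => //.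
    by rewrite eT1 /Rdiv Rmult_assoc Rinv_l; lra.
  have := sum_primes_wt_ge T1 H T10 Hp hy; rewrite /T1 ln_exp => h.
  apply: (Rle_trans _ (u / 256 - 4)); first lra.
  apply: (Rle_trans _ _ _ h); apply: Rsum_le => p pp; apply: wt_le_inv => //; exact: prime_gt0.
lra.
Qed.

Lemma sinsum_small f y N K a : (0 < y)%N -> T * pw T y <= / 2 -> T <= ln (INR y) ->
  unimodular_mult f -> V <= INR K <= V + 1 ->
  (forall s xi, (0 < s)%N -> (s <= K)%N -> is_dirichlet_char s xi -> odd_char s xi ->
     32 * ln u <= dist2 T y (fun n => f n * xi n)%C) ->
  ln (INR N) <= T ->
  Cmod (sinsum f a 0 N) <= (290 + 64 * exp 8) * (T / sqrt u).
Proof.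
move=> y0 hy Ty fP hK hD NT; have V1 := param_V; have uV := param_uV; have V2 := param_V2.
have T1 : 1 <= T by rewrite param_T; apply: pow_R1_Rle; lra.
have u0 : 0 < u by lra.
have [H [lH L HV hH]] := param_H.
have K0 : (0 < K)%N by case: K {hD} hK => //=; lra.
have Kp := INR_pos K K0.
have lK : 2 + ln (INR K) <= u.
  have h2 := ln_mono (INR K) (exp 1 * V) Kp; have e1 := exp_ineq1_le 1.
  have := h2 ltac:(nra); rewrite ln_mult; [|lra|lra]; rewrite ln_exp /V ln_exp; lra.
have lK0 := ln_INR_ge0 K.
have sT := param_sqrtT.
have V64 : V ^ 2 <= V ^ 64 by apply: Rle_pow; [lra | lia].
(* The major arc width e must be below about 1 / (H K), while ln(1/e) enters [katai_error] and must
   stay well below [T]. The choice exp(-sqrt T) makes it V^64. *)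
have e01 : 0 < exp (- sqrt T) <= 1.
  by split; [exact: exp_pos | rewrite -exp_0; apply: exp_mono; have := sqrt_pos T; lra].
have lie : ln (/ exp (- sqrt T)) = V ^ 64 by rewrite -exp_Ropp ln_exp Ropp_involutive sT.
have := sinsum_bound T y f T1 y0 hy Ty fP H N K a (exp (- sqrt T)) (32 * ln u) (u / 4) K0.
move/(_ ltac:(lra) e01 ltac:(lra)) => h.
have {}h : Cmod (sinsum f a 0 N) <= katai_error H N 3 (2 + V ^ 64) +
    katai_error H N 1 (2 * (2 + ln (INR K))) +
    hsum K * (mean_bound T (32 * ln u) + INR K * mean_bound T (u / 4)) + 7.
  rewrite -lie; apply: h => //.
    apply: (Rle_trans _ (exp (2 * V + 4 - V ^ 64))); last first.
      by rewrite -exp_0; apply: exp_mono; rewrite /= in V64; nra.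
    rewrite sT; have -> : 2 * V + 4 - V ^ 64 = (2 + 2) + (V + V) + - V ^ 64 by ring.
    rewrite (exp_plus (2 + 2 + (V + V))) (exp_plus (2 + 2)) (exp_plus 2 2) (exp_plus V).
    have := exp2_ge4; have := exp_ineq1_le V; have := exp_pos V; have := exp_pos (- V ^ 64).
    have := PI_4; have := PI_RGT_0; set E := exp (- V ^ 64); set EV := exp V => pi0 pi4 E0 EV0 EV1 e4.
    have hK2 : INR K <= EV by lra.
    rewrite -/EV in HV.
    have e16 : 16 <= exp 2 * exp 2 by nra.
    apply: (Rle_trans _ (4 * (2 * EV) * E * EV)).
      have PH : 0 <= PI * INR H by apply: Rmult_le_pos; [lra | apply: pos_INR].
      apply: Rmult_le_compat; [by apply: Rmult_le_pos; lra | lra | | lra].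
      apply: Rmult_le_compat_r; first lra.
      by apply: Rmult_le_compat; [lra | apply: pos_INR | lra | lra].
    have p0 : 0 <= EV * EV * E by repeat apply: Rmult_le_pos; lra.
    have := Rmult_le_compat_r _ _ _ p0 e16; lra.
  rewrite -uT; have := ln_mono (2 + ln (INR K)) u ltac:(lra) lK.
  by have := ln_le_small u u_big; lra.
have k1 := katai_error_small H N 3 (2 + V ^ 64) ltac:(lra) NT lH L ltac:(rewrite /= in V64; nra).
have k2 := katai_error_small H N 1 (2 * (2 + ln (INR K))) ltac:(lra) NT lH L ltac:(rewrite /= in V64; nra).
have k3 := head_small K hK.
have k4 := param_pow_small 97 isT.
have k5 := Rmult_le_compat_l T _ _ ltac:(lra) inv_u_le; rewrite -!/(Rdiv _ _) in k5.
have k6 : 1 <= T / u.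
  by apply: Rle_trans (param_pow_small 0 isT); rewrite /=; lra.
have c0 := exp_pos 8.
have := Rmult_le_compat_l (64 * exp 8) _ _ ltac:(lra) k5; lra.
Qed.
End ParameterChoice.

(** * Characters whose powers pretend to be odd *)

Lemma dist2_ext T y h h' : (forall n, h n = h' n) -> dist2 T y h = dist2 T y h'.
Proof. by move=> e; apply: eq_bigr => p _; rewrite e. Qed.

Lemma sign_mul_succ k : (-1) ^ k.+1 * (-1) ^ k = - 1.
Proof.
elim: k => [|k IH]; first by rewrite /=; ring.
by have -> : (-1) ^ k.+2 * (-1) ^ k.+1 = (-1) ^ k.+1 * (-1) ^ k by rewrite /=; ring.
Qed.

(* If the set [S] of exponents whose characters pretend to be odd characters of small conductor
   were dense, some element would be a sum of both [j + 1] and [j + 2] elements of [S], up to a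
   common summand, so the same character would pretend to be both an even and an odd character. *)
Lemma pretender_density (T u : R) (y K d' : nat) (f : 'I_d'.+1 -> nat -> C) (S : {set 'I_d'.+1}) :
  u = ln T -> 0 < T -> 100000000 <= u -> (0 < y)%N -> T * pw T y <= / 2 ->
  INR K <= exp (u / 128) + 1 -> (0 < K)%N ->
  (forall v, unimodular_mult (f v)) -> (forall v s n, f (v * s)%g n = (f v n * f s n)%C) ->
  (forall s, s \in S -> exists r xi, (0 < r)%N /\ (r <= K)%N /\ is_dirichlet_char r xi /\
     odd_char r xi /\ dist2 T y (fun n => f s n * xi n)%C <= 32 * ln u) ->
  (d'.+1 < #|S| * pdiv d'.+1)%N ->
  INR #|S| <= 50 * sqrt (ln u / u) * INR d'.+1.
Proof.
move=> uT T0 u_big y0 hy hK K0 fU fM hS dense; apply: Rnot_lt_le => big.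
have u0 : 0 < u by lra.
set E := 32 * ln u; set de := sqrt (ln u / u) in big.
have lu1 : 1 <= ln u.
  rewrite -(ln_exp 1); apply: ln_mono; first exact: exp_pos.
  by have := exp_le_3; lra.
have lus := ln_le_small u u_big.
have de2 : de * de = ln u / u by apply: sqrt_sqrt; left; apply: Rdiv_lt_0_compat; lra.
have de0 : 0 < de by apply: sqrt_lt_R0; apply: Rdiv_lt_0_compat; lra.
have de100 : de <= / 100.
  apply: sqrt_le_of_sq; first lra.
  apply: (Rmult_le_reg_r u) => //; have -> : ln u / u * u = ln u by field; lra.
  lra.
have deu : / u <= de.
  apply: (Rmult_le_reg_r u) => //; rewrite Rinv_l; last lra.
  have h2 : 1 <= (de * u) * (de * u).
    have -> : (de * u) * (de * u) = (de * de) * (u * u) by ring.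
    by rewrite de2; have -> : ln u / u * (u * u) = ln u * u by [field; lra]; nra.
  by have := Rmult_lt_0_compat _ _ de0 u0; nra.
have S0 : (0 < #|S|)%N by case: (#|S|) dense.
have [x0 x0S] : exists x0, x0 \in S by apply/card_gt0P.
have cI : #|{: 'I_d'.+1}| = d'.+1 by rewrite card_ord.
have [j [hj xj]] := diff_ball_full _ S x0 x0S ltac:(by rewrite cI).
rewrite cI in hj.
(* The index is shifted: [P k] is the property inherited by sums of k + 1 elements of [S], so each
   bound carries k + 1 as exponent or factor. *)
pose P (k : nat) (v : 'I_d'.+1) := exists m Xi, (0 < m)%N /\ (m <= K ^ k.+1)%N /\
  is_dirichlet_char m Xi /\
  (forall a b, (m %| a + b)%N -> Xi a = (RtoC ((-1) ^ k.+1) * Xi b)%C) /\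
  dist2 T y (fun n => f v n * Xi n)%C <= INR k.+1 ^ 2 * E.
have P0 : P 0%N x0.
  have [r [xi [r0 [rK [xiP [odd hd]]]]]] := hS x0 x0S.
  exists r, xi; rewrite expn1; split=> //; split=> //; split=> //; split.
    by move=> a b /odd ->; rewrite pow_1; ring.
  by rewrite [INR 1]/= /E; lra.
have PS k v s : P k v -> s \in S -> P k.+1 (v * s)%g.
  move=> [m [Xi [m0 [mK [XiP [par hd]]]]]] sS.
  have [r [xi [r0 [rK [xiP [odd hd2]]]]]] := hS s sS.
  exists (m * r)%N, (fun n => Xi n * xi n)%C; split; first by rewrite muln_gt0 m0.
  split; first by rewrite expnSr leq_mul.
  split; first exact: is_char_mul.
  split.
    move=> a b h; rewrite (par a b); last by apply: dvdn_trans h; apply: dvdn_mulr.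
    rewrite (odd a b); last by apply: dvdn_trans h; apply: dvdn_mull.
    have -> : (-1) ^ k.+2 = - (-1) ^ k.+1 by rewrite /=; ring.
    by rewrite RtoC_opp; ring.
  rewrite (dist2_ext _ _ _ (fun n => (f v n * Xi n) * (f s n * xi n))%C); last by move=> n; rewrite fM; ring.
  apply: dist2_mul => // n.
  exact: (unimodular_mult_le1 _ n (unimodular_multM _ _ (fU v) (char_unimodular m Xi m0 XiP))).
(* The group law of ['I_d'.+1], written multiplicatively, is addition modulo d. *)
have comm (x z : 'I_d'.+1) : (x * z)%g = (z * x)%g by apply: val_inj; rewrite /= addnC.
have [v [w [Pv [Pw e]]]] := diff_ball_represent _ S x0 P comm P0 PS j x0 xj.
(* As x0 lies in ball j, v x0 = w. The left side uses j + 2 elements and the right side j + 1, so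
   [f w] pretends to be characters of both parities, and X1 conj X2 is odd. *)
have := PS j v x0 Pv x0S; rewrite e.
move=> [m1 [X1 [m10 [m1K [X1P [par1 hd1]]]]]]; case: Pw => m2 [X2 [m20 [m2K [X2P [par2 hd2]]]]].
have m0 : (0 < m1 * m2)%N by rewrite muln_gt0 m10.
have cP := is_char_mul m1 m2 X1 (fun n => Cconj (X2 n)) X1P (is_char_conj _ _ X2P) m10 m20.
have odd12 : odd_char (m1 * m2) (fun n => X1 n * Cconj (X2 n))%C.
  move=> a b h; rewrite (par1 a b); last by apply: dvdn_trans h; apply: dvdn_mulr.
  rewrite (par2 a b); last by apply: dvdn_trans h; apply: dvdn_mull.
  rewrite Cconj_mult Cconj_R.
  have -> : (RtoC ((-1) ^ j.+2) * X1 b * (RtoC ((-1) ^ j.+1) * Cconj (X2 b)) =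
    RtoC ((-1) ^ j.+2 * (-1) ^ j.+1) * (X1 b * Cconj (X2 b)))%C by rewrite RtoC_mult; ring.
  rewrite sign_mul_succ; have -> : RtoC (- 1) = (- RtoC 1)%C by rewrite /RtoC /Copp /=; f_equal; lra.
  ring.
have := dist2_repulsion T y (m1 * m2) (f w) X1 X2 T0 y0 hy (fU w)
  (char_unimodular m1 X1 m10 X1P) (char_unimodular m2 X2 m20 X2P) m0 cP
  (odd_char_nontrivial _ _ m0 cP odd12).
rewrite -uT => lower.
set J := INR j.+2 in hd1.
have J0 : 1 <= J by apply: INR_ge1.
(* j <= 2 d / #|S| < 2 / (50 de) by the assumption [big], and the two extra steps cost 2 de <=
   2/100; together 3/50. *)
have Jde : J * de <= 3 / 50.
  have Sp := INR_pos _ S0; have dp := INR_pos d'.+1 isT.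
  have h1 : INR j <= 2 * (INR d'.+1 / INR #|S|).
    apply: (Rle_trans _ (INR (2 * (d'.+1 %/ #|S|)))); first exact: INR_leq.
    by rewrite INRM; have := INR_divn_le d'.+1 #|S| S0; rewrite [INR 2]/=; lra.
  have h2 : INR d'.+1 / INR #|S| * de <= / 50.
    apply: (Rmult_le_reg_r (INR #|S|)) => //.
    have -> : INR d'.+1 / INR #|S| * de * INR #|S| = de * INR d'.+1 by field; lra.
    lra.
  rewrite /J !S_INR; have := Rmult_le_compat_r de _ _ (Rlt_le _ _ de0) h1; lra.
have Jlu : J ^ 2 * ln u <= 36 / 10000 * u.
  have -> : J ^ 2 * ln u = (J * de) * (J * de) * u.
    have -> : (J * de) * (J * de) * u = J ^ 2 * (de * de) * u by rewrite /=; ring.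
    by rewrite de2; field; lra.
  apply: Rmult_le_compat_r; first lra.
  by have := Rmult_lt_0_compat J de ltac:(lra) de0; nra.
have Ju : J <= u.
  have h : J * / u <= 3 / 50 by apply: Rle_trans Jde; apply: Rmult_le_compat_l; lra.
  have := Rmult_le_compat_r u _ _ (Rlt_le _ _ u0) h; rewrite Rmult_assoc Rinv_l; lra.
have lnK : ln (INR K) <= u.
  have h2 := ln_mono (INR K) (exp 1 * exp (u / 128)) (INR_pos _ K0); have e1 := exp_ineq1_le 1.
  have := exp_ineq1_le (u / 128) => e2.
  have := h2 ltac:(nra); rewrite -exp_plus ln_exp; lra.
have lnKp n : ln (INR (K ^ n)%N) = INR n * ln (INR K).
  elim: n => [|n IH]; first by rewrite expn0 /= ln_1; ring.
  by rewrite expnS INRM ln_mult ?IH ?S_INR; [ring | exact: INR_pos | apply: INR_pos; rewrite expn_gt0 K0].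
(* The modulus is at most K^(2 J), and both J and ln K are at most u, so its double logarithm is
   only O(ln u). *)
have lm : ln (INR (m1 * m2)) <= 2 * u ^ 2.
  rewrite INRM ln_mult; try exact: INR_pos.
  have h1 := ln_mono _ _ (INR_pos _ m10) (INR_leq _ _ m1K).
  have h2 := ln_mono _ _ (INR_pos _ m20) (INR_leq _ _ m2K).
  rewrite lnKp -/J in h1; rewrite lnKp in h2.
  have h3 : INR j.+1 <= J by apply: INR_leq.
  have lK0 := ln_INR_ge0 K; have j0 := pos_INR j.+1.
  have h4 := Rmult_le_compat J u (ln (INR K)) u ltac:(lra) lK0 Ju lnK.
  have h5 := Rmult_le_compat (INR j.+1) u (ln (INR K)) u j0 lK0 ltac:(lra) lnK.
  by rewrite /=; lra.
have lm0 := ln_INR_ge0 (m1 * m2).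
have l3 : ln (2 + ln (INR (m1 * m2))) <= 3 * ln u.
  have -> : 3 * ln u = ln (u ^ 3).
    rewrite /= Rmult_1_r !ln_mult; try lra; nra.
  apply: ln_mono; first lra.
  by apply: (Rle_trans _ (2 + 2 * u ^ 2)); [lra | rewrite /=; nra].
have hd2' : dist2 T y (fun n => f w n * X2 n)%C <= J ^ 2 * E.
  apply: (Rle_trans _ _ _ hd2); apply: Rmult_le_compat_r; first by rewrite /E; lra.
  apply: pow_incr; split; [exact: pos_INR | exact: INR_leq].
(* The two distances together are at most 0.2304 u, but would have to reach u - 3 ln u - 7. *)
have : J ^ 2 * E <= 1152 / 10000 * u by rewrite /E; lra.
lra.
Qed.

(** * From lists to sums, and powers of a character of order d *)

Lemma fold_seq_sum (g : nat -> R) m k :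
  List.fold_right Rplus 0 (List.map g (List.seq m k)) = \Rsum_(m <= l < m + k) g l.
Proof.
elim: k m => [|k IH] m; first by rewrite addn0 big_geq.
rewrite /= IH addSnnS [RHS]big_ltn //; lia.
Qed.

Lemma Mmax_le q psi B : 0 <= B -> (forall t, Cmod (char_sum psi t) <= B) -> Mmax q psi <= B.
Proof.
move=> B0 h; rewrite /Mmax; elim: (List.seq 1 q) => [|t s IH] /=; first lra.
exact: Rmax_lub.
Qed.

Lemma Cpow_mul_distr (x z : C) k : Cpow (x * z)%C k = (Cpow x k * Cpow z k)%C.
Proof. by elim: k => [|k IH]; rewrite /= ?IH; ring. Qed.

Lemma Cpow_one k : Cpow (RtoC 1) k = RtoC 1.
Proof. by elim: k => [|k IH] //=; rewrite IH Cmult_1_l. Qed.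

Lemma Cpow_zero k : (0 < k)%N -> Cpow (RtoC 0) k = RtoC 0.
Proof. by case: k => // k _; rewrite /= Cmult_0_l. Qed.

Lemma Cpow_conj (x : C) k : Cconj (Cpow x k) = Cpow (Cconj x) k.
Proof. by elim: k => [|k IH] /=; rewrite ?Cconj_R // Cconj_mult IH. Qed.

Lemma Cpow_addn (x : C) k l : Cpow x (k + l) = (Cpow x k * Cpow x l)%C.
Proof. by elim: k => [|k IH]; rewrite ?add0n ?addSn /= ?IH; ring. Qed.

Lemma Cpow_muln (x : C) k l : Cpow x (k * l) = Cpow (Cpow x k) l.
Proof.
elim: l => [|l IH]; first by rewrite muln0.
by rewrite mulnS Cpow_addn IH.
Qed.

Section PowersOfCharacter.
Variables (q d : nat) (chi : nat -> C).
Hypotheses (pq : prime q) (d2 : (2 <= d)%N) (chiP : is_dirichlet_char q chi).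
Hypothesis ordP : char_order q chi d.

Lemma char_pow_char l : (0 < l)%N -> is_dirichlet_char q (char_pow chi l).
Proof.
move=> l0; case: chiP => mul [per z]; split; last split.
- by move=> m n; rewrite /char_pow mul Cpow_mul_distr.
- by move=> n; rewrite /char_pow per.
move=> n; rewrite -z /char_pow; split=> [h|->]; last exact: Cpow_zero.
apply: Cmod_eq_0; have := f_equal Cmod h; rewrite Cmod_pow Cmod_0.
by case: (Req_dec (Cmod (chi n)) 0) => // nz /(pow_nonzero _ _ nz).
Qed.

Lemma char_pow_nontrivial l : (0 < l)%N -> (l < d)%N -> nontrivial_char q (char_pow chi l).
Proof.
move=> l0 ld; case: ordP => _ [_ /(_ l l0 ld)[n [cn h]]].
by exists n; split=> //; apply/eqP.
Qed.

Lemma polya_Mmax l : (0 < l)%N -> (l < d)%N ->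
  Mmax q (char_pow chi l) <= sqrt (INR q) * (1 + ln (INR q)).
Proof.
move=> l0 ld; have q0 := prime_gt0 pq; apply: Mmax_le.
  by apply: Rmult_le_pos; [apply: sqrt_pos | have := ln_INR_ge0 q; lra].
by move=> t; apply: polya_vinogradov => //; [apply: char_pow_char | apply: char_pow_nontrivial].
Qed.

(** chi(-1)^2 = 1 and chi(-1)^d = 1 with d odd force chi(-1) = 1. All powers of chi are then even,
    which is what turns the Pólya expansion into a sine sum. *)
Lemma char_minus_one : odd d -> chi q.-1 = RtoC 1.
Proof.
move=> od; have q0 := prime_gt0 pq; have q1 := prime_gt1 pq.
have c1 : coprime q.-1 q.
  by rewrite coprime_sym -{1}(prednK q0) coprimeSn.
have sq : Cpow (chi q.-1) 2 = RtoC 1.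
  rewrite -(unimodular_mult_pow chi _ _ (char_unimodular q chi q0 chiP)).
  rewrite (char_congr q chi chiP _ 1%N) ?(char_one q) //.
  have -> : (q.-1 ^ 2 = (q - 2) * q + 1)%N by rewrite expnS expn1; nia.
  by rewrite modnMDl.
have dd : Cpow (chi q.-1) d = RtoC 1 by case: ordP => _ [h _]; apply: h; apply/eqP.
by move: dd; rewrite -(odd_double_half d) od add1n /= -mul2n Cpow_muln sq Cpow_one Cmult_1_r.
Qed.

(* [chi n ^ (u + d)] rather than [chi n ^ u], so that the value is [0] off the units for [u = 0] too. *)
Definition conj_pow (v n : nat) : C := Cpow (Cconj (chi n)) (v + d).

Lemma conj_pow_add_mod v s n : conj_pow ((v + s) %% d) n = (conj_pow v n * conj_pow s n)%C.
Proof.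
rewrite /conj_pow; case cn: (coprime n q); last first.
  rewrite (char_zero q chi chiP) ?cn // Cconj_R !Cpow_zero ?Cmult_0_l //; lia.
have dd : Cpow (Cconj (chi n)) d = RtoC 1.
  by rewrite -Cpow_conj; case: ordP => _ [h _]; rewrite h ?Cconj_R //; apply/eqP.
rewrite !Cpow_addn dd !Cmult_1_r -Cpow_addn {2}(divn_eq (v + s) d) Cpow_addn.
by rewrite mulnC Cpow_muln dd Cpow_one Cmult_1_l.
Qed.

Lemma conj_pow_char_pow l n : (0 < l)%N -> conj_pow l n = Cconj (char_pow chi l n).
Proof.
move=> l0; rewrite /conj_pow /char_pow Cpow_conj; case cn: (coprime n q); last first.
  rewrite (char_zero q chi chiP) ?cn // Cconj_R !Cpow_zero //; lia.
rewrite Cpow_addn -(Cpow_conj _ d); case: ordP => _ [h _]; rewrite h; last by apply/eqP.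
by rewrite Cconj_R Cmult_1_r.
Qed.

Lemma conj_pow_unimodular v : unimodular_mult (conj_pow v).
Proof.
have q0 := prime_gt0 pq.
have [c1 [cM cn]] := unimodular_multC chi (char_unimodular q chi q0 chiP).
split; first by rewrite /conj_pow c1 Cpow_one.
split=> [m n|n]; first by rewrite /conj_pow cM Cpow_mul_distr.
case: (cn n) => h; rewrite /conj_pow; first by left; rewrite h Cpow_zero //; lia.
by right; rewrite Cmod_pow h pow1.
Qed.
End PowersOfCharacter.

(** * The average over the powers of chi *)

Theorem theorem3 :
  exists C0 : R, 0 < C0 /\
  exists q0 : nat, forall q : nat, (q0 <= q)%N -> prime q ->
  forall d : nat, (2 <= d)%N -> (d %| q.-1)%N ->
  forall chi : nat -> C, primitive_char q chi -> char_order q chi d ->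
    / INR d * sum_M q d chi
      <= C0 * (sqrt (INR q) * ln (INR q)) *
         (sqrt (ln (ln (ln (INR q))) / ln (ln (INR q))) + / INR (lpf d)).
Proof.
have e8 := exp_pos 8.
exists (400 + 64 * exp 8); split; first lra.
(* This makes u = ln ln q at least 10^8, the threshold of the explicit inequalities. *)
have [q0 [q00 hq0]] := INR_unbounded (exp (exp 100000000)).
exists q0 => q qq0 pq d d2 _ chi [chiP _] ordP.
have hq := Rle_trans _ _ _ hq0 (INR_leq _ _ qq0).
set T := ln (INR q); set u := ln T.
have hT : exp 100000000 <= T by have := ln_mono _ _ (exp_pos _) hq; rewrite ln_exp.
have T0 : 0 < T by have := exp_pos 100000000; lra.
have u_big : 100000000 <= u by have := ln_mono _ _ (exp_pos _) hT; rewrite ln_exp.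
have u0 : 0 < u by lra.
have lu1 : 1 <= ln u.
  rewrite -(ln_exp 1); apply: ln_mono; first exact: exp_pos.
  by have := exp_le_3; lra.
have T1 : 1 <= T by have := exp_ineq1_le 100000000; lra.
set de := sqrt (ln u / u); set sq := sqrt (INR q).
have de0 : 0 <= de by exact: sqrt_pos.
have sq0 : 0 <= sq by exact: sqrt_pos.
have d0 : (0 < d)%N by lia.
have dp := INR_pos d d0; have d1 : (1 < d)%N by lia.
have pp := pdiv_prime d1; have p0 := INR_pos _ (prime_gt0 pp).
have ip := Rinv_0_lt_compat _ p0.
have sT : 0 <= sq * T by apply: Rmult_le_pos; lra.
have pv l : (1 <= l < d)%N -> Mmax q (char_pow chi l) <= sq * (1 + T).
  by move=> /andP[l0 ld]; apply: (polya_Mmax q d).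
rewrite /sum_M fold_seq_sum subnKC // /lpf.
suff main : \Rsum_(1 <= l < d) Mmax q (char_pow chi l) <=
    INR d * ((400 + 64 * exp 8) * (sq * T) * (de + / INR (pdiv d))).
  apply: (Rmult_le_reg_l (INR d)) => //; rewrite -Rmult_assoc Rinv_r; lra.
(* For even d the term 1 / P^-(d) equals 1/2, and up to the constant the claim is the
   Pólya-Vinogradov bound for each power. *)
case od: (odd d); last first.
  have -> : pdiv d = 2%N.
    have h2 : (2 %| d)%N by rewrite dvdn2 od.
    by apply/eqP; rewrite eqn_leq pdiv_min_dvd // prime_gt1.
  apply: (Rle_trans _ (\Rsum_(1 <= l < d) (sq * (1 + T)))).
    by apply: Rsum_le_nat => l hl _; apply: pv.
  rewrite Rsum_const count_predT size_iota; apply: Rmult_le_compat; [exact: pos_INR | | |].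
  - by apply: Rmult_le_pos; lra.
  - by apply: INR_leq; lia.
  rewrite [INR 2]/=; have h1 : sq * (1 + T) <= 2 * (sq * T) by nra.
  apply: (Rle_trans _ _ _ h1); have -> : 1 + 1 = 2 by [].
  have h2 : 4 * / 2 <= (400 + 64 * exp 8) * (de + / 2).
    by apply: Rmult_le_compat; lra.
  by have := Rmult_le_compat_r _ _ _ sT h2; lra.
have q2 : odd q.
  case: (even_prime pq) => // q2; have := exp_ineq1_le 100000000.
  by have := ln_le_sub1 (INR q) (INR_pos q (prime_gt0 pq)); rewrite -/T q2 /=; lra.
have [K hK] := INR_ceil (exp (u / 128)) (Rlt_le _ _ (exp_pos _)).
(* A cutoff y of at least exp(T^2) makes y^(-1/T) at most exp(-T), so that the tail [T * pw T y] is
   at most 1/2. No final bound involves y. *)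
have [y hy2] := INR_ceil (exp (T * T)) (Rlt_le _ _ (exp_pos _)).
have TT : 1 <= T * T by nra.
have K0 : (0 < K)%N by case: K hK => //=; have := exp_pos (u / 128); lra.
have y0 : (0 < y)%N by case: y hy2 => //=; have := exp_pos (T * T); lra.
have Ty2 : T * T <= ln (INR y) by have := ln_mono _ _ (exp_pos _) (proj1 hy2); rewrite ln_exp.
have Ty : T <= ln (INR y) by nra.
have hy : T * pw T y <= / 2.
  apply: Rle_trans (mul_exp_opp_le T); apply: Rmult_le_compat_l; first lra.
  apply: exp_mono; apply: Ropp_le_contravar; apply: (Rmult_le_reg_r T) => //.
  by rewrite /Rdiv Rmult_assoc Rinv_l; lra.
case: d => [//|d'] in d2 ordP d0 dp d1 pp p0 ip pv od *.
pose f (v : 'I_d'.+1) := conj_pow d'.+1 chi v.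
pose near (v : 'I_d'.+1) := exists r xi, (0 < r)%N /\ (r <= K)%N /\ is_dirichlet_char r xi /\
     odd_char r xi /\ dist2 T y (fun n => f v n * xi n)%C <= 32 * ln u.
pose S := [set v | if excluded_middle_informative (near v) then true else false].
have SP v : v \in S <-> near v by rewrite inE; case: excluded_middle_informative.
(* Either #|S| P^-(d) <= d, which is the second term of the theorem, or [S] is dense enough for
   [pretender_density], which gives the first. *)
have dens : INR #|S| <= INR d'.+1 * (/ INR (pdiv d'.+1) + 50 * de).
  case: (leqP (#|S| * pdiv d'.+1) d'.+1) => h.
    have := INR_leq _ _ h; rewrite INRM => h2.
    have h3 : INR #|S| <= INR d'.+1 * / INR (pdiv d'.+1).
      apply: (Rmult_le_reg_r (INR (pdiv d'.+1))) => //.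
      by rewrite Rmult_assoc Rinv_l; lra.
    have := Rmult_le_pos (INR d'.+1) (50 * de) ltac:(lra) ltac:(lra); lra.
  have h3 : INR #|S| <= 50 * de * INR d'.+1.
    apply: (pretender_density T u y K d' f S) => //; first lra.
    - by move=> v; apply: (conj_pow_unimodular q).
    - by move=> v s n; apply: (conj_pow_add_mod q).
    - by move=> s /SP.
  have := Rmult_lt_0_compat _ _ dp ip; lra.
set B := (290 + 64 * exp 8) * (T / sqrt u).
have B0 : 0 <= B.
  apply: Rmult_le_pos; first lra.
  by left; apply: Rdiv_lt_0_compat => //; apply: sqrt_lt_R0.
have good l : (1 <= l < d'.+1)%N -> inord l \notin S -> Mmax q (char_pow chi l) <= sq * (B + 2).
  move=> /andP[l0 ld] nS; apply: Mmax_le; first by apply: Rmult_le_pos; lra.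
  move=> t; apply: (even_char_sum_bound q) => //.
  - exact: char_pow_char.
  - exact: (char_pow_nontrivial q d'.+1).
  - by rewrite /char_pow (char_minus_one q d'.+1) ?Cpow_one.
  set al := _ / _.
  have -> : sinsum (fun n => Cconj (char_pow chi l n)) al 0 q./2 = sinsum (f (inord l)) al 0 q./2.
    apply: eq_bigr => n _; congr (_ * _ * _)%C.
    by rewrite /f inordK // (conj_pow_char_pow q).
  apply: (sinsum_small T u _ T0 u_big _ y _ K) => //.
  - exact: (conj_pow_unimodular q).
  - move=> s xi s0 sK xiP odd; apply: Rnot_lt_le => h; case/negP: nS; apply/SP.
    by exists s, xi; do 4 split=> //; lra.
  - have q20 : (0 < q./2)%N by have := prime_gt1 pq; lia.
    by apply: ln_mono; [exact: INR_pos | apply: INR_leq; lia].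
(* On [S] the Pólya-Vinogradov bound is used and the small density compensates; elsewhere the
   stronger bound with B holds. The index l = 0 is absent from the sum but may be counted in #|S|,
   which only enlarges the right side. *)
apply: (Rle_trans _ (\Rsum_(1 <= l < d'.+1) (sq * (B + 2) + (if inord l \in S then 1 else 0) * (sq * (1 + T))))).
  apply: Rsum_le_nat => l hl _.
  have b2 : 0 <= sq * (B + 2) by apply: Rmult_le_pos; lra.
  case: ifP => lS; first by have := pv l hl; lra.
  by have := good l hl ltac:(by rewrite lS); lra.
rewrite big_split /= Rsum_const count_predT size_iota -big_distrl /=.
have cS : \Rsum_(1 <= l < d'.+1) (if (inord l : 'I_d'.+1) \in S then 1 else 0) <= INR #|S|.
  apply: (Rle_trans _ (\Rsum_(0 <= l < d'.+1) (if (inord l : 'I_d'.+1) \in S then 1 else 0))).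
    by rewrite [X in _ <= X]big_ltn //; case: ifP => _; lra.
  rewrite big_mkord; under eq_bigr do rewrite inord_val.
  by rewrite -big_mkcond Rsum_const Rmult_1_r cardE size_filter; right.
have su := sqrt_lt_R0 u u0; have suu := sqrt_sqrt u (Rlt_le _ _ u0).
(* Since ln u >= 1, the bound T / sqrt u outside [S] is already below T de, so the density of [S]
   determines the final rate. *)
have isu : / sqrt u <= de.
  rewrite -sqrt_inv; apply: sqrt_le_1_alt; rewrite /Rdiv -{1}(Rmult_1_l (/ u)).
  by apply: Rmult_le_compat_r => //; left; apply: Rinv_0_lt_compat.
have Tde : T / sqrt u <= T * de by apply: Rmult_le_compat_l; lra.
have one : 1 <= T * de.
  have h := param_pow_small T u erefl T0 u_big 0 isT; rewrite /= in h.
  have := Rmult_le_compat_l T _ _ (Rlt_le _ _ T0) (inv_u_le u u_big).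
  rewrite /Rdiv in h Tde *; lra.
have h1 : INR (d'.+1 - 1) * (sq * (B + 2)) <= INR d'.+1 * (sq * ((292 + 64 * exp 8) * (T * de))).
  apply: Rmult_le_compat; [exact: pos_INR | by apply: Rmult_le_pos; lra | by apply: INR_leq; lia |].
  apply: Rmult_le_compat_l => //; have := Rmult_le_compat_l (290 + 64 * exp 8) _ _ ltac:(lra) Tde.
  by rewrite -/B; lra.
have h2 : (\Rsum_(1 <= l < d'.+1) (if (inord l : 'I_d'.+1) \in S then 1 else 0)) * (sq * (1 + T)) <=
    INR d'.+1 * (/ INR (pdiv d'.+1) + 50 * de) * (2 * (sq * T)).
  apply: Rmult_le_compat; [by apply: Rsum_ge0 => l _; case: ifP => _; lra | by apply: Rmult_le_pos; lra | lra |].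
  by nra.
apply: (Rle_trans _ _ _ (Rplus_le_compat _ _ _ _ h1 h2)).
have -> : INR d'.+1 * (sq * ((292 + 64 * exp 8) * (T * de))) +
   INR d'.+1 * (/ INR (pdiv d'.+1) + 50 * de) * (2 * (sq * T)) =
   INR d'.+1 * ((sq * T) * ((392 + 64 * exp 8) * de + 2 * / INR (pdiv d'.+1))) by ring.
have -> : INR d'.+1 * ((400 + 64 * exp 8) * (sq * T) * (de + / INR (pdiv d'.+1))) =
   INR d'.+1 * ((sq * T) * ((400 + 64 * exp 8) * de + (400 + 64 * exp 8) * / INR (pdiv d'.+1))) by ring.
apply: Rmult_le_compat_l; first lra.
apply: Rmult_le_compat_l => //; apply: Rplus_le_compat; apply: Rmult_le_compat_r; lra.
Qed.
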